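(* Fix $p\ge 1$, $v\in\mathbb{R}^p$, and a $p\times p$ matrix $Q$ that is either positive definite or zero. Let $\{(X_i,Y_i)\}_{i=1}^\infty$ be random pairs with $X_i\in\mathbb{R}^p$, $Y_i\in\{0,1\}$, satisfying: (A1) the pairs are i.i.d. and $Y_i\mid X_i\sim\mathrm{Bernoulli}(G(X_i))$ for some measurable $G:\mathbb{R}^p\to(0,1)$; (A2) $\mathbb{E}X_1X_1^T$ is finite and positive definite; (A3) for every $j\in\{1,\dots,2^p\}$ and every $\beta\neq 0$, $\mathbb{P}\big((1_{S_j}(X_1)+1_{S_j}(-X_1))X_1^T\beta\neq 0\big)>0$, where $S_1,\dots,S_{2^p}$ are the open orthants of $\mathbb{R}^p$. For $n\ge1$ let $\mathcal{D}_n=\{(X_i,Y_i)\}_{i=1}^n$ and let $\rho_*(\mathcal{D}_n)$ be the geometric convergence rate of the Albert–Chib chain built from $\mathcal{D}_n$ and the prior $(v,Q)$ (defined whenever the corresponding posterior is proper, which almost surely holds for all sufficiently large $n$). Then there exists a constant $\rho<1$ such that, almost surely, $\limsup_{n\to\infty}\rho_*(\mathcal{D}_n)\le\rho$.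
   Context: Probit setting: given covariates $X_1,\dots,X_n\in\mathbb{R}^p$ and responses $Y_1,\dots,Y_n\in\{0,1\}$, let $X$ be the $n\times p$ matrix with $i$th row $X_i^T$. $\Phi,\phi$ denote the standard normal cdf and pdf. The prior density is $\omega(\beta)\propto\exp\{-\frac12(\beta-v)^TQ(\beta-v)\}$ and the posterior density is $\pi(\beta)\propto\prod_{i=1}^n\Phi(X_i^T\beta)^{Y_i}(1-\Phi(X_i^T\beta))^{1-Y_i}\omega(\beta)$, assumed proper; then $\Sigma:=X^TX+Q$ is nonsingular. $\mathrm{TN}(\theta,1;1)$ (resp. $\mathrm{TN}(\theta,1;0)$) denotes $N(\theta,1)$ truncated to $(0,\infty)$ (resp. $(-\infty,0)$). The Albert–Chib chain on $\mathbb{R}^p$ moves from $\beta$ as follows: draw $Z_i\sim\mathrm{TN}(X_i^T\beta,1;Y_i)$ independently, $Z=(Z_1,\dots,Z_n)^T$, then draw the new state from $N_p(\Sigma^{-1}(X^TZ+Qv),\Sigma^{-1})$. It is Harris ergodic with invariant distribution the posterior $\Pi$. For a Markov transition function $K$ with invariant probability $\Pi$, the geometric convergence rate is $\rho_*=\inf\{\rho\in[0,1]:$ there is $M:\mathbb{R}^p\to[0,\infty)$ with $\|K^m(x,\cdot)-\Pi\|_{TV}\le M(x)\rho^m$ for all $x$ and $m\in\mathbb{N}\}$. *)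

(* Defs.v *)
From HB Require Import structures.
From mathcomp Require Import all_boot all_order all_algebra.
From mathcomp Require Import all_classical all_reals all_analysis.
Set Implicit Arguments.
Unset Strict Implicit.
Unset Printing Implicit Defensive.
Import Order.TTheory GRing.Theory Num.Theory.
Import numFieldNormedType.Exports.
Local Open Scope classical_set_scope.
Local Open Scope ring_scope.

Section probit.
Variable R : realType.

Definition borelRk (k : nat) : set (set 'cV[R]_k) :=
  <<s [set B | exists (i : 'I_k) (A : set R),
                 measurable A /\ B = [set x : 'cV[R]_k | A (x i ord0)]] >>.

(* Lebesgue integral over R^k of an extended-real valued function,
   as the iterated one-dimensional Lebesgue integral (Tonelli). *)
Fixpoint intRk (k : nat) : ('cV[R]_k -> \bar R) -> \bar R :=
  match k with
  | 0 => fun f => f 0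
  | k'.+1 => fun f : 'cV[R]_k'.+1 -> \bar R =>
      (\int[@lebesgue_measure R]_t
         intRk (fun y : 'cV[R]_k' => f (col_mx (const_mx (t : R) : 'cV[R]_1) y)))%E
  end.

Definition phi (x : R) : R := normal_pdf 0 1 x.
Definition Phi (t : R) : R :=
  fine (\int[@lebesgue_measure R]_(x in `]-oo, t]) (phi x)%:E)%E.

Definition tn_pdf (theta : R) (y : bool) (z : R) : R :=
  if y then (if 0 < z then phi (z - theta) / Phi theta else 0)
  else (if z < 0 then phi (z - theta) / (1 - Phi theta) else 0).

Definition mvn_prec_pdf (k : nat) (m : 'cV[R]_k) (S : 'M[R]_k) (x : 'cV[R]_k) : R :=
  (Num.sqrt (2 * pi))^-k * Num.sqrt (\det S) *
  expR (- ((x - m)^T *m S *m (x - m)) ord0 ord0 / 2).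

Definition posdef (k : nat) (A : 'M[R]_k) : Prop :=
  A^T = A /\ forall u : 'cV[R]_k, u != 0 -> 0 < (u^T *m A *m u) ord0 ord0.

Section data.
Variables (p : nat) (v : 'cV[R]_p) (Q : 'M[R]_p).
(* data D_n = (Xs i, Ys i)_{i < n} *)
Variables (n : nat) (Xs : nat -> 'cV[R]_p) (Ys : nat -> bool).

Definition design : 'M[R]_(n, p) := \matrix_(i < n, j < p) Xs i j ord0.
Definition Sigma : 'M[R]_p := design^T *m design + Q.
Definition ac_mean (z : 'cV[R]_n) : 'cV[R]_p :=
  invmx Sigma *m (design^T *m z + Q *m v).

Definition latent_pdf (beta : 'cV[R]_p) (z : 'cV[R]_n) : R :=
  \prod_(i < n) tn_pdf (((Xs i)^T *m beta) ord0 ord0) (Ys i) (z i ord0).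

Definition ac_step (beta : 'cV[R]_p) (g : 'cV[R]_p -> \bar R) : \bar R :=
  intRk (fun z => ((latent_pdf beta z)%:E *
     intRk (fun b => (mvn_prec_pdf (ac_mean z) Sigma b)%:E * g b))%E).

Fixpoint ac_kernel (m : nat) (beta : 'cV[R]_p) (A : set 'cV[R]_p) : \bar R :=
  match m with
  | 0 => (\1_A beta)%:E
  | m'.+1 => ac_step beta (fun b => ac_kernel m' b A)
  end.

Definition post_unnorm (beta : 'cV[R]_p) : R :=
  (\prod_(i < n) (if Ys i then Phi (((Xs i)^T *m beta) ord0 ord0)
                  else 1 - Phi (((Xs i)^T *m beta) ord0 ord0))) *
  expR (- ((beta - v)^T *m Q *m (beta - v)) ord0 ord0 / 2).

Definition post_proper : Prop := (intRk (fun b => (post_unnorm b)%:E) < +oo)%E.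

Definition posterior (A : set 'cV[R]_p) : R :=
  fine (intRk (fun b => (post_unnorm b * \1_A b)%:E)) / fine (intRk (fun b => (post_unnorm b)%:E)).

Definition tv_dist (m : nat) (x : 'cV[R]_p) : \bar R :=
  ereal_sup [set (`|ac_kernel m x A - (posterior A)%:E|)%E | A in @borelRk p].

Definition geom_rate_set : set R :=
  [set rho | 0 <= rho <= 1 /\
     exists M : 'cV[R]_p -> R, (forall x, 0 <= M x) /\
       forall x (m : nat), (tv_dist m x <= (M x * rho ^+ m)%:E)%E].

(* geometric convergence rate rho_*(D_n); set to 1 (arbitrary) when the
   posterior is improper, where it is undefined in the paper. *)
Definition ac_rate : R :=
  if `[< post_proper >] then inf geom_rate_set else 1.

End data.

Definition orthant (p : nat) (s : 'I_p -> bool) : set 'cV[R]_p :=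
  [set x | forall i, if s i then 0 < x i ord0 else x i ord0 < 0].

End probit.

Arguments borelRk {R} k.

Section events.
Variables (R : realType) (d : measure_display) (Omega : measurableType d) (p : nat).
(* the event {(X_i, Y_i) \in B} for the Borel set
   B = (B0 x {0}) u (B1 x {1}) of R^p x {0,1} *)
Definition pair_event (X : nat -> Omega -> 'cV[R]_p) (Y : nat -> Omega -> bool)
  (i : nat) (B0 B1 : set 'cV[R]_p) : set Omega :=
  [set w | if Y i w then B1 (X i w) else B0 (X i w)].
End events.

(* Main.v *)
(** Write N(a) = a^T Sigma a and couple two copies of the chain: the truncated
normal variables are driven by common uniforms through their quantile functions,
and the two normal draws share the same noise. The quantile function of TN(theta,1;y)
at level u is 1-Lipschitz in theta, and even (1-u)-Lipschitz while theta stays on the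
side away from the half-line selected by y. If beta and beta' lie in the same closed
orthant, every observation i with (1-2Y_i) X_i in that orthant is of the second kind,
and since the integral of (1-u)^2 is 1/3, one step satisfies
E N(new - new') <= N(a) - (2/3) sum_i (X_i^T a)^2, where a = beta - beta' and i ranges
over these observations. So if eps N(a) is at most this last sum for every orthant
and every a, cutting a segment at the coordinate hyperplanes shows that the chain
contracts the distance sqrt N with ratio sqrt (1 - 2 eps / 3); the Gaussian draw turns
this distance into total variation.

A strong law along n = 2^k bounds the sum from below and N(a) from above by
multiples of n |a|^2, almost surely for all large n. By monotonicity in n a subsequence
of powers of two suffices, so Chebyshev's inequality and the Borel-Cantelli lemma are
enough. The lower bound is nondegenerate for every orthant by (A3), since G takes
its values in (0,1). *)

Require Import Defs.
From HB Require Import structures.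
From mathcomp Require Import all_boot all_order all_algebra.
From mathcomp Require Import all_classical all_reals all_analysis.
From mathcomp Require Import measurable_realfun ring lra.
Set Implicit Arguments.
Unset Strict Implicit.
Unset Printing Implicit Defensive.
Import Order.TTheory GRing.Theory Num.Theory.
Import numFieldNormedType.Exports.
Local Open Scope classical_set_scope.
Local Open Scope ring_scope.

(** * Lebesgue measure on column vectors *)

(** The two copies of the chain are never built as processes. A coupling is used only as an
    inequality on test functions, and a step of the chain acts as an operator on functions, so no
    transport distance has to be defined. The distance $\sqrt N$ enters as the infimum over $s>0$ of
    $(s+N/s)/2$ with $s$ left free: such a bound is linear in $N$, so it can be integrated knowing
    only a second moment, and the square root of the one-step factor comes out by rescaling $s$.

    The obstacle is that an observation whose predictor is far on its own side has quantiles that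
    move almost as fast as the mean. A gain uniform over pairs of states can come only from
    observations on the wrong side, and which ones these are depends on the state. Fixing a closed
    orthant freezes a set of them, which is why segments are cut at the hyperplanes.

    The same observations give the posterior Gaussian tails even when $Q=0$: properness and the
    second moment behind $M(x)$ follow from the condition that yields the contraction. *)

Section sigma_finite_pack.
Context d (T : measurableType d) (R : realType) (nu : {measure set T -> \bar R}).
Hypothesis nu_sf : sigma_finite setT nu.

(** An alias that carries the proof [nu_sf] as a canonical structure, the form in which product
    measures and Tonelli's theorem ask for sigma-finiteness. *)
Definition sigma_finite_of : set T -> \bar R := nu.
HB.instance Definition _ := Measure.on sigma_finite_of.
HB.instance Definition _ := Measure_isSigmaFinite.Build _ _ _ sigma_finite_of nu_sf.

Lemma sigma_finite_pack :
  exists nu' : {sigma_finite_measure set T -> \bar R}, nu' = nu :> (set T -> \bar R).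
Proof. by exists sigma_finite_of. Qed.
End sigma_finite_pack.

Lemma sigma_finite_prod d1 d2 (T1 : measurableType d1) (T2 : measurableType d2) (R : realType)
  (m1 : {sigma_finite_measure set T1 -> \bar R}) (m2 : {sigma_finite_measure set T2 -> \bar R}) :
  exists nu : {sigma_finite_measure set (T1 * T2)%type -> \bar R},
    nu = (m1 \x m2)%E :> (set (T1 * T2) -> \bar R).
Proof.
apply: (@sigma_finite_pack _ _ _ [the measure _ _ of (m1 \x m2)%E]).
have /sigma_finiteP[F [TF ndF Foo]] := sigma_finiteT m1.
have /sigma_finiteP[G [TG ndG Goo]] := sigma_finiteT m2.
exists (fun n => F n `*` G n).
  apply/esym/seteqP; split=> // -[x y] _.
  have [i _ Fi] : (\bigcup_i F i) x by rewrite -TF.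
  have [j _ Gj] : (\bigcup_i G i) y by rewrite -TG.
  exists (maxn i j) => //; split=> /=.
  - exact: (subsetPset _ _ (ndF _ _ (leq_maxl i j))).
  - exact: (subsetPset _ _ (ndG _ _ (leq_maxr i j))).
move=> k; have [? ?] := Foo k; have [? ?] := Goo k.
split; first exact: measurableX.
by rewrite /= product_measure1E// lte_mul_pinfty// ge0_fin_numE.
Qed.

Section sigma_finite_image.
Context d1 d2 (T1 : measurableType d1) (T2 : measurableType d2) (R : realType).
Variables (mu : {sigma_finite_measure set T1 -> \bar R}) (f : T1 -> T2) (g : T2 -> T1).

(** The left inverse [g] transports the exhausting sets: the preimage under [f] of $g^{-1}(F_n)$ is
    $F_n$ again, of finite measure. *)
Lemma sigma_finite_image : measurable_fun setT f -> measurable_fun setT g -> cancel f g ->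
  exists nu : {sigma_finite_measure set T2 -> \bar R},
  forall h : T2 -> \bar R, measurable_fun setT h -> (forall x, 0 <= h x)%E ->
    (\int[nu]_x h x = \int[mu]_x h (f x))%E.
Proof.
move=> mf mg fK.
pose nu : {measure set T2 -> \bar R} :=
  measure_function_pushforward__canonical__measure_function_Measure mu mf.
have nu_sf : sigma_finite setT nu.
  have [F TF Foo] := sigma_finiteT mu.
  exists (fun n => g @^-1` F n).
    by rewrite -preimage_bigcup -TF preimage_setT.
  move=> i; have [mF Fi] := Foo i; split.
    by rewrite -[X in measurable X]setTI; exact: mg.
  rewrite /nu /= /pushforward -comp_preimage.
  by rewrite (_ : _ \o _ = id) ?preimage_id//; apply/funext => x /=; exact: fK.
have [nu' nu'E] := sigma_finite_pack nu_sf.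
exists nu' => h mh h0.
rewrite nu'E.
by rewrite [LHS](@ge0_integral_pushforward _ _ _ _ _ f mf mu) // preimage_setT.
Qed.
End sigma_finite_image.

Section vector_space_measure.
Variable R : realType.

Definition cyl (k : nat) : set (set 'cV[R]_k) :=
  [set B | exists (i : 'I_k) (A : set R),
                 measurable A /\ B = [set x : 'cV[R]_k | A (x i ord0)]].

Arguments cyl : clear implicits.
(** The measurable type of column vectors. Its measurable sets are by conversion those of
    [borelRk k], so hypotheses on Borel sets apply to it directly. *)
Definition Vk (k : nat) := g_sigma_algebraType (cyl k).
HB.instance Definition _ k := Measurable.on (Vk k).

Lemma measurable_coord k (i : 'I_k) : measurable_fun setT (fun x : Vk k => x i ord0 : R).
Proof.
move=> _ A mA; rewrite setTI; apply: sub_sigma_algebra.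
by exists i, A.
Qed.

Lemma measurable_toVk d (T : measurableType d) k (f : T -> Vk k) :
  (forall i, measurable_fun setT (fun x => f x i ord0 : R)) -> measurable_fun setT f.
Proof.
move=> mf; apply: (@measurability _ _ T (Vk k) setT f (cyl k)) => //.
by move=> _ [B [i [A [mA ->]]] <-]; exact: mf.
Qed.

Definition consV k (ty : R * 'cV[R]_k) : 'cV[R]_k.+1 :=
  col_mx (const_mx ty.1 : 'cV[R]_1) ty.2.
Definition headtailV k (x : 'cV[R]_k.+1) : R * 'cV[R]_k :=
  (x ord0 ord0, @dsubmx R 1 k 1 x).

Lemma consV0 k (ty : R * 'cV[R]_k) : consV ty ord0 ord0 = ty.1.
Proof.
rewrite /consV (_ : ord0 = @lshift 1 k ord0); last exact/val_inj.
by rewrite (@col_mxEu R 1 k) mxE.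
Qed.

Lemma consVS k (ty : R * 'cV[R]_k) i : consV ty (lift ord0 i) ord0 = ty.2 i ord0.
Proof.
rewrite /consV (_ : lift ord0 i = @rshift 1 k i); last exact/val_inj.
by rewrite (@col_mxEd R 1 k).
Qed.

Lemma headtailVK k : cancel (@headtailV k) (@consV k).
Proof.
move=> x; apply/matrixP => i j; rewrite ord1.
have [j' ->|->] := unliftP ord0 i; last by rewrite consV0.
rewrite consVS mxE; congr (x _ _); exact/val_inj.
Qed.

Lemma consVK k : cancel (@consV k) (@headtailV k).
Proof.
by move=> [t y]; rewrite /headtailV consV0 /= /consV (@col_mxKd R 1 k).
Qed.

Lemma measurable_consV k :
  measurable_fun setT (@consV k : (R * Vk k)%type -> Vk k.+1).
Proof.
apply: measurable_toVk => i.
have [j ->|->] := unliftP ord0 i.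
  under eq_fun do rewrite consVS.
  exact: (measurableT_comp (@measurable_coord k j) measurable_snd).
by under eq_fun do rewrite consV0; exact: measurable_fst.
Qed.

Lemma measurable_headtailV k :
  measurable_fun setT (@headtailV k : Vk k.+1 -> (R * Vk k)%type).
Proof.
apply: measurable_fun_pair; first exact: measurable_coord.
apply: measurable_toVk => i; under eq_fun do rewrite mxE.
exact: measurable_coord.
Qed.

(** Tonelli turns one more iterated integral into an integral over a product, and [consV] carries
    the product measure to vectors of length $k+1$. *)
Lemma leb_succ_subproof k (mu : {sigma_finite_measure set (Vk k) -> \bar R}) :
  (forall f : Vk k -> \bar R, measurable_fun setT f ->
    (forall x, 0 <= f x)%E -> intRk f = (\int[mu]_x f x)%E) ->
  exists nu : {sigma_finite_measure set (Vk k.+1) -> \bar R},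
  forall f : Vk k.+1 -> \bar R, measurable_fun setT f ->
    (forall x, 0 <= f x)%E -> intRk f = (\int[nu]_x f x)%E.
Proof.
move=> IH.
have [prod prodE] := sigma_finite_prod (@lebesgue_measure R) mu.
have [nu nuE] := sigma_finite_image prod
  (@measurable_consV k) (@measurable_headtailV k) (@consVK k).
exists nu => g mg g0.
have mgf := measurableT_comp mg (@measurable_consV k).
transitivity (\int[@lebesgue_measure R]_t \int[mu]_y (g (consV (t, y))))%E.
  rewrite /=; apply: eq_integral => t _; rewrite IH //.
  have mp : measurable_fun setT (fun y : Vk k => ((t : measurableTypeR R), y)).
    by apply: measurable_fun_pair.
  exact: (measurableT_comp mgf mp).
rewrite nuE // prodE.
rewrite (@fubini_tonelli1 _ _ (measurableTypeR R) (Vk k) _ _ _ (fun x => g (consV x))) //=.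
Qed.

Lemma leb_subproof k : exists mu : {sigma_finite_measure set (Vk k) -> \bar R},
  forall f : Vk k -> \bar R, measurable_fun setT f ->
    (forall x, 0 <= f x)%E -> intRk f = (\int[mu]_x f x)%E.
Proof.
elim: k => [|k [mu IH]]; last exact: (@leb_succ_subproof k mu).
exists (\d_ (0 : Vk 0)) => f mf f0.
by rewrite integral_dirac //= diracT mul1e.
Qed.

(** Lebesgue measure on $\mathbb{R}^k$, known only through [intRkE]: it represents the iterated
    integral [intRk] on nonnegative measurable functions. It makes convergence theorems, Tonelli and
    almost-everywhere arguments available for [intRk]. *)
Definition leb k : {sigma_finite_measure set (Vk k) -> \bar R} :=
  projT1 (cid (leb_subproof k)).

Lemma intRkE k (f : Vk k -> \bar R) : measurable_fun setT f ->
  (forall x, 0 <= f x)%E -> intRk f = (\int[leb k]_x f x)%E.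
Proof. exact: projT2 (cid (leb_subproof k)) f. Qed.

Lemma integral_consV k (f : Vk k.+1 -> \bar R) : measurable_fun setT f ->
  (forall x, 0 <= f x)%E ->
  (\int[leb k.+1]_x f x = \int[@lebesgue_measure R]_t \int[leb k]_y f (consV (t, y)))%E.
Proof.
move=> mf f0; rewrite -intRkE //=; apply: eq_integral => t _; rewrite intRkE //.
have mp : measurable_fun setT (fun y : Vk k => ((t : measurableTypeR R), y)).
  by apply: measurable_fun_pair.
exact: (measurableT_comp mf (measurableT_comp (@measurable_consV k) mp)).
Qed.

End vector_space_measure.

(** * Quantiles of the truncated normal distribution *)

Section transfer.
Context d1 d2 d3 (T1 : measurableType d1) (T2 : measurableType d2)
  (S : measurableType d3) (R : realType).
Variables (mu1 : {measure set T1 -> \bar R}) (mu2 : {measure set T2 -> \bar R}).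
Variables (w1 : T1 -> R) (w2 : T2 -> R) (q1 : T1 -> S) (q2 : T2 -> S).
Hypotheses (mw1 : measurable_fun setT w1) (mw2 : measurable_fun setT w2)
  (mq1 : measurable_fun setT q1) (mq2 : measurable_fun setT q2).
Hypotheses (w1_ge0 : forall x, 0 <= w1 x) (w2_ge0 : forall x, 0 <= w2 x).
Local Open Scope ereal_scope.
Import HBNNSimple.

Lemma integral_weight_nnsfun d (T : measurableType d) (mu : {measure set T -> \bar R})
  (w : T -> R) (q : T -> S) (f : {nnsfun S >-> R}) :
  measurable_fun setT w -> measurable_fun setT q -> (forall x, 0 <= w x)%R ->
  \int[mu]_x ((w x)%:E * (f (q x))%:E) =
  \sum_(r \in range f) (r%:E * \int[mu]_x ((w x)%:E * (\1_(f @^-1` [set r]) (q x))%:E)).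
Proof.
move=> mw mq w0.
have mi r : measurable_fun setT (fun x => (\1_(f @^-1` [set r]) (q x))%:E : \bar R).
  by apply/measurable_EFinP; apply: (measurableT_comp _ mq).
have mt r : measurable_fun setT (fun x => (w x)%:E * (\1_(f @^-1` [set r]) (q x))%:E).
  by apply: emeasurable_funM => //; exact/measurable_EFinP.
transitivity (\int[mu]_x (\sum_(r \in range f) (r%:E * ((w x)%:E * (\1_(f @^-1` [set r]) (q x))%:E)))).
  apply: eq_integral => x _; rewrite fimfunE -fsumEFin// ge0_mule_fsumr; last first.
    by move=> r; rewrite EFinM nnfun_muleindic_ge0.
  by apply: eq_fsbigr => r _; rewrite EFinM muleCA.
rewrite ge0_integral_fsum//; last 2 first.
- by move=> r; apply: emeasurable_funM.
- move=> r x _; rewrite muleCA mule_ge0 ?lee_fin //.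
  by rewrite -lee_fin EFinM nnfun_muleindic_ge0.
apply: eq_fsbigr => r; rewrite inE => -[y _ yr]; rewrite ge0_integralZl//.
- by move=> x _; rewrite mule_ge0 ?lee_fin.
- by rewrite lee_fin -yr.
Qed.

Lemma cvg_integral_weight d (T : measurableType d) (mu : {measure set T -> \bar R})
  (w : T -> R) (q : T -> S) (h : S -> \bar R) (mh : measurable_fun setT h) :
  measurable_fun setT w -> measurable_fun setT q -> (forall x, 0 <= w x)%R ->
  (forall x, 0 <= h x) ->
  \int[mu]_x ((w x)%:E * h (q x)) =
  limn (fun n => \int[mu]_x ((w x)%:E * (nnsfun_approx measurableT mh n (q x))%:E)).
Proof.
move=> mw mq w0 h0; rewrite -monotone_convergence //.
- apply: eq_integral => x _; apply/esym/cvg_lim => //.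
  by apply: cvgeZl => //; apply: cvg_nnsfun_approx.
- move=> n; apply: emeasurable_funM; first exact/measurable_EFinP.
  by apply/measurable_EFinP; apply: (measurableT_comp _ mq).
- by move=> n x _; rewrite mule_ge0 ?lee_fin.
- move=> x _ m n mn; rewrite lee_pmul ?lee_fin //.
  exact/lefP/nd_nnsfun_approx.
Qed.

(** The usual extension from indicators to simple functions and then to monotone limits, for two
    weighted measures on different spaces having the same image. *)
Lemma integral_transfer :
  (forall A, measurable A -> \int[mu1]_x ((w1 x)%:E * (\1_A (q1 x))%:E) =
     \int[mu2]_x ((w2 x)%:E * (\1_A (q2 x))%:E)) ->
  forall h : S -> \bar R, measurable_fun setT h -> (forall x, 0 <= h x) ->
  \int[mu1]_x ((w1 x)%:E * h (q1 x)) = \int[mu2]_x ((w2 x)%:E * h (q2 x)).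
Proof.
move=> H h mh h0; rewrite !(@cvg_integral_weight _ _ _ _ _ h mh) //.
congr (limn _); apply/funext => n; rewrite !integral_weight_nnsfun //.
by apply: eq_fsbigr => r _; rewrite H.
Qed.
End transfer.

(** * Translation and reflection invariance of Lebesgue measure on the line *)

Section shift.
Variable R : realType.
Local Notation mu := (@lebesgue_measure R).

Lemma lebesgue_measure_shift (a : R) (A : set R) : measurable A ->
  pushforward mu (fun x : R => x + a : measurableTypeR R) A = mu A.
Proof.
have ma : measurable_fun setT (fun x : R => x + a : R) by exact: measurable_funD.
move=> mA; apply/esym.
pose nu := measure_function_pushforward__canonical__measure_function_Measure
  mu (ma : measurable_fun setT (fun x : measurableTypeR R => x + a : measurableTypeR R)).
apply: (lebesgue_measure_unique (mu := nu)) => //= _ [[x y]] _ <-.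
rewrite /nu /= /pushforward /=.
rewrite (_ : _ @^-1` _ = `](x - a), (y - a)]%classic); last first.
  by apply/seteqP; split => z /=; rewrite !in_itv/= ltrBlDr lerBrDr.
by rewrite [LHS]lebesgue_measure_itv [RHS]lebesgue_measure_itv /= !lte_fin ltrD2r -!EFinB opprB addrA subrK.
Qed.

Lemma integral_shift (a : R) (f : R -> \bar R) : measurable_fun setT f ->
  (forall x, 0 <= f x)%E -> (\int[mu]_x f ((x : R) + a)%R = \int[mu]_x f x)%E.
Proof.
move=> mf f0.
have ma : measurable_fun setT (fun x : R => x + a : R) by exact: measurable_funD.
transitivity (\int[pushforward mu (fun x : R => (x + a)%R : measurableTypeR R)]_x f x)%E.
  by rewrite (@ge0_integral_pushforward _ _ (measurableTypeR R) (measurableTypeR R) R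
    (fun x : R => x + a) ma mu setT f) // preimage_setT.
by apply: eq_measure_integral => // A mA _; exact: lebesgue_measure_shift.
Qed.

Lemma integral_comp_opp (f : R -> \bar R) : measurable_fun setT f ->
  (forall x, 0 <= f x)%E -> (\int[mu]_x f (- (x : R))%R = \int[mu]_x f x)%E.
Proof.
move=> mf f0.
have ma : measurable_fun setT (fun x : R => - x : R) by exact: measurableT_comp.
transitivity (\int[pushforward mu (fun x : R => (- x)%R : measurableTypeR R)]_x f x)%E.
  by rewrite (@ge0_integral_pushforward _ _ (measurableTypeR R) (measurableTypeR R) R
    (fun x : R => - x) ma mu setT f) // preimage_setT.
by apply: eq_measure_integral => // A mA _; exact: lebesgue_measureN.
Qed.
End shift.

(** * The standard normal distribution function: tails, log-concavity, contraction *)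

Section gaussian_cdf.
Variable R : realType.
Local Notation mu := (@lebesgue_measure R).
Implicit Types x y t u d : R.

Lemma phiE x : phi x = normal_peak (1 : R) * expR (- (x ^+ 2 / 2)).
Proof.
rewrite /phi normal_pdfE ?oner_eq0 // /normal_fun subr0 expr1n.
by rewrite mulNr.
Qed.

Lemma phi_gt0 x : 0 < phi x.
Proof. by rewrite phiE mulr_gt0 ?expR_gt0 // normal_peak_gt0 // oner_eq0. Qed.

Lemma phiN x : phi (- x) = phi x.
Proof. by rewrite !phiE sqrrN. Qed.

Lemma phiD x d : phi (x + d) = phi x * expR (- (x * d) - d ^+ 2 / 2).
Proof. rewrite [LHS]phiE [phi x]phiE -[RHS]mulrA -[in RHS]expRD; congr (_ * expR _).
by field. Qed.

Lemma phi_le x y : `|y| <= `|x| -> phi x <= phi y.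
Proof.
move=> xy; rewrite !phiE ler_pM2l ?normal_peak_gt0 ?oner_eq0 // ler_expR lerN2.
by rewrite ler_pM2r // -[x ^+ 2]real_normK ?num_real // -[y ^+ 2]real_normK ?num_real // lerXn2r ?nnegrE.
Qed.

Lemma measurable_phi : measurable_fun setT (@phi R).
Proof. exact: measurable_normal_pdf. Qed.

Lemma continuous_phi : continuous (@phi R).
Proof. by apply: continuous_normal_pdf; rewrite oner_eq0. Qed.

Lemma integral_phi : (\int[mu]_x (phi x)%:E = 1)%E.
Proof. exact: integral_normal_pdf. Qed.

Lemma integrable_phi : mu.-integrable setT (EFin \o @phi R).
Proof. exact: integrable_normal_pdf. Qed.

Lemma Phi_integral t : (Phi t)%:E = (\int[mu]_(x in `]-oo, t]) (phi x)%:E)%E.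
Proof.
rewrite fineK //; apply: integrable_fin_num => //.
exact: (integrableS measurableT _ (@subsetT _ _) integrable_phi).
Qed.

Lemma Phi_compl_integral t : (1 - Phi t)%:E = (\int[mu]_(x in `]t, +oo[) (phi x)%:E)%E.
Proof.
rewrite EFinB Phi_integral -integral_phi.
rewrite -(setUv `]-oo, t]) ge0_integral_setU //=; last 4 first.
- exact: measurableC.
- by apply/measurable_EFinP; apply: measurable_funTS; exact: measurable_phi.
- by move=> x _; rewrite lee_fin ltW ?phi_gt0.
- by rewrite disj_set2E setICr.
rewrite setCitvl addeAC -Phi_integral subee ?add0e //.
Qed.

Lemma PhiN t : Phi (- t) = 1 - Phi t.
Proof.
apply: EFin_inj; rewrite Phi_compl_integral Phi_integral.
rewrite [RHS]integral_mkcond -[RHS]integral_comp_opp; last 2 first.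
- apply/(measurable_restrictT _ _).1 => //.
  by apply/measurable_EFinP; apply: measurable_funTS; exact: measurable_phi.
- by move=> x; rewrite erestrict_ge0 // => y _; rewrite lee_fin ltW ?phi_gt0.
rewrite -integral_itv_bndo_bndc; last first.
  by apply/measurable_EFinP; apply: measurable_funTS; exact: measurable_phi.
rewrite integral_mkcond; apply: eq_integral => x _; rewrite !patchE.
by rewrite !mem_setE !in_itv /= andbT ltrNr phiN.
Qed.

Lemma is_derive_Phi t : is_derive (t : R^o) 1 (@Phi R) (phi t).
Proof.
have [|||d1 d2] := @continuous_FTC1 R (@phi R) -oo%O t (t + 1) _ _ _ (@continuous_phi t).
- by rewrite ltrDl.
- exact: (integrableS measurableT _ (@subsetT _ _) integrable_phi).
- by rewrite ltNyr.
 rewrite (_ : @Phi R = fun x => (\int[mu]_(t in `]-oo, x]) phi t)%R); last exact/funext.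
by apply: DeriveDef; [exact: d1|rewrite -derive1E; exact: d2].
Qed.

Lemma continuous_Phi : continuous (@Phi R).
Proof.
by move=> t; apply/differentiable_continuous/derivable1_diffP; have [] := is_derive_Phi t.
Qed.

Lemma derive_ge0_le (f df : R -> R) (a b : R) : a <= b ->
  (forall x, is_derive (x : R^o) 1 f (df x)) ->
  (forall x, a < x < b -> 0 <= df x) -> f a <= f b.
Proof.
rewrite le_eqVlt => /predU1P[->//|ab] fd df0.
have [|c cab] := @MVT R f df a b ab (fun x _ => fd x).
  apply: continuous_subspaceT => x.
  by apply/differentiable_continuous/derivable1_diffP; have [] := fd x.
rewrite in_itv /= in cab.
by move=> /eqP; rewrite subr_eq => /eqP ->; rewrite lerDr mulr_ge0 ?df0 // subr_ge0 ltW.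
Qed.

Lemma is_derive_Phi_affine a b x :
  is_derive (x : R^o) 1 (fun x => Phi (a + x * b)) (phi (a + x * b) * b).
Proof.
apply: (@is_derive1_comp R (@Phi R) (fun x => a + x * b)); first exact: is_derive_Phi.
apply: (@is_derive_eq _ _ _ _ _ _ _ (0 + (x *: (0 : R) + b *: (1 : R)))).
by rewrite scaler0 !add0r; exact: mulr1.
Qed.

Lemma Phi_lt x y : x < y -> Phi x < Phi y.
Proof.
move=> xy; have [|c cab] := @MVT R (@Phi R) (@phi R) x y xy (fun x _ => is_derive_Phi x).
  by apply: continuous_subspaceT; exact: continuous_Phi.
by rewrite -subr_gt0 => ->; rewrite mulr_gt0 ?phi_gt0 // subr_gt0.
Qed.

Lemma Phi_le x y : (Phi x <= Phi y) = (x <= y).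
Proof.
have [xy|xy] := ltP y x.
  by apply/negbTE; rewrite -ltNge Phi_lt.
by move: xy; rewrite le_eqVlt => /predU1P[->|/Phi_lt/ltW //]; exact: lexx.
Qed.

Lemma Phi_ltE x y : (Phi x < Phi y) = (x < y).
Proof. by rewrite !ltNge Phi_le. Qed.

Lemma Phi_ge0 x : 0 <= Phi x.
Proof. by rewrite -lee_fin Phi_integral integral_ge0 // => y _; rewrite lee_fin ltW ?phi_gt0. Qed.

Lemma Phi_gt0 x : 0 < Phi x.
Proof. by apply: le_lt_trans (Phi_ge0 (x - 1)) _; rewrite Phi_ltE ltrBlDr ltrDl. Qed.

Lemma Phi_lt1 x : Phi x < 1.
Proof. by rewrite -subr_gt0 -PhiN Phi_gt0. Qed.

Lemma Phi0 : Phi 0 = 1 / 2 :> R.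
Proof. by have := PhiN 0; rewrite oppr0 => h; lra. Qed.

Lemma measurable_Phi : measurable_fun setT (@Phi R).
Proof. by apply: nondecreasing_measurable => // x y; rewrite Phi_le. Qed.

Lemma Phi_integral_shift a t :
  (\int[mu]_(z in `]-oo, a]) (phi (z - t))%:E = (Phi (a - t))%:E)%E.
Proof.
rewrite Phi_integral integral_mkcond [RHS]integral_mkcond.
rewrite -[RHS](@integral_shift R (- t)); last 2 first.
- apply/(measurable_restrictT _ _).1 => //.
  by apply/measurable_EFinP; apply: measurable_funTS; exact: measurable_phi.
- by move=> x; rewrite erestrict_ge0 // => y _; rewrite lee_fin ltW ?phi_gt0.
by apply: eq_integral => x _; rewrite !patchE !mem_setE !in_itv /= lerD2r.
Qed.

(** For $z\le 0\le t$ one has $\phi(z-t)=\phi(z)e^{zt-t^2/2}\le e^{-t^2/2}\phi(z)$; integrate over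
    $z\le 0$. This is also the source of the Gaussian tails of the posterior. *)
Lemma Phi_tail_le t : 0 <= t -> Phi (- t) <= expR (- (t ^+ 2 / 2)).
Proof.
move=> t0; rewrite -lee_fin -[X in Phi X]add0r -Phi_integral_shift.
have le1 : (\int[mu]_(z in `]-oo, 0%R]) (phi (z - t))%:E <=
    \int[mu]_(x in `]-oo, 0%R]) ((expR (- (t ^+ 2 / 2)))%:E * (phi x)%:E))%E.
  apply: ge0_le_integral => //=.
  - by move=> x _; rewrite lee_fin ltW ?phi_gt0.
  - apply/measurable_EFinP; apply: (measurableT_comp measurable_phi); exact: measurable_funB.
  - apply/measurable_EFinP; apply: measurable_funM => //; apply: measurable_funTS; exact: measurable_phi.
  - move=> x; rewrite in_itv /= => x0.
    rewrite -EFinM lee_fin phiD mulrC ler_pM2r ?phi_gt0 // ler_expR sqrrN.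
    by rewrite mulrN opprK gerDr // mulr_le0_ge0.
apply: (le_trans le1); rewrite ge0_integralZl //; last 2 first.
- by apply/measurable_EFinP; apply: measurable_funTS; exact: measurable_phi.
- by move=> x _; rewrite lee_fin ltW ?phi_gt0.
rewrite -Phi_integral -EFinM lee_fin ler_piMr ?expR_ge0 //.
exact/ltW/Phi_lt1.
Qed.

Lemma Phi_small e : 0 < e -> exists x, Phi x < e.
Proof.
(* With $t=1+2/e\ge 1$, $\exp(t^2/2)\ge\exp(t/2)\ge 1+t/2>1/e$. *)
move=> e0; exists (- (1 + e^-1 *+ 2)); set t := 1 + _.
have t1 : 1 <= t by rewrite lerDl mulrn_wge0 // invr_ge0 ltW.
apply: le_lt_trans (Phi_tail_le (le_trans ler01 t1)) _.
rewrite expRN invf_plt ?posrE ?expR_gt0 //.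
have h : t / 2 <= t ^+ 2 / 2 by rewrite ler_pM2r // expr2 ler_peMl // (le_trans ler01).
apply: lt_le_trans (le_trans (expR_ge1Dx _) _); last by rewrite ler_expR; exact: h.
rewrite /t; lra.
Qed.

(** Log-concavity of $\Phi$, with no logarithm or Mills ratio. For $k=\phi(A+d)/\phi(A)$ the
    function $F(x)=\Phi(x+d)-k\Phi(x)$ increases up to $A$ and decreases afterwards, so $F(th)\le
    F(A)$ and $F(A)\ge 0$. Then $\Phi(A)F(th)\le\Phi(th)F(A)$, which is the claim after adding
    $k\Phi(A)\Phi(th)$. *)
Lemma Phi_logconcave A th d : A <= th -> 0 <= d ->
  Phi A * Phi (th + d) <= Phi (A + d) * Phi th.
Proof.
move=> Ath d0.
pose k := expR (- (A * d) - d ^+ 2 / 2).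
pose F x := Phi (d + x * 1) - k * Phi x.
pose dF x := phi x * (expR (- (x * d) - d ^+ 2 / 2) - k).
have FD x : is_derive (x : R^o) 1 F (dF x).
  rewrite (_ : dF x = phi (d + x * 1) * 1 - k *: phi x); last first.
    by rewrite /dF mulrBr -phiD !mulr1 [d + _]addrC [phi x * k]mulrC.
  apply: is_deriveB; first exact: is_derive_Phi_affine.
  by apply: is_deriveZ; exact: is_derive_Phi.
have Fth : F th <= F A.
  rewrite -lerN2; apply: (@derive_ge0_le (- F) (- dF)) => // x /andP[Ax xt].
  rewrite -[(- dF) x]/(- dF x) oppr_ge0 pmulr_rle0 ?phi_gt0 // subr_le0 ler_expR.
  by rewrite lerD2r lerN2 ler_wpM2r // ltW.
have FE x : F x = Phi (x + d) - k * Phi x by rewrite /F mulr1 [d + x]addrC.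
(* $F$ is nondecreasing up to $A$ and bounded below by $-k\Phi$, which is arbitrarily close to $0$
   far to the left. *)
have FA : 0 <= F A.
  rewrite leNgt; apply/negP => FA0.
  have k0 : 0 < k by exact: expR_gt0.
  have [x xe] : exists x, Phi x < (- F A) / k by apply: Phi_small; rewrite divr_gt0 // oppr_gt0.
  have [xA|/ltW Ax] := leP x A; last first.
    have : Phi A < - F A / k by apply: le_lt_trans xe; rewrite Phi_le.
    rewrite ltr_pdivlMr // FE => h.
    have := Phi_gt0 (A + d); lra.
  have : F x <= F A.
    apply: (@derive_ge0_le F dF) => // z /andP[_ zA].
    rewrite /dF pmulr_rge0 ?phi_gt0 // subr_ge0 ler_expR.
    by rewrite lerD2r lerN2 ler_wpM2r // ltW.
  move: xe; rewrite ltr_pdivlMr // !FE => h1 h2.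
  have := Phi_gt0 (x + d); lra.
rewrite !FE in Fth FA.
have := Phi_gt0 A; have := Phi_gt0 th; have : Phi A <= Phi th by rewrite Phi_le.
nra.
Qed.

(** $G(x)=u\Phi(th+x)-\Phi(A+xu)$ vanishes at $0$ and has derivative $u(\phi(th+x)-\phi(A+xu))$.
    This is nonnegative because $A+xu\le th+x\le 0$ and $\phi$ increases on the negative half-line.
    Moving $A$ at speed $u$ is what lets the factor $u$ come out of both terms. *)
Lemma Phi_contract A th d u : 0 <= d -> 0 <= u <= 1 -> A <= th -> th + d <= 0 ->
  Phi A = u * Phi th -> Phi (A + d * u) <= u * Phi (th + d).
Proof.
move=> d0 /andP[u0 u1] Ath thd AE.
pose G x := u * Phi (th + x) - Phi (A + x * u).
pose dG x := u * phi (th + x) - phi (A + x * u) * u.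
have : G 0 <= G d.
  apply: (@derive_ge0_le G dG) => // [x|x /andP[x0 xd]].
    apply: is_deriveB; last exact: is_derive_Phi_affine.
    have := is_derive_Phi_affine th 1 x; rewrite !mulr1 => dP.
    apply: is_deriveZ; rewrite (_ : (fun x => _) = fun x => Phi (th + x * 1)) //.
    by apply/funext => z; rewrite mulr1.
  rewrite /dG [X in _ - X]mulrC -mulrBr mulr_ge0 // subr_ge0 phi_le //.
  have h1 : th + x <= 0 by rewrite (le_trans _ thd) // lerD2l ltW.
  have h2 : A + x * u <= th + x.
    by rewrite lerD // ler_piMr // ltW.
  by rewrite !ler0_norm ?lerN2 // (le_trans h2).
by rewrite /G addr0 mul0r addr0 AE subrr subr_ge0.
Qed.

(** * Normal and truncated normal quantiles *)

Lemma Phi_surj t : 0 < t < 1 -> exists x, Phi x = t.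
Proof.
move=> /andP[t0 t1].
have [a at_] := Phi_small t0.
have [b bt] : exists x, Phi x < 1 - t by apply: Phi_small; rewrite subr_gt0.
have tb : t < Phi (- b) by rewrite PhiN ltrBrDr addrC -ltrBrDr.
have ab : a <= - b by rewrite -Phi_le ltW // (lt_trans at_).
have [|c _ <-] := @IVT R (@Phi R) a (- b) t ab (continuous_subspaceT continuous_Phi).
  by rewrite ge_min le_max (ltW at_) (ltW tb) orbT.
by exists c.
Qed.

(** The normal quantile function, with default value $0$ outside $]0,1[$. *)
Definition iPhi t := xget 0 [set x | Phi x = t].

Lemma PhiK t : 0 < t < 1 -> Phi (iPhi t) = t.
Proof. by move=> /Phi_surj[x xt]; rewrite /iPhi; case: xgetP => [y _ //|/(_ x)]. Qed.

Lemma iPhi_le t x : 0 < t < 1 -> (iPhi t <= x) = (t <= Phi x).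
Proof. by move=> t01; rewrite -[LHS]Phi_le PhiK. Qed.

Lemma le_iPhi t x : 0 < t < 1 -> (x <= iPhi t) = (Phi x <= t).
Proof. by move=> t01; rewrite -[LHS]Phi_le PhiK. Qed.

Lemma iPhi_lt t x : 0 < t < 1 -> (iPhi t < x) = (t < Phi x).
Proof. by move=> t01; rewrite !ltNge le_iPhi. Qed.

(* [tnq th true u] is the upper [u]-quantile of N(th, 1) truncated to the positive half-line. *)
Definition tnq (th : R) (y : bool) (u : R) : R :=
  if y then th - iPhi (u * Phi th) else th + iPhi (u * Phi (- th)).

(** The reflection $z\mapsto -z$ exchanges the two truncations, so estimates are needed for
    [y = true] only. *)
Lemma tnqN th (y : bool) u : tnq th y u = - tnq (- th) (~~ y) u.
Proof. by case: y; rewrite /tnq /= ?opprK opprD !opprK. Qed.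

Lemma tn_pdfN th (y : bool) z : tn_pdf th y z = tn_pdf (- th) (~~ y) (- z) :> R.
Proof.
rewrite /tn_pdf; case: y => /=; rewrite ?oppr_lt0 ?oppr_gt0 -[- z - - th]opprD phiN PhiN.
  by rewrite subKr.
by [].
Qed.

Lemma uPhi_itv u th : 0 < u < 1 -> 0 < u * Phi th < 1.
Proof.
move=> /andP[u0 u1]; rewrite mulr_gt0 ?Phi_gt0 //=.
by rewrite (lt_trans _ (Phi_lt1 th)) // gtr_pMl ?Phi_gt0.
Qed.

(** Monotonicity in [th] is exactly log-concavity of $\Phi$; the bound by [d] only uses that $\Phi$
    is increasing. *)
Lemma tnq_true_le th d u : 0 < u < 1 -> 0 <= d ->
  tnq th true u <= tnq (th + d) true u <= tnq th true u + d.
Proof.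
move=> u01 d0; rewrite /tnq; have /andP[u0 u1] := u01.
have p1 := uPhi_itv th u01; have p2 := uPhi_itv (th + d) u01.
set A := iPhi (u * Phi th).
have AE : Phi A = u * Phi th by exact: PhiK.
have Ath : A <= th by rewrite iPhi_le // ler_piMl ?Phi_ge0 // ltW.
apply/andP; split.
  have : iPhi (u * Phi (th + d)) <= A + d; last by lra.
  rewrite iPhi_le // -(ler_pM2r (Phi_gt0 th)).
  by apply: le_trans (Phi_logconcave Ath d0); rewrite AE mulrAC.
rewrite [th - _ + d]addrAC lerD2l lerN2 le_iPhi // AE ler_pM2l // Phi_le.
by rewrite lerDl.
Qed.

Lemma tnq_true_contract th d u : 0 < u < 1 -> 0 <= d -> th + d <= 0 ->
  tnq (th + d) true u <= tnq th true u + d * (1 - u).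
Proof.
move=> u01 d0 thd; rewrite /tnq; have /andP[u0 u1] := u01.
have p1 := uPhi_itv th u01; have p2 := uPhi_itv (th + d) u01.
set A := iPhi (u * Phi th).
have AE : Phi A = u * Phi th by exact: PhiK.
have Ath : A <= th by rewrite iPhi_le // ler_piMl ?Phi_ge0 // ltW.
have : A + d * u <= iPhi (u * Phi (th + d)).
  by rewrite le_iPhi // (Phi_contract d0 _ Ath thd AE) // (ltW u0) ltW.
rewrite mulrBr mulr1; lra.
Qed.

Lemma tnq_lip th th' (y : bool) u : 0 < u < 1 ->
  `|tnq th y u - tnq th' y u| <= `|th - th'|.
Proof.
have H a b : 0 < u < 1 -> `|tnq a true u - tnq b true u| <= `|a - b|.
  move=> u01; wlog ab : a b / a <= b.
    move=> W; have [/W //|/ltW /W] := leP a b.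
    by rewrite distrC [`|b - a|]distrC.
  have d0 : 0 <= b - a by rewrite subr_ge0.
  have := tnq_true_le a u01 d0; rewrite addrC subrK => /andP[h1 h2].
  by rewrite distrC [`|a - b|]distrC !ger0_norm ?subr_ge0 // lerBlDl.
move=> u01; case: y; first exact: H.
rewrite tnqN [tnq th' _ _]tnqN /= -opprD normrN.
rewrite (_ : `|th - th'| = `|- th - - th'|); last by rewrite -opprD normrN.
exact: H.
Qed.

Lemma tnq_contract th th' (y : bool) u : 0 < u < 1 ->
  (if y then (th <= 0) && (th' <= 0) else (0 <= th) && (0 <= th')) ->
  `|tnq th y u - tnq th' y u| <= `|th - th'| * (1 - u).
Proof.
have H a b : 0 < u < 1 -> a <= 0 -> b <= 0 ->
    `|tnq a true u - tnq b true u| <= `|a - b| * (1 - u).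
  move=> u01; wlog ab : a b / a <= b.
    move=> W a0 b0; have [/W //|/ltW /W] := leP a b; first exact.
    by rewrite distrC [`|b - a|]distrC; apply.
  move=> a0 b0; have d0 : 0 <= b - a by rewrite subr_ge0.
  have := tnq_true_le a u01 d0; rewrite addrC subrK => /andP[h1 h2].
  have := @tnq_true_contract a _ _ u01 d0; rewrite addrC subrK => /(_ b0) h3.
  by rewrite distrC [`|a - b|]distrC !ger0_norm ?subr_ge0 // lerBlDl.
move=> u01; case: y => /andP[t0 t0']; first exact: H.
rewrite tnqN [tnq th' _ _]tnqN /= -opprD normrN.
rewrite (_ : `|th - th'| = `|- th - - th'|); last by rewrite -opprD normrN.
by apply: H; rewrite ?oppr_le0.
Qed.
Lemma measurable_iPhi : measurable_fun setT iPhi.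
Proof.
apply: (measurability (@RGenCInfty.G R)) => [|/= _ [_] [x] -> <-].
  exact: RGenCInfty.measurableE.
(* Outside $]0,1[$ the default value $0$ belongs to $[x,+\infty[$ exactly when $x\le 0$. *)
rewrite setTI (_ : _ @^-1` _ = (`]0, 1[ `&` `[Phi x, +oo[) `|`
  (~` `]0, 1[ `&` [set _ | x <= 0])); last first.
  apply/seteqP; split => t /=; rewrite !in_itv /= !andbT.
    have [t01|t01] := boolP (0 < t < 1).
      by rewrite le_iPhi //; left.
    rewrite /iPhi; case: xgetP => [y _ yt|_ x0]; last by right; split => //; apply/negP.
    by move: t01; rewrite -yt Phi_gt0 Phi_lt1.
  case=> [[t01]|[/negP t01 x0]]; first by rewrite le_iPhi.
  rewrite /iPhi; case: xgetP => // y _ yt.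
  by move: t01; rewrite -yt Phi_gt0 Phi_lt1.
apply: measurableU; apply: measurableI => //; first exact: measurableC.
by case: (x <= 0); rewrite ?set_true ?set_false.
Qed.

Lemma measurable_tnq th (y : bool) : measurable_fun setT (tnq th y).
Proof.
rewrite /tnq; case: y; [apply: measurable_funB|apply: measurable_funD] => //;
  by apply: (measurableT_comp measurable_iPhi); exact: measurable_funM.
Qed.

Lemma normal_pdf_phi th z : normal_pdf th 1 z = phi (z - th) :> R.
Proof. by rewrite /phi !normal_pdfE ?oner_eq0 // /normal_fun subr0. Qed.

Lemma Phi_integral_shift_gt a t :
  (\int[mu]_(z in `]a, +oo[) (phi (z - t))%:E = (Phi (t - a))%:E)%E.
Proof.
rewrite -opprB PhiN Phi_compl_integral integral_mkcond [RHS]integral_mkcond.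
rewrite -[RHS](@integral_shift R (- t)); last 2 first.
- apply/(measurable_restrictT _ _).1 => //.
  by apply/measurable_EFinP; apply: measurable_funTS; exact: measurable_phi.
- by move=> x; rewrite erestrict_ge0 // => y _; rewrite lee_fin ltW ?phi_gt0.
by apply: eq_integral => x _; rewrite !patchE !mem_setE !in_itv /= !andbT ltrD2r.
Qed.

(** Both sides are finite measures of $A$ and are compared on the open rays, a generating family
    stable under intersection. On $]x,+\infty[$ both equal $\Phi(th-\max(x,0))/\Phi(th)$, since the
    quantile exceeds $x$ precisely for the levels $u$ below this number. *)
Lemma tn_pdf_true_law th (A : set R) : measurable A ->
  (\int[mu]_z ((tn_pdf th true z)%:E * (\1_A z)%:E) =
   \int[mu]_u ((\1_(`]0, 1[%classic : set R) u)%:E * (\1_A (tnq th true u))%:E))%E.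
Proof.
move=> mA.
have mD : measurable (`]0, +oo[%classic : set (measurableTypeR R)) by [].
have mU : measurable (`]0, 1[%classic : set (measurableTypeR R)) by [].
have c0 : 0 <= (Phi th)^-1 by rewrite invr_ge0 Phi_ge0.
pose m1 : {measure set (measurableTypeR R) -> \bar R} := mscale (NngNum c0) (mrestr (normal_prob th 1) mD).
have mq : measurable_fun setT (tnq th true : measurableTypeR R -> measurableTypeR R).
  exact: measurable_tnq.
pose m2 := measure_function_pushforward__canonical__measure_function_Measure
  (mrestr mu mU) mq.
have m1E B : measurable B -> (\int[mu]_z ((tn_pdf th true z)%:E * (\1_B z)%:E) = m1 B)%E.
  move=> mB; rewrite /m1 /= /mscale /= /mrestr /normal_prob.
  rewrite -ge0_integralZl //=; last 3 first.
  - exact: measurableI.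
  - by apply/measurable_EFinP; apply: measurable_funTS; exact: measurable_normal_pdf.
  - by move=> x _; rewrite lee_fin normal_pdf_ge0.
  rewrite [RHS]integral_mkcond; apply: eq_integral => x _.
  have e : (x \in `]0, +oo[%classic) = (0 < (x : R)).
    by apply/idP/idP => [/set_mem|h]; [|apply/mem_set]; rewrite /= in_itv /= andbT.
  rewrite patchE in_setI e normal_pdf_phi indicE; case: (x \in B); last by rewrite mule0.
  by rewrite mule1; case: ifP; rewrite //= -EFinM mulrC.
have m2E B : measurable B -> (\int[mu]_u ((\1_(`]0, 1[%classic : set R) u)%:E *
    (\1_B (tnq th true u))%:E) = m2 B)%E.
  move=> mB; rewrite /m2 /= /pushforward /mrestr.
  have mqB : measurable (tnq th true @^-1` B) by rewrite -[X in measurable X]setTI; exact: measurable_tnq.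
  have mI : measurable (tnq th true @^-1` B `&` `]0, 1[) by exact: measurableI.
  have := @integral_indic _ (measurableTypeR R) R mu setT measurableT _ mI.
  rewrite setIT => <-; apply: eq_integral => x _.
  by rewrite setIC indicI /= EFinM.
rewrite m1E // m2E //.
have H x : m1 `]x, +oo[%classic = m2 `]x, +oo[%classic.
  rewrite /m1 /= /mscale /= /mrestr /normal_prob.
  rewrite (_ : _ `&` _ = `]Num.max x 0, +oo[%classic); last first.
    by apply/seteqP; split => z; rewrite /= !in_itv /= !andbT gt_max => /andP.
  under eq_integral do rewrite normal_pdf_phi.
  rewrite Phi_integral_shift_gt -EFinM mulrC /m2 /= /pushforward /mrestr.
  rewrite (_ : _ `&` _ = `]0, Phi (th - Num.max x 0) / Phi th[%classic).
    rewrite lebesgue_measure_itv /= lte_fin divr_gt0 ?Phi_gt0 //.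
    by rewrite oppr0 addr0.
  apply/seteqP; split => u; rewrite /= !in_itv /= andbT ltr_pdivlMr ?Phi_gt0 //.
    move=> [xu /andP[u0 u1]]; rewrite u0 /=.
    have p := uPhi_itv th (introT andP (conj u0 u1)).
    case: (leP x 0) => x0.
      by rewrite subr0 gtr_pMl ?Phi_gt0.
    by move: xu; rewrite ltrBrDr addrC -ltrBrDr iPhi_lt.
  move=> /andP[u0 uP].
  have u1 : u < 1.
    rewrite -(@ltr_pM2r _ (Phi th)) ?Phi_gt0 // mul1r (lt_le_trans uP) // Phi_le.
    by rewrite gerBl le_max lexx orbT.
  split; last by rewrite u0.
  have p := uPhi_itv th (introT andP (conj u0 u1)).
  rewrite ltrBrDr addrC -ltrBrDr iPhi_lt // (lt_le_trans uP) // Phi_le.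
  by rewrite lerD2l lerN2 le_max lexx.
apply: (@measure_unique _ R (measurableTypeR R) (@RGenOInfty.G R)
  (fun n => `](- (n%:R : R))%R, +oo[%classic) _ _ _ _ m1 m2) => //.
- exact: RGenOInfty.measurableE.
- move=> _ _ [x ->] [y ->]; exists (Num.max x y).
  by apply/seteqP; split => z; rewrite /= !in_itv /= !andbT gt_max => /andP.
- by move=> n; exists (- n%:R).
- apply/seteqP; split => // x _; exists (Num.bound `|x|) => //=.
  rewrite in_itv /= andbT ltrNl; apply: le_lt_trans (archi_boundP (normr_ge0 x)).
  by rewrite -normrN ler_norm.
- by move=> _ [x ->]; exact: H.
- move=> k; rewrite H /= /pushforward /mrestr; apply: le_lt_trans (_ : (1 < +oo)%E); last exact: ltry.
  have <- : mu `]0, 1[%classic = 1%E by rewrite lebesgue_measure_itv /= lte01 oppr0 addr0.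
  apply: (le_measure mu); rewrite ?inE //.
  by apply: measurableI => //; rewrite -[X in measurable X]setTI; exact: measurable_tnq.
Qed.

Lemma tn_pdf_ge0 th (y : bool) z : 0 <= tn_pdf th y z :> R.
Proof.
rewrite /tn_pdf; case: y; case: ifP => // _; rewrite divr_ge0 ?ltW ?phi_gt0 ?Phi_gt0 //.
by rewrite subr_gt0 Phi_lt1.
Qed.

Lemma measurable_tn_pdf dT (T : measurableType dT) (f g : T -> R) (y : bool) :
  measurable_fun setT f -> measurable_fun setT g ->
  measurable_fun setT (fun w => tn_pdf (f w) y (g w)).
Proof.
move=> mf mg.
have mfg : measurable_fun setT (fun w => phi (g w - f w)).
  by apply: (measurableT_comp measurable_phi); exact: measurable_funB.
have mP : measurable_fun setT (fun w => (Phi (f w))^-1).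
  apply: (measurableT_comp (f := fun t => (Phi t)^-1) _ mf).
  apply: nonincreasing_measurable => // a b ab.
  by rewrite lef_pV2 ?posrE ?Phi_gt0 // Phi_le.
have mQ : measurable_fun setT (fun w => (1 - Phi (f w))^-1).
  apply: (measurableT_comp (f := fun t => (1 - Phi t)^-1) _ mf).
  apply: nondecreasing_measurable => // a b ab.
  by rewrite lef_pV2 ?posrE -?PhiN ?Phi_gt0 // Phi_le lerN2.
rewrite /tn_pdf; case: y; apply: measurable_fun_ifT => //.
- exact: measurable_fun_ltr.
- exact: measurable_funM.
- exact: measurable_fun_ltr.
- exact: measurable_funM.
Qed.

Lemma tn_pdf_law th (y : bool) (h : R -> \bar R) : measurable_fun setT h ->
  (forall x, 0 <= h x)%E ->
  (\int[mu]_z ((tn_pdf th y z)%:E * h z) =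
   \int[mu]_u ((\1_(`]0, 1[%classic : set R) u)%:E * h (tnq th y u)))%E.
Proof.
have mU : measurable (`]0, 1[%classic : set R) by [].
have T th' (k : R -> \bar R) : measurable_fun setT k -> (forall x, 0 <= k x)%E ->
  (\int[mu]_z ((tn_pdf th' true z)%:E * k z) =
   \int[mu]_u ((\1_(`]0, 1[%classic : set R) u)%:E * k (tnq th' true u)))%E.
  move=> mk k0.
  apply: (@integral_transfer _ _ _ _ _ _ _ mu mu (tn_pdf th' true) (\1_(`]0, 1[%classic : set R)) id (tnq th' true)) => //.
  - exact: measurable_tn_pdf.
  - exact: measurable_tnq.
  - exact: tn_pdf_ge0.
  - by move=> A mA; exact: tn_pdf_true_law.
move=> mh h0; case: y; first exact: T.
transitivity (\int[mu]_z ((tn_pdf (- th) true z)%:E * h (- (z : R))%R))%E.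
  rewrite -[LHS]integral_comp_opp; last 2 first.
  - apply: emeasurable_funM => //; apply/measurable_EFinP; exact: measurable_tn_pdf.
  - by move=> x; rewrite mule_ge0 ?lee_fin ?tn_pdf_ge0.
  by apply: eq_integral => z _; rewrite tn_pdfN opprK.
rewrite (T (- th) (fun z => h (- z))) //; last by apply: (measurableT_comp mh).
by apply: eq_integral => u _; rewrite [tnq th _ _]tnqN.
Qed.

End gaussian_cdf.

(** * Quadratic forms and Gaussian densities *)

Section bilinear.
Variable R : realType.

Definition qf k (S : 'M[R]_k) (a b : 'cV[R]_k) : R := (a^T *m S *m b) ord0 ord0.

Lemma qfDl k (S : 'M[R]_k) a a' b : qf S (a + a') b = qf S a b + qf S a' b.
Proof. by rewrite /qf linearD /= !mulmxDl mxE. Qed.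
Lemma qfDr k (S : 'M[R]_k) a b b' : qf S a (b + b') = qf S a b + qf S a b'.
Proof. by rewrite /qf mulmxDr mxE. Qed.
Lemma qfNl k (S : 'M[R]_k) a b : qf S (- a) b = - qf S a b.
Proof. by rewrite /qf linearN /= !mulNmx mxE. Qed.
Lemma qfNr k (S : 'M[R]_k) a b : qf S a (- b) = - qf S a b.
Proof. by rewrite /qf mulmxN mxE. Qed.
Lemma qfZl k (S : 'M[R]_k) t a b : qf S (t *: a) b = t * qf S a b.
Proof. by rewrite /qf linearZ /= -!scalemxAl mxE. Qed.
Lemma qfZr k (S : 'M[R]_k) t a b : qf S a (t *: b) = t * qf S a b.
Proof. by rewrite /qf -!scalemxAr mxE. Qed.
Lemma qfC k (S : 'M[R]_k) a b : S^T = S -> qf S a b = qf S b a.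
Proof.
move=> St; rewrite /qf; have -> : a^T *m S *m b = (b^T *m S *m a)^T.
  by rewrite !trmx_mul St trmxK mulmxA.
by rewrite mxE.
Qed.
Lemma qf0 k (S : 'M[R]_k) b : qf S 0 b = 0.
Proof. by rewrite /qf linear0 !mul0mx mxE. Qed.
Lemma qfDm k (S S' : 'M[R]_k) a b : qf (S + S') a b = qf S a b + qf S' a b.
Proof. by rewrite /qf mulmxDr mulmxDl mxE. Qed.

Lemma posdef_unit k (S : 'M[R]_k) : posdef S -> S \in unitmx.
Proof.
move=> [St Sp]; rewrite unitmxE unitfE; apply/negP => /det0P[v v0 vS].
have := Sp v^T; rewrite -(inj_eq trmx_inj) trmxK trmx0 => /(_ v0).
by rewrite vS mul0mx mxE ltxx.
Qed.

Lemma posdef_ge0 k (S : 'M[R]_k) u : posdef S -> 0 <= qf S u u.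
Proof.
move=> [_ Sp]; have [->|/Sp/ltW //] := eqVneq u 0; by rewrite qf0.
Qed.

Lemma qf_block k (a : R) (b : 'rV[R]_k) (D : 'M[R]_k) (t : R) (y : 'cV[R]_k) :
  qf (block_mx a%:M b b^T D : 'M[R]_(1 + k)) (col_mx t%:M y) (col_mx t%:M y) =
  a * t ^+ 2 + 2 * t * (b *m y) ord0 ord0 + qf D y y.
Proof.
rewrite /qf tr_col_mx tr_scalar_mx mul_row_block mul_row_col !mulmxDl.
rewrite -!scalar_mxM mul_mx_scalar -(mulmxA t%:M) mul_scalar_mx -trmx_mul.
rewrite !mxE /= mulr1n; ring.
Qed.

(** The Schur complement of $D$ is the precision of the first coordinate once the others are
    integrated out; this factorization splits the normalizing constant in [integral_mvn]. *)
Lemma schur_det k (a : R) (b : 'rV[R]_k) (D : 'M[R]_k) : D \in unitmx ->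
  \det (block_mx a%:M b b^T D : 'M[R]_(1 + k)) =
  (a - (b *m invmx D *m b^T) ord0 ord0) * \det D.
Proof.
move=> Du; set s := a - _.
have -> : (block_mx a%:M b b^T D : 'M[R]_(1 + k)) =
  block_mx 1%:M (b *m invmx D) 0 1%:M *m block_mx s%:M 0 b^T D.
  rewrite mulmx_block !mul1mx mulmxKV // mul0mx !add0r mul0mx add0r; congr block_mx.
  by rewrite [b *m invmx D *m b^T]mx11_scalar -raddfD /= subrK.
by rewrite det_mulmx det_ublock det_lblock !det1 !mul1r det_scalar1.
Qed.
End bilinear.

(** * Integration on column vectors and multivariate Gaussian densities *)

Section multivariate.
Variable R : realType.
Local Notation mu := (@lebesgue_measure R).

Lemma measurable_int_Vk dT (T : measurableType dT) k (f : T * Vk R k -> \bar R) :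
  measurable_fun setT f -> (forall x, 0 <= f x)%E ->
  measurable_fun setT (fun x => \int[leb R k]_y f (x, y))%E.
Proof.
move=> mf f0.
exact: (measurable_fun_fubini_tonelli_F (m2 := leb R k) f mf f0).
Qed.

Lemma measurable_consV1 k (f : Vk R k.+1 -> \bar R) (t : R) : measurable_fun setT f ->
  measurable_fun setT (fun y : Vk R k => f (consV (t, y))).
Proof.
move=> mf; apply: (measurableT_comp mf).
apply: (measurableT_comp (@measurable_consV R k)).
exact: measurable_fun_pair.
Qed.

Lemma cV0_eq (x y : 'cV[R]_0) : x = y.
Proof. by apply/matrixP => -[]. Qed.

Lemma consVD k t t' (y y' : 'cV[R]_k) : consV (t, y) + consV (t', y') = consV (t + t', y + y').
Proof.
apply/matrixP => i j; rewrite ord1 mxE.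
by have [l ->|->] := unliftP ord0 i; rewrite ?consVS ?consV0 //= mxE.
Qed.

Lemma leb_shift k (a : 'cV[R]_k) (f : Vk R k -> \bar R) : measurable_fun setT f ->
  (forall x, 0 <= f x)%E ->
  (\int[leb R k]_x f ((x : 'cV[R]_k) + a)%R = \int[leb R k]_x f x)%E.
Proof.
elim: k a f => [|k IH] a f mf f0.
  by apply: eq_integral => x _; congr f; exact: cV0_eq.
have msh : measurable_fun setT (fun x : Vk R k.+1 => (x : 'cV[R]_k.+1) + a : Vk R k.+1).
  apply: measurable_toVk => i; under eq_fun do rewrite mxE.
  by apply: measurable_funD => //; exact: measurable_coord.
rewrite integral_consV; last 2 first.
- exact: (measurableT_comp mf msh).
- by move=> x; exact: f0.
rewrite (integral_consV mf f0).
rewrite -[a]headtailVK /headtailV; set a0 := a ord0 ord0; set a' := dsubmx _.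
have mF : measurable_fun setT (fun t : R => \int[leb R k]_y f (consV (t, y)))%E.
  apply: (@measurable_int_Vk _ _ k (fun x => f (consV x))) => //.
  exact: (measurableT_comp mf (@measurable_consV R k)).
rewrite -[RHS](integral_shift a0 mF); last by move=> x; exact: integral_ge0.
apply: eq_integral => t _.
rewrite -[RHS](IH a' _ (measurable_consV1 _ mf)); last by move=> y; exact: f0.
by apply: eq_integral => y _; rewrite consVD.
Qed.

(** A coordinatewise change of variables for product densities, by induction with Tonelli. With [f]
    the truncated normal densities, [g] the indicator of $]0,1[$ and [T] the quantiles, it produces
    the common uniforms. *)
Lemma leb_coupling k (f g T : 'I_k -> R -> R) :
  (forall i, measurable_fun setT (f i)) -> (forall i, measurable_fun setT (g i)) ->
  (forall i, measurable_fun setT (T i)) ->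
  (forall i x, 0 <= f i x) -> (forall i x, 0 <= g i x) ->
  (forall i (h : R -> \bar R), measurable_fun setT h -> (forall x, 0 <= h x)%E ->
    \int[mu]_z ((f i z)%:E * h z) = \int[mu]_u ((g i u)%:E * h (T i u)))%E ->
  forall H : Vk R k -> \bar R, measurable_fun setT H -> (forall x, 0 <= H x)%E ->
  (\int[leb R k]_z ((\prod_i f i (z i ord0))%:E * H z) =
   \int[leb R k]_u ((\prod_i g i (u i ord0))%:E * H (\col_i T i (u i ord0))))%E.
Proof.
elim: k f g T => [|k IH] f g T mf mg mT f0 g0 fgT H mH H0.
  by apply: eq_integral => x _; rewrite !big_ord0; congr (_ * H _)%E; exact: cV0_eq.
have mprod (f' : 'I_k.+1 -> R -> R) : (forall i, measurable_fun setT (f' i)) ->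
  measurable_fun setT (fun x : Vk R k.+1 => \prod_i f' i (x i ord0)).
  move=> mf'; apply: measurable_prod => i _.
  exact: (measurableT_comp (mf' i) (@measurable_coord R k.+1 i)).
have mprod' (f' : 'I_k -> R -> R) : (forall i, measurable_fun setT (f' i)) ->
  measurable_fun setT (fun x : Vk R k => \prod_i f' i (x i ord0)).
  move=> mf'; apply: measurable_prod => i _.
  exact: (measurableT_comp (mf' i) (@measurable_coord R k i)).
have prod0 l (f' : 'I_l -> R -> R) (x : 'cV[R]_l) : (forall i x, 0 <= f' i x) ->
  (0 <= (\prod_i f' i (x i ord0))%:E)%E.
  by move=> f'0; rewrite lee_fin prodr_ge0.
have mTT l (T' : 'I_l -> R -> R) : (forall i, measurable_fun setT (T' i)) ->
  measurable_fun setT (fun u : Vk R l => \col_i T' i (u i ord0) : Vk R l).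
  move=> mT'; apply: measurable_toVk => i; under eq_fun do rewrite mxE.
  exact: (measurableT_comp (mT' i) (@measurable_coord R l i)).
rewrite integral_consV; last 2 first.
- by apply: emeasurable_funM => //; apply/measurable_EFinP; exact: mprod.
- by move=> x; apply: mule_ge0 => //; rewrite lee_fin prodr_ge0.
rewrite integral_consV; last 2 first.
- apply: emeasurable_funM; first by apply/measurable_EFinP; exact: mprod.
  exact: (measurableT_comp mH (mTT _ _ mT)).
- by move=> x; apply: mule_ge0 => //; rewrite lee_fin prodr_ge0.
have mHc : measurable_fun setT (fun ty : R * Vk R k => H (consV ty)).
  exact: (measurableT_comp mH (@measurable_consV R k)).
pose F t := (\int[leb R k]_y ((\prod_i g (lift ord0 i) (y i ord0))%:E *
    H (consV (t, \col_i T (lift ord0 i) (y i ord0)))))%E.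
transitivity (\int[mu]_t ((f ord0 t)%:E * F t))%E.
  apply: eq_integral => t _.
  rewrite /F -(IH _ _ _ (fun i => mf (lift ord0 i)) (fun i => mg (lift ord0 i))
    (fun i => mT (lift ord0 i)) (fun i => f0 (lift ord0 i)) (fun i => g0 (lift ord0 i))
    (fun i => fgT (lift ord0 i)) (fun y => H (consV (t, y))) (measurable_consV1 _ mH)
    (fun y => H0 _)).
  rewrite -ge0_integralZl //; last 3 first.
  - apply: emeasurable_funM; first by apply/measurable_EFinP; exact: (mprod' (fun i => f (lift ord0 i))).
    exact: measurable_consV1.
  - by move=> y _; apply: mule_ge0 => //; rewrite lee_fin prodr_ge0.
  - by rewrite lee_fin.
  apply: eq_integral => y _; rewrite big_ord_recl consV0 muleA -EFinM.
  by congr ((_ * _)%:E * _)%E; apply: eq_bigr => i _; rewrite consVS.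
rewrite fgT; last 2 first.
- rewrite /F.
  apply: (@measurable_int_Vk _ _ k (fun ty => ((\prod_i g (lift ord0 i) (ty.2 i ord0))%:E *
    H (consV (ty.1, \col_i T (lift ord0 i) (ty.2 i ord0))))%E)).
    apply: emeasurable_funM.
      apply/measurable_EFinP.
      by apply: (@measurableT_comp _ _ _ _ _ _ (fun x : Vk R k => \prod_i g (lift ord0 i) (x i ord0))) => //; exact: (mprod' (fun i => g (lift ord0 i))).
    apply: (measurableT_comp mHc); apply: measurable_fun_pair => //.
    exact: (measurableT_comp (mTT _ (fun i => T (lift ord0 i)) (fun i => mT (lift ord0 i))) measurable_snd).
  by move=> x; apply: mule_ge0 => //; rewrite lee_fin prodr_ge0.
- by move=> t; apply: integral_ge0 => y _; apply: mule_ge0 => //; rewrite lee_fin prodr_ge0.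
apply: eq_integral => t _.
rewrite /F -ge0_integralZl //; last 3 first.
- apply: emeasurable_funM; first by apply/measurable_EFinP; exact: (mprod' (fun i => g (lift ord0 i))).
  apply: (measurableT_comp mHc); apply: measurable_fun_pair => //.
  exact: (mTT _ (fun i => T (lift ord0 i))).
- by move=> y _; apply: mule_ge0 => //; rewrite lee_fin prodr_ge0.
- by rewrite lee_fin.
apply: eq_integral => y _; rewrite big_ord_recl consV0 muleA -EFinM.
congr ((_ * _)%:E * H _)%E; first by apply: eq_bigr => i _; rewrite consVS.
apply/matrixP => i j; rewrite [RHS]mxE (ord1 j).
by have [l ->|->] := unliftP ord0 i; rewrite ?consVS ?consV0 //= mxE.
Qed.

Lemma qfE k (S : 'M[R]_k) a b : qf S a b = \sum_i \sum_j a i ord0 * S i j * b j ord0.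
Proof.
rewrite /qf -mulmxA mxE; apply: eq_bigr => i _; rewrite mxE [X in _ * X]mxE mulr_sumr.
by apply: eq_bigr => j _; rewrite mulrA.
Qed.

Lemma measurable_qf dT (T : measurableType dT) k (S : 'M[R]_k) (f g : T -> Vk R k) :
  measurable_fun setT f -> measurable_fun setT g ->
  measurable_fun setT (fun w => qf S (f w) (g w)).
Proof.
move=> mf mg; under eq_fun do rewrite qfE.
apply: measurable_sum => i; apply: measurable_sum => j.
apply: measurable_funM; first apply: measurable_funM => //.
- exact: (measurableT_comp (@measurable_coord R k i) mf).
- exact: (measurableT_comp (@measurable_coord R k j) mg).
Qed.

Lemma measurable_mulmx dT (T : measurableType dT) k l (A : 'M[R]_(l, k)) (f : T -> Vk R k) :
  measurable_fun setT f -> measurable_fun setT (fun w => A *m f w : Vk R l).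
Proof.
move=> mf; apply: measurable_toVk => i; under eq_fun do rewrite mxE.
apply: measurable_sum => j; apply: measurable_funM => //.
exact: (measurableT_comp (@measurable_coord R k j) mf).
Qed.

Lemma measurable_addV dT (T : measurableType dT) k (f g : T -> Vk R k) :
  measurable_fun setT f -> measurable_fun setT g ->
  measurable_fun setT (fun w => (f w : 'cV[R]_k) + g w : Vk R k).
Proof.
move=> mf mg; apply: measurable_toVk => i; under eq_fun do rewrite mxE.
apply: measurable_funD; first exact: (measurableT_comp (@measurable_coord R k i) mf).
exact: (measurableT_comp (@measurable_coord R k i) mg).
Qed.

Lemma measurable_subV dT (T : measurableType dT) k (f g : T -> Vk R k) :
  measurable_fun setT f -> measurable_fun setT g ->
  measurable_fun setT (fun w => (f w : 'cV[R]_k) - g w : Vk R k).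
Proof.
move=> mf mg; apply: measurable_toVk => i; under eq_fun do rewrite !mxE.
apply: measurable_funB; first exact: (measurableT_comp (@measurable_coord R k i) mf).
exact: (measurableT_comp (@measurable_coord R k i) mg).
Qed.

Lemma mvnE k (m : 'cV[R]_k) S x : mvn_prec_pdf m S x =
  (Num.sqrt (2 * pi))^-k * Num.sqrt (\det S) * expR (- qf S (x - m) (x - m) / 2).
Proof. by []. Qed.

Lemma mvn_ge0 k (m : 'cV[R]_k) S x : 0 <= mvn_prec_pdf m S x.
Proof. by rewrite !mulr_ge0 ?expR_ge0 ?invr_ge0 ?exprn_ge0 ?sqrtr_ge0. Qed.

Lemma measurable_mvn dT (T : measurableType dT) k (S : 'M[R]_k) (f g : T -> Vk R k) :
  measurable_fun setT f -> measurable_fun setT g ->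
  measurable_fun setT (fun w => mvn_prec_pdf (f w) S (g w)).
Proof.
move=> mf mg; rewrite /mvn_prec_pdf; apply: measurable_funM => //.
apply: (measurableT_comp (@measurable_expR R)); apply: measurable_funM => //.
apply: measurableT_comp => //.
by apply: measurable_qf; exact: measurable_subV.
Qed.

Lemma gauss1 (m s : R) : 0 < s ->
  (\int[mu]_t ((Num.sqrt (2 * pi))^-1 * Num.sqrt s * expR (- (s * (t - m) ^+ 2) / 2))%:E = 1)%E.
Proof.
move=> s0; have r0 : 0 < Num.sqrt s by rewrite sqrtr_gt0.
rewrite -(integral_normal_pdf m (Num.sqrt s)^-1); apply: eq_integral => t _; congr EFin.
rewrite normal_pdfE ?invr_eq0 ?gt_eqF // /normal_peak /normal_fun.
have e : (Num.sqrt s)^-1 ^+ 2 = s^-1 by rewrite exprVn sqr_sqrtr // ltW.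
rewrite e; congr (_ * expR _); last first.
  by rewrite -[s^-1 *+ 2]mulr_natr; field; exact: lt0r_neq0.
have -> : s^-1 * pi *+ 2 = (2 * pi) * s^-1 by rewrite -mulr_natl [s^-1 * pi]mulrC mulrA.
have -> : Num.sqrt (2 * pi * s^-1) = Num.sqrt (2 * pi) * (Num.sqrt s)^-1.
  by rewrite sqrtrM ?mulr_ge0 ?pi_ge0 // -[in LHS]e sqrtr_sqr ger0_norm // invr_ge0 sqrtr_ge0.
by rewrite invfM invrK.
Qed.

Lemma col_mx_consV k t (y : 'cV[R]_k) : col_mx t%:M y = consV (t, y).
Proof.
by rewrite /consV /=; congr col_mx; apply/matrixP => i j; rewrite !ord1 !mxE eqxx mulr1n.
Qed.

(** Induction on the dimension. For a fixed first coordinate, completing the square in the others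
    leaves a Gaussian of precision $D$ with a shifted mean; what remains is a one-dimensional
    Gaussian whose precision is the Schur complement. *)
Lemma integral_mvn k (m : 'cV[R]_k) S : posdef S ->
  (\int[leb R k]_x (mvn_prec_pdf m S x)%:E = 1)%E.
Proof.
elim: k m S => [|k IH] m S pS.
  rewrite -intRkE; last 2 first.
  - apply/measurable_EFinP; apply: measurable_mvn => //; exact: measurable_cst.
  - by move=> x; rewrite lee_fin mvn_ge0.
  rewrite /= mvnE det_mx00 sqrtr1 expr0 invr1 !mul1r.
  by rewrite (_ : 0 - m = 0) ?qf0 ?oppr0 ?mul0r ?expR0 //; exact: cV0_eq.
pose a := S ord0 ord0; pose b : 'rV[R]_k := @ursubmx _ 1 k 1 k S.
pose D : 'M[R]_k := @drsubmx _ 1 k 1 k S.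
have [St Sp] := pS.
have SE : S = (block_mx a%:M b b^T D : 'M[R]_(1 + k)).
  rewrite -[LHS](@submxK _ 1 k 1 k).
  have -> : @ulsubmx _ 1 k 1 k S = a%:M.
    rewrite [LHS]mx11_scalar !mxE; congr (S _ _)%:M; exact/val_inj.
  have -> // : @dlsubmx _ 1 k 1 k S = b^T.
  by rewrite -[in LHS]St /b; apply/matrixP => i j; rewrite !mxE.
have pD : posdef D.
  split; first by rewrite /D trmx_drsub St.
  move=> u u0; have := Sp (consV (0, u)).
  rewrite -col_mx_consV [X in _ *m X *m _]SE -/(qf _ _ _) qf_block !mulr0 mul0r expr0n mulr0 !add0r.
  apply; apply: contra u0 => /eqP/(congr1 (@dsubmx R 1 k 1)).
  by rewrite linear0 col_mxKd => ->.
have Du := posdef_unit pD.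
(* For a fixed first coordinate $s$ the form is minimal at $y=-sc$ with value [sg] $s^2$; positivity
   of [sg] is read off by evaluating $S$ at the vector $(1,-c)$. *)
pose c := invmx D *m b^T; pose sg := a - (b *m invmx D *m b^T) ord0 ord0.
have Dt := pD.1.
have qfc y : qf D y c = (b *m y) ord0 ord0.
  by rewrite /qf /c -mulmxA mulKVmx // -trmx_mul mxE.
have qfS s y : qf S (consV (s, y)) (consV (s, y)) =
    sg * s ^+ 2 + qf D (y + s *: c) (y + s *: c).
  rewrite [X in qf X]SE -col_mx_consV qf_block !(qfDl, qfDr, qfZl, qfZr) -(qfC y c Dt) !qfc.
  rewrite /sg -mulmxA -/c; ring.
have sg0 : 0 < sg.
  have := Sp (consV (1, - c)); rewrite -/(qf _ _ _) qfS scale1r addNr qf0 addr0 expr1n mulr1.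
  apply; apply/eqP => /matrixP/(_ ord0 ord0); rewrite consV0 mxE /= => /eqP.
  by rewrite oner_eq0.
rewrite integral_consV; last 2 first.
- apply/measurable_EFinP; apply: measurable_mvn => //; exact: measurable_cst.
- by move=> x; rewrite lee_fin mvn_ge0.
pose m0 := m ord0 ord0; pose m' : 'cV[R]_k := @dsubmx R 1 k 1 m.
rewrite -[RHS](gauss1 m0 sg0); apply: eq_integral => t _.
set C := _ * expR _.
transitivity (\int[leb R k]_y (C%:E * (mvn_prec_pdf (m' - (t - m0) *: c) D y)%:E))%E.
  apply: eq_integral => y _; rewrite -EFinM; congr EFin; rewrite /C !mvnE.
  have -> : consV (t, y) - m = consV (t - m0, y - m').
    have {1}-> : m = consV (m0, m') by rewrite -[LHS]headtailVK.
    by rewrite -[consV (t, y)](addrK (consV (m0, m'))) addrK -[consV (t - m0, _)](addrK (consV (m0, m'))) consVD !subrK.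
  have -> : \det S = sg * \det D by rewrite SE schur_det.
  rewrite qfS (_ : y - m' + _ = y - (m' - (t - m0) *: c)); last first.
    by rewrite opprB [_ *: c - m']addrC addrA.
  set A := sg * (_ ^+ 2); set B := qf _ _ _.
  rewrite (_ : - (A + B) / 2 = - A / 2 + - B / 2); last by rewrite opprD mulrDl.
  rewrite (sqrtrM _ (ltW sg0)) exprS invfM expRD.
  move: (expR _) (expR _) (Num.sqrt sg) (Num.sqrt (\det D)) (_^-1) (_^-1) => e1 e2 r1 r2 c1 c2.
  ring.
rewrite ge0_integralZl //; last 3 first.
- apply/measurable_EFinP; apply: measurable_mvn => //; exact: measurable_cst.
- by move=> x _; rewrite lee_fin mvn_ge0.
- by rewrite lee_fin /C !mulr_ge0 ?expR_ge0 ?invr_ge0 ?sqrtr_ge0.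
by rewrite IH // mule1.
Qed.

End multivariate.

(** * Contraction of the Albert-Chib chain *)

(** The test on the left is symmetric in [a] and [b]. It therefore selects one closed orthant
    containing two vectors that have no strict sign disagreement. *)
Lemma mul_ge0_sign (R : realDomainType) (a b : R) : 0 <= a * b ->
  if (0 <= a) && (0 <= b) then 0 <= a else a <= 0.
Proof.
case: (leP 0 a) => a0 /=; last by move=> _; exact: ltW.
case: (leP 0 b) => //= b0 ab; rewrite leNgt; apply/negP => a1.
by move: ab; rewrite leNgt pmulr_rlt0 // b0.
Qed.

Section chain.
Variables (R : realType) (p : nat) (v : 'cV[R]_p) (Q : 'M[R]_p) (n : nat)
  (Xs : nat -> 'cV[R]_p) (Ys : nat -> bool).
Hypothesis Qs : Q^T = Q.
Hypothesis Q_ge0 : forall a, 0 <= qf Q a a.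
Local Notation S := (Sigma Q n Xs).
Hypothesis S_pd : posdef S.
Local Notation N2 a := (qf S a a).
Local Notation mean := (@ac_mean R p v Q n Xs).
Definition lin (i : nat) (b : 'cV[R]_p) : R := ((Xs i)^T *m b) ord0 ord0.

Lemma linD i a b : lin i (a + b) = lin i a + lin i b.
Proof. by rewrite /lin mulmxDr mxE. Qed.
Lemma linN i a : lin i (- a) = - lin i a.
Proof. by rewrite /lin mulmxN mxE. Qed.
Lemma linB i a b : lin i (a - b) = lin i a - lin i b.
Proof. by rewrite linD linN. Qed.

Lemma linE i b : lin i b = \sum_j Xs i j ord0 * b j ord0.
Proof. by rewrite /lin mxE; apply: eq_bigr => j _; rewrite mxE. Qed.

Lemma design_lin (i : 'I_n) a : (design n Xs *m a) i ord0 = lin i a.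
Proof. by rewrite mxE linE; apply: eq_bigr => j _; rewrite mxE. Qed.

Lemma design_tr (z : 'cV[R]_n) a :
  ((design n Xs)^T *m z)^T *m a = (\sum_i z i ord0 * lin i a)%:M.
Proof.
rewrite trmx_mul trmxK -mulmxA [LHS]mx11_scalar; congr (_ %:M).
by rewrite mxE; apply: eq_bigr => i _; rewrite mxE design_lin.
Qed.

Lemma qfSE a b : qf S a b = \sum_(i < n) lin i a * lin i b + qf Q a b.
Proof.
rewrite /Sigma qfDm; congr (_ + _); rewrite /qf mulmxA -mulmxA -trmx_mul mxE.
by apply: eq_bigr => i _; rewrite mxE !design_lin.
Qed.

Lemma N2E a : N2 a = \sum_(i < n) lin i a ^+ 2 + qf Q a a.
Proof. by rewrite qfSE; congr (_ + _); apply: eq_bigr => i _; rewrite expr2. Qed.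

Lemma N2_ge0 a : 0 <= N2 a. Proof. exact: posdef_ge0. Qed.

(** [Sigma] cancels the inverse inside the mean, so later computations with the mean never meet an
    inverse matrix. *)
Lemma qf_mean z b : qf S (mean z) b = \sum_(i < n) z i ord0 * lin i b + qf Q v b.
Proof.
rewrite /qf /ac_mean trmx_mul trmx_inv S_pd.1 mulmxKV ?posdef_unit //.
rewrite [in LHS]linearD /= mulmxDl mxE design_tr mxE eqxx mulr1n.
by congr (_ + _); rewrite trmx_mul Qs.
Qed.

Lemma meanB z z' b : qf S (mean z - mean z') b = \sum_(i < n) (z i ord0 - z' i ord0) * lin i b.
Proof.
rewrite qfDl qfNl !qf_mean opprD addrACA subrr addr0 -sumrB.
by apply: eq_bigr => i _; rewrite mulrBl.
Qed.

(** For $a$ the difference of the means, $N(a)=\langle z-z',Xa\rangle\le\frac12(|z-z'|^2+|Xa|^2)$,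
    and $|Xa|^2\le N(a)$ because $Q\ge 0$. *)
Lemma mean_contract z z' :
  N2 (mean z - mean z') <= \sum_(i < n) (z i ord0 - z' i ord0) ^+ 2.
Proof.
set a := _ - _.
have h1 : N2 a = \sum_(i < n) (z i ord0 - z' i ord0) * lin i a by exact: meanB.
have h2 : \sum_(i < n) lin i a ^+ 2 <= N2 a by rewrite N2E lerDl.
have h3 : 2 * (\sum_(i < n) (z i ord0 - z' i ord0) * lin i a) <=
    \sum_(i < n) (z i ord0 - z' i ord0) ^+ 2 + \sum_(i < n) lin i a ^+ 2.
  rewrite mulr_sumr -big_split /=; apply: ler_sum => i _.
  by rewrite -subr_ge0 (_ : _ - _ = (z i ord0 - z' i ord0 - lin i a) ^+ 2) ?sqr_ge0 //; ring.
lra.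
Qed.

Lemma N2D_le a b : N2 (a + b) <= 2 * N2 a + 2 * N2 b.
Proof.
have := N2_ge0 (a - b).
rewrite !(qfDl, qfDr, qfNl, qfNr) (qfC b a S_pd.1); lra.
Qed.

Lemma N2Z t a : N2 (t *: a) = t ^+ 2 * N2 a.
Proof. by rewrite qfZl qfZr mulrA expr2. Qed.

Lemma N2N a : N2 (- a) = N2 a.
Proof. by rewrite qfNl qfNr opprK. Qed.

Definition contr (s : 'I_p -> bool) (i : nat) : bool :=
  if Ys i then - Xs i \in orthant s else Xs i \in orthant s.

Definition corthant (s : 'I_p -> bool) (b : 'cV[R]_p) :=
  forall j, if s j then 0 <= b j ord0 else b j ord0 <= 0.

(** The vector $(1-2Y_i)X_i$ has in every coordinate the sign prescribed for [b], so all terms of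
    the inner product agree in sign. The predictor is then on the side away from the half-line
    selected by $Y_i$, as [tnq_contract] requires. *)
Lemma contr_sign s i b : contr s i -> corthant s b ->
  if Ys i then lin i b <= 0 else 0 <= lin i b.
Proof.
rewrite /contr => + sb; case: (Ys i) => /set_mem Xo; rewrite linE.
- apply: sumr_le0 => j _; have := Xo j; have := sb j; rewrite mxE; case: (s j).
    by rewrite oppr_gt0 => ? ?; rewrite mulr_le0_ge0 // ltW.
  by rewrite oppr_lt0 => ? ?; rewrite mulr_ge0_le0 // ltW.
- apply: sumr_ge0 => j _; have := Xo j; have := sb j; case: (s j).
    by move=> ? ?; rewrite mulr_ge0 // ltW.
  by move=> ? ?; rewrite mulr_le0 // ltW.
Qed.

(* A bound [f x <= f y + L |x - y|], with [|x - y| = min_(s > 0) (s + |x - y|^2 / s) / 2]. *)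
Definition lipV (L : R) (f : 'cV[R]_p -> \bar R) := forall x y s, 0 < s ->
  (f x <= f y + (L * (s / 2 + N2 (x - y) / (2 * s)))%:E)%E.

(** Latent vectors are compared through their means, the only way in which the Gaussian draw depends
    on them. *)
Definition lipZ (L : R) (f : 'cV[R]_n -> \bar R) := forall z z' s, 0 < s ->
  (f z <= f z' + (L * (s / 2 + N2 (mean z - mean z') / (2 * s)))%:E)%E.

(** Induction on the number of coordinates where [x] and [y] have strictly opposite signs. The
    segment is cut at a point where one such coordinate vanishes; that point disagrees with each end
    in strictly fewer coordinates. *)
Lemma lip_glue L (f : 'cV[R]_p -> \bar R) :
  (forall c x y s, corthant c x -> corthant c y -> 0 < s ->
     (f x <= f y + (L * (s / 2 + N2 (x - y) / (2 * s)))%:E)%E) -> lipV L f.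
Proof.
move=> H x y; pose dis (x y : 'cV[R]_p) := [set j | x j ord0 * y j ord0 < 0]%SET.
have [k] := ubnP #|dis x y|; elim: k x y => // k IH x y; rewrite ltnS => xyk s s0.
have [d0|[j jd]] := set_0Vmem (dis x y).
  pose c j := (0 <= x j ord0) && (0 <= y j ord0).
  have dj j : 0 <= x j ord0 * y j ord0.
    rewrite leNgt; apply/negP => h.
    by have : j \in dis x y; [rewrite inE | rewrite d0 finset.in_set0].
  apply: (H c) => // j; rewrite /c; first exact: mul_ge0_sign.
  by rewrite andbC; apply: mul_ge0_sign; rewrite mulrC.
have xyj : x j ord0 * y j ord0 < 0 by move: jd; rewrite inE.
pose a := x j ord0; pose b := y j ord0.
have ab0 : a - b != 0.
  rewrite subr_eq0; apply/eqP => e; move: xyj; rewrite -/a -/b e.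
  by rewrite ltNge -expr2 sqr_ge0.
(* The parameter at which the [j]-th coordinate of the segment is zero. *)
pose t := a / (a - b).
have t01 : 0 < t < 1.
  have aab : t * (a - b) = a by rewrite /t divfK.
  move: xyj; rewrite -/a -/b => ab.
  have [h|h] := leP (a - b) 0.
    have h' : a - b < 0 by rewrite lt_neqAle ab0.
    have a0 : a < 0 by nra. have b0 : 0 < b by nra.
    by apply/andP; split; nra.
  have a0 : 0 < a by nra. have b0 : b < 0 by nra.
  by apply/andP; split; nra.
have /andP[t0 t1] := t01.
have t1' : 0 < 1 - t by rewrite subr_gt0.
pose w := x + t *: (y - x).
have wE i : w i ord0 = (1 - t) * x i ord0 + t * y i ord0 by rewrite !mxE; ring.
have wj : w j ord0 = 0.
  by rewrite wE -/a -/b /t; field.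
have d1 : (#|dis x w| < k)%N.
  apply: leq_trans xyk; apply/proper_card/properP; split.
    apply/fintype.subsetP => i; rewrite !inE wE => h.
    have h2 : 0 <= (1 - t) * (x i ord0 * x i ord0) by rewrite mulr_ge0 ?(ltW t1') // -expr2 sqr_ge0.
    by rewrite -(pmulr_rlt0 _ t0); lra.
  by exists j => //; rewrite inE wj mulr0 ltxx.
have d2 : (#|dis w y| < k)%N.
  apply: leq_trans xyk; apply/proper_card/properP; split.
    apply/fintype.subsetP => i; rewrite !inE wE => h.
    have h2 : 0 <= t * (y i ord0 * y i ord0) by rewrite mulr_ge0 ?(ltW t0) // -expr2 sqr_ge0.
    by rewrite -(pmulr_rlt0 _ t1'); lra.
  by exists j => //; rewrite inE wj mul0r ltxx.
(* Sharing $s$ in the ratio $t:(1-t)$ makes the two bounds add up exactly: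
   $ts/2+t^2N/(2ts)=t(s/2+N/(2s))$, and likewise with $1-t$. *)
apply: le_trans (IH _ _ d1 (t * s) _) _; first by rewrite mulr_gt0.
apply: le_trans (leeD2r _ (IH _ _ d2 ((1 - t) * s) _)) _; first by rewrite mulr_gt0.
rewrite -addeA leeD2l // -EFinD lee_fin.
have -> : x - w = t *: (x - y) by rewrite /w opprD addrA subrr add0r -scalerN opprB.
have -> : w - y = (1 - t) *: (x - y).
  by apply/matrixP => i i'; rewrite !mxE; ring.
rewrite !N2Z le_eqVlt; apply/orP; left; apply/eqP; field.
by rewrite !gt_eqF.
Qed.

(** * The two half-steps as operators on test functions *)

Local Notation mu := (@lebesgue_measure R).
Local Open Scope ereal_scope.

Definition gauss_op (g : 'cV[R]_p -> \bar R) (z : 'cV[R]_n) : \bar R :=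
  \int[leb R p]_b ((mvn_prec_pdf (mean z) S b)%:E * g b).

Definition latent_op (h : 'cV[R]_n -> \bar R) (b : 'cV[R]_p) : \bar R :=
  \int[leb R n]_z ((latent_pdf Xs Ys b z)%:E * h z).

Lemma latent_ge0 b (z : 'cV[R]_n) : (0 <= latent_pdf Xs Ys b z)%R.
Proof. by apply: prodr_ge0 => i _; exact: tn_pdf_ge0. Qed.

Lemma measurable_lin dT (T : measurableType dT) i (f : T -> Vk R p) :
  measurable_fun setT f -> measurable_fun setT (fun w => lin i (f w)).
Proof.
move=> mf; under eq_fun do rewrite linE.
apply: measurable_sum => j; apply: measurable_funM => //.
exact: (measurableT_comp (@measurable_coord R p j) mf).
Qed.

Lemma measurable_latent dT (T : measurableType dT) (f : T -> Vk R p) (g : T -> Vk R n) :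
  measurable_fun setT f -> measurable_fun setT g ->
  measurable_fun setT (fun w => latent_pdf Xs Ys (f w) (g w)).
Proof.
move=> mf mg; apply: measurable_prod => i _; apply: measurable_tn_pdf.
  exact: measurable_lin.
exact: (measurableT_comp (@measurable_coord R n i) mg).
Qed.

Lemma measurable_mean dT (T : measurableType dT) (f : T -> Vk R n) :
  measurable_fun setT f -> measurable_fun setT (fun w => mean (f w) : Vk R p).
Proof.
move=> mf; apply: measurable_mulmx; apply: measurable_addV; last exact: measurable_cst.
exact: measurable_mulmx.
Qed.

Lemma measurable_gauss_op (g : Vk R p -> \bar R) : measurable_fun setT g ->
  (forall b, 0 <= g b) -> measurable_fun setT (gauss_op g : Vk R n -> \bar R).
Proof.
move=> mg g0.
apply: (@measurable_int_Vk R _ (Vk R n) p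
  (fun w => (mvn_prec_pdf (mean w.1) S w.2)%:E * g w.2)).
  apply: emeasurable_funM; last exact: (measurableT_comp mg measurable_snd).
  apply/measurable_EFinP; apply: measurable_mvn => //; exact: measurable_mean.
by move=> w; rewrite mule_ge0 // lee_fin mvn_ge0.
Qed.

Lemma measurable_latent_op (h : Vk R n -> \bar R) : measurable_fun setT h ->
  (forall b, 0 <= h b) -> measurable_fun setT (latent_op h : Vk R p -> \bar R).
Proof.
move=> mh h0.
apply: (@measurable_int_Vk R _ (Vk R p) n
  (fun w => (latent_pdf Xs Ys w.1 w.2)%:E * h w.2)).
  apply: emeasurable_funM; last exact: (measurableT_comp mh measurable_snd).
  by apply/measurable_EFinP; apply: measurable_latent.
by move=> w; rewrite mule_ge0 // lee_fin latent_ge0.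
Qed.

Lemma gauss_op_ge0 g z : (forall b, 0 <= g b) -> 0 <= gauss_op g z.
Proof. by move=> g0; apply: integral_ge0 => b _; rewrite mule_ge0 // lee_fin mvn_ge0. Qed.

Lemma latent_op_ge0 h b : (forall z, 0 <= h z) -> 0 <= latent_op h b.
Proof. by move=> h0; apply: integral_ge0 => z _; rewrite mule_ge0 // lee_fin latent_ge0. Qed.

Lemma ac_stepE b g : measurable_fun setT (g : Vk R p -> \bar R) -> (forall b, 0 <= g b) ->
  ac_step v Q n Xs Ys b g = latent_op (gauss_op g) b.
Proof.
move=> mg g0; rewrite /ac_step /latent_op.
have e z : intRk (fun b => (mvn_prec_pdf (mean z) S b)%:E * g b) = gauss_op g z.
  rewrite intRkE //.
    apply: emeasurable_funM => //; apply/measurable_EFinP.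
    by apply: measurable_mvn => //; exact: measurable_cst.
  by move=> x; rewrite mule_ge0 // lee_fin mvn_ge0.
rewrite -intRkE.
- by congr intRk; apply/funext => z; rewrite e.
- apply: emeasurable_funM; last exact: measurable_gauss_op.
  by apply/measurable_EFinP; apply: measurable_latent => //; exact: measurable_cst.
- by move=> z; rewrite mule_ge0 ?gauss_op_ge0 // lee_fin latent_ge0.
Qed.

Definition unit_cube (u : 'cV[R]_n) : R :=
  (\prod_(i < n) \1_(`]0, 1[%classic : set R) (u i ord0))%R.
Definition quant (b : 'cV[R]_p) (u : 'cV[R]_n) : 'cV[R]_n :=
  \col_i tnq (lin i b) (Ys i) (u i ord0).

(** This is the coupling of the latent draws: the randomness [u] no longer depends on the state [b],
    so two states can be compared under one integral sign. *)
Lemma latent_op_quant (h : Vk R n -> \bar R) b : measurable_fun setT h -> (forall z, 0 <= h z) ->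
  latent_op h b = \int[leb R n]_u ((unit_cube u)%:E * h (quant b u)).
Proof.
move=> mh h0.
have E := @leb_coupling R n (fun i => tn_pdf (lin i b) (Ys i))
  (fun _ => \1_(`]0%R, 1%R[%classic : set R)) (fun i => tnq (lin i b) (Ys i)) _ _ _ _ _ _ h mh h0.
apply: E => //.
- by move=> i; apply: measurable_tn_pdf.
- by move=> i; exact: measurable_tnq.
- by move=> i x; exact: tn_pdf_ge0.
- by move=> i k mk k0; exact: tn_pdf_law.
Qed.

Lemma leb_prod k (f : 'I_k -> R -> R) (c : 'I_k -> R) :
  (forall i, measurable_fun setT (f i)) -> (forall i x, (0 <= f i x)%R) ->
  (forall i, \int[mu]_x (f i x)%:E = (c i)%:E) ->
  \int[leb R k]_x (\prod_i f i (x i ord0))%R%:E = (\prod_i c i)%:E.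
Proof.
elim: k f c => [|k IH] f c mf f0 fc.
  rewrite -intRkE; first by rewrite /= !big_ord0.
    by apply/measurable_EFinP; apply: measurable_prod => -[].
  by move=> x; rewrite lee_fin prodr_ge0.
have mprod : measurable_fun setT (fun x : Vk R k => (\prod_i f (lift ord0 i) (x i ord0))%R).
  apply: measurable_prod => i _.
  exact: (measurableT_comp (mf _) (@measurable_coord R k i)).
rewrite integral_consV; last 2 first.
- apply/measurable_EFinP; apply: measurable_prod => i _.
  exact: (measurableT_comp (mf i) (@measurable_coord R k.+1 i)).
- by move=> x; rewrite lee_fin prodr_ge0.
transitivity (\int[mu]_t ((f ord0 t)%:E * (\prod_i c (lift ord0 i))%:E)).
  apply: eq_integral => t _; rewrite -(IH _ _ (fun i => mf (lift ord0 i)) (fun i => f0 (lift ord0 i)) (fun i => fc (lift ord0 i))).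
  rewrite -ge0_integralZl //; last 3 first.
  - exact/measurable_EFinP.
  - by move=> y _; rewrite lee_fin prodr_ge0.
  - by rewrite lee_fin.
  apply: eq_integral => y _; rewrite -EFinM big_ord_recl consV0.
  by congr EFin; congr (_ * _)%R; apply: eq_bigr => i _; rewrite consVS.
rewrite ge0_integralZr //; last 3 first.
- by apply/measurable_EFinP; exact: mf.
- by move=> y _; rewrite lee_fin.
- rewrite lee_fin prodr_ge0 // => i _; rewrite -lee_fin -fc.
  by apply: integral_ge0 => x _; rewrite lee_fin.
by rewrite fc -EFinM big_ord_recl.
Qed.

Lemma measurable_unit_cube : measurable_fun setT (unit_cube : Vk R n -> R).
Proof.
apply: measurable_prod => i _.
have m1 : measurable_fun setT (\1_(`]0%R, 1%R[%classic : set R) : R -> R).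
  exact: measurable_indic.
exact: (measurableT_comp m1 (@measurable_coord R n i)).
Qed.

Lemma unit_cube_ge0 u : (0 <= unit_cube u)%R.
Proof. by apply: prodr_ge0 => i _; rewrite indicE. Qed.

Lemma measurable_quant b : measurable_fun setT (quant b : Vk R n -> Vk R n).
Proof.
apply: measurable_toVk => i; under eq_fun do rewrite mxE.
exact: (measurableT_comp (measurable_tnq _ _) (@measurable_coord R n i)).
Qed.

Lemma integral_indic01 : \int[mu]_u (\1_(`]0%R, 1%R[%classic : set R) u)%:E = 1.
Proof.
by rewrite integral_indic //= setIT lebesgue_measure_itv /= lte01 oppr0 addr0.
Qed.

Lemma integral_unit_cube : \int[leb R n]_u (unit_cube u)%:E = 1.
Proof.
rewrite (@leb_prod n (fun=> \1_(`]0%R, 1%R[%classic : set R)) (fun=> 1%R)) //.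
- by rewrite big1.
- by move=> i; exact: integral_indic01.
Qed.

Lemma integral_latent b : \int[leb R n]_z (latent_pdf Xs Ys b z)%:E = 1.
Proof.
have := @latent_op_quant (cst 1) b (measurable_cst _) (fun=> lee01).
rewrite /latent_op /=; under eq_integral do rewrite mule1.
by under [in RHS]eq_integral do rewrite mule1; rewrite integral_unit_cube.
Qed.

Lemma integral_unit_cube_coord (i : 'I_n) (f : R -> R) c : measurable_fun setT f ->
  (forall x, (0 <= f x)%R) ->
  \int[mu]_u ((\1_(`]0%R, 1%R[%classic : set R) u) * f u)%R%:E = c%:E ->
  \int[leb R n]_u (unit_cube u * f (u i ord0))%R%:E = c%:E.
Proof.
move=> mf f0 fc.
pose F j x : R := (\1_(`]0%R, 1%R[%classic : set R) x * (if j == i then f x else 1))%R.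
transitivity (\int[leb R n]_u (\prod_j F j (u j ord0))%R%:E).
  apply: eq_integral => u _; congr EFin; rewrite /F big_split /=; congr (_ * _)%R.
  rewrite (bigD1 i) //= eqxx big1 ?mulr1 // => j ji.
  by rewrite (negbTE ji).
rewrite (@leb_prod n F (fun j => if j == i then c else 1%R)).
- rewrite (bigD1 i) //= eqxx big1 ?mulr1 // => j ji.
  by rewrite (negbTE ji).
- by move=> j; rewrite /F; apply: measurable_funM => //; case: (j == i).
- by move=> j x; rewrite /F mulr_ge0 ?indicE //; case: (j == i).
- move=> j; rewrite /F; case: (j == i) => //.
  by under eq_integral do rewrite mulr1; exact: integral_indic01.
Qed.

Lemma integral_onem2 :
  \int[mu]_u ((\1_(`]0%R, 1%R[%classic : set R) u) * (1 - u) ^+ 2)%R%:E = (3%R^-1)%:E.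
Proof.
have mf : measurable_fun setT (fun u : R => (1 - u) ^+ 2)%R.
  by apply: measurable_funX; exact: measurable_funB.
have m1 : measurable_fun setT (fun u : R => \1_(`]0%R, 1%R[%classic : set R) u * (1 - u) ^+ 2)%R.
  by apply: measurable_funM.
have E : \int[mu]_u ((\1_(`]0%R, 1%R[%classic : set R) u) * (1 - u) ^+ 2)%R%:E =
    \int[mu]_(u in `[0%R, 1%R]) (((1 - u) ^+ 2)%R)%:E.
  rewrite -integral_itv_obnd_cbnd; last by apply/measurable_EFinP; exact: measurable_funTS.
  rewrite -integral_itv_bndo_bndc; last by apply/measurable_EFinP; exact: measurable_funTS.
  rewrite [RHS]integral_mkcond; apply: eq_integral => u _.
  by rewrite patchE indicE; case: ifP => _; rewrite ?mul1r ?mul0r.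
have I := @Rintegral_onemXn R 2.
rewrite E -[X in X%:E]I /Rintegral fineK // -E ge0_fin_numE; last first.
  by apply: integral_ge0 => u _; rewrite lee_fin mulr_ge0 ?sqr_ge0 // indicE.
apply: le_lt_trans (_ : 1 < +oo); last exact: ltry.
rewrite -integral_indic01; apply: ge0_le_integral => //.
- by move=> u _; rewrite lee_fin mulr_ge0 ?sqr_ge0 // indicE.
- exact/measurable_EFinP.
- by apply/measurable_EFinP; exact: measurable_indic.
move=> u _; rewrite lee_fin indicE; case: (boolP (u \in _)); rewrite ?mul0r // mul1r.
by move=> /set_mem; rewrite /= in_itv /= => /andP[u0 u1]; nra.
Qed.

(** * The Gaussian draw: common noise and smoothing *)

Lemma leb_mvn_shift (g : Vk R p -> \bar R) z : measurable_fun setT g -> (forall b, 0 <= g b) ->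
  gauss_op g z = \int[leb R p]_b ((mvn_prec_pdf 0 S b)%:E * g ((b : 'cV[R]_p) + mean z)%R).
Proof.
move=> mg g0; rewrite /gauss_op -(leb_shift (mean z)); last 2 first.
- apply: emeasurable_funM => //; apply/measurable_EFinP.
  by apply: measurable_mvn => //; exact: measurable_cst.
- by move=> x; rewrite mule_ge0 // lee_fin mvn_ge0.
by apply: eq_integral => b _; rewrite !mvnE addrK subr0.
Qed.

Lemma integral_mul_addc d (T : measurableType d) (m : {measure set T -> \bar R})
  (w : T -> R) (g : T -> \bar R) (c : R) :
  measurable_fun setT w -> (forall x, (0 <= w x)%R) -> \int[m]_x (w x)%:E = 1 ->
  measurable_fun setT g -> (forall x, 0 <= g x) -> (0 <= c)%R ->
  \int[m]_x ((w x)%:E * (g x + c%:E)) = \int[m]_x ((w x)%:E * g x) + c%:E.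
Proof.
move=> mw w0 w1 mg g0 c0.
under eq_integral do rewrite ge0_muleDr ?lee_fin //.
rewrite ge0_integralD //; first last.
- by apply: emeasurable_funM => //; exact/measurable_EFinP.
- by move=> x _; rewrite mule_ge0 ?lee_fin.
- by apply: emeasurable_funM => //; exact/measurable_EFinP.
- by move=> x _; rewrite mule_ge0 ?lee_fin.
congr (_ + _); rewrite ge0_integralZr ?lee_fin //.
- by rewrite w1 mul1e.
- exact/measurable_EFinP.
- by move=> x _; rewrite lee_fin.
Qed.

(** With common noise the two draws differ exactly by the difference of the means, so the bound is
    constant under the integral and passes through it unchanged. *)
Lemma lipZ_gauss_op L (g : Vk R p -> \bar R) : measurable_fun setT g -> (forall b, 0 <= g b) ->
  (0 <= L)%R -> lipV L g -> lipZ L (gauss_op g).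
Proof.
move=> mg g0 L0 gL z z' s s0; set c := (L * _)%R.
have c0 : (0 <= c)%R.
  by rewrite mulr_ge0 // addr_ge0 // divr_ge0 ?N2_ge0 ?mulr_ge0 ?ltW.
have mgs y : measurable_fun setT (fun b : Vk R p => g ((b : 'cV[R]_p) + y)%R).
  by apply: (measurableT_comp mg); apply: measurable_addV => //; exact: measurable_cst.
have mw : measurable_fun setT (fun b : Vk R p => mvn_prec_pdf 0 S b).
  by apply: measurable_mvn => //; exact: measurable_cst.
rewrite !leb_mvn_shift // -integral_mul_addc //; last 2 first.
- by move=> x; exact: mvn_ge0.
- exact: integral_mvn.
apply: ge0_le_integral => //.
- by move=> x _; rewrite mule_ge0 // lee_fin mvn_ge0.
- by apply: emeasurable_funM => //; exact/measurable_EFinP.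
- apply: emeasurable_funM; first exact/measurable_EFinP.
  by apply: emeasurable_funD => //; exact: measurable_cst.
move=> b _; rewrite lee_wpmul2l ?lee_fin ?mvn_ge0 //.
have := gL (b + mean z)%R (b + mean z')%R s s0.
by rewrite /c (_ : b + mean z - (b + mean z') = mean z - mean z')%R // opprD addrACA subrr add0r.
Qed.

(** Positivity of the normalizing constant is deduced from the total mass being one: a zero constant
    would give mass zero. *)
Lemma mvn_gt0 (m b : 'cV[R]_p) : (0 < mvn_prec_pdf m S b)%R.
Proof.
have c0 : (0 < (Num.sqrt (2 * pi))^-p * Num.sqrt (\det S) :> R)%R.
  rewrite lt0r mulr_ge0 ?invr_ge0 ?exprn_ge0 ?sqrtr_ge0 // andbT; apply/eqP => c0.
  have := integral_mvn 0 S_pd; under eq_integral do rewrite mvnE c0 mul0r.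
  by rewrite integral0 => /eqP; rewrite eq_sym onee_eq0.
by rewrite mvnE mulr_gt0 // expR_gt0.
Qed.

(* The chi-square density [f_m'^2 / f_m] is a multiple of another Gaussian density. *)
Lemma mvn_chi2 (m m' b : 'cV[R]_p) :
  (mvn_prec_pdf m' S b ^+ 2 =
   mvn_prec_pdf m S b * (expR (N2 (m' - m)) * mvn_prec_pdf (m' + m' - m) S b))%R.
Proof.
rewrite !mvnE; set C := (_ * Num.sqrt _)%R.
have e : (expR (- N2 (b - m') / 2) ^+ 2 = expR (- N2 (b - m) / 2) *
    (expR (N2 (m' - m)) * expR (- N2 (b - (m' + m' - m)) / 2)))%R.
  rewrite expr2 -!expRD; congr expR.
  rewrite (_ : b - m = (b - m') + (m' - m))%R; last by rewrite addrA subrK.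
  rewrite (_ : b - (m' + m' - m) = (b - m') - (m' - m))%R; last first.
    by apply/matrixP => k l; rewrite !mxE; ring.
  move: (b - m')%R (m' - m)%R => x y.
  rewrite !(qfDl, qfDr, qfNl, qfNr) (qfC y x S_pd.1); by field.
by rewrite exprMn e; ring.
Qed.

Lemma expR_le_2x (x : R) : (0 <= x <= 1 / 2 -> expR x <= 1 + 2 * x)%R.
Proof.
move=> /andP[x0 x1].
have h : (1 - x <= expR (- x))%R by have := expR_ge1Dx (- x).
have h0 : (0 < 1 - x)%R by lra.
rewrite -[x in expR x]opprK expRN; apply: (@le_trans _ _ (1 - x)^-1%R).
  by rewrite lef_pV2 ?posrE ?expR_gt0.
by rewrite -div1r ler_pdivrMr //; nra.
Qed.

Lemma integral_mvn_g (m : 'cV[R]_p) (g : 'cV[R]_p -> R) : measurable_fun setT (g : Vk R p -> R) ->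
  (forall b, (0 <= g b <= 1)%R) ->
  0 <= \int[leb R p]_b (mvn_prec_pdf m S b * g b)%R%:E <= 1.
Proof.
move=> mg g01; apply/andP; split.
  apply: integral_ge0 => b _; rewrite lee_fin mulr_ge0 ?mvn_ge0 //.
  by have /andP[] := g01 b.
have mw : measurable_fun setT (fun b : Vk R p => mvn_prec_pdf m S b).
  by apply: measurable_mvn => //; exact: measurable_cst.
rewrite -(integral_mvn m S_pd); apply: ge0_le_integral => //.
- move=> b _; rewrite lee_fin mulr_ge0 ?mvn_ge0 //.
  by have /andP[] := g01 b.
- by apply/measurable_EFinP; exact: measurable_funM.
- exact/measurable_EFinP.
by move=> b _; rewrite lee_fin ler_piMr ?mvn_ge0 //; have /andP[] := g01 b.
Qed.

(** Total variation through the chi-square divergence, with the Cauchy-Schwarz step replaced by the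
    pointwise inequality $g(r-1)\le t/2+(r-1)^2/(2t)$ for the density ratio $r=f'/f$. Integrated
    against $f$, the term $r^2$ contributes $\exp N(m'-m)$ by [mvn_chi2]. *)
Lemma mvn_tv (m m' : 'cV[R]_p) (g : 'cV[R]_p -> R) (t : R) :
  measurable_fun setT (g : Vk R p -> R) -> (forall b, (0 <= g b <= 1)%R) -> (0 < t)%R ->
  \int[leb R p]_b (mvn_prec_pdf m' S b * g b)%R%:E <=
  \int[leb R p]_b (mvn_prec_pdf m S b * g b)%R%:E +
    (t / 2 + (expR (N2 (m' - m)) - 1) / (2 * t))%:E.
Proof.
move=> mg g01 t0.
pose f := mvn_prec_pdf m S; pose f' := mvn_prec_pdf m' S.
pose W := mvn_prec_pdf (m' + m' - m) S; pose E := expR (N2 (m' - m)).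
have mw y : measurable_fun setT (fun b : Vk R p => mvn_prec_pdf y S b).
  by apply: measurable_mvn => //; exact: measurable_cst.
have chi b : (f' b ^+ 2 = f b * (E * W b))%R.
  exact: mvn_chi2.
have t1 : (0 <= t^-1)%R by rewrite invr_ge0 ltW.
have t2 : (0 <= t / 2 + (2 * t)^-1)%R by rewrite addr_ge0 ?invr_ge0 ?mulr_ge0 ?divr_ge0 ?ltW.
(* The cross term $r/t$ of the expanded square is kept on the left, so that all integrands are
   nonnegative. *)
have pt b : (f' b * g b + t^-1 * f' b <=
    f b * g b + ((t / 2 + (2 * t)^-1) * f b + (E / (2 * t)) * W b))%R.
  have f0 : (0 < f b)%R by exact: mvn_gt0.
  pose r := (f' b / f b)%R.
  have f'E : (f' b = r * f b)%R by rewrite /r divfK // gt_eqF.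
  have WE : (E * W b = r ^+ 2 * f b)%R.
    apply: (mulfI (lt0r_neq0 f0)); rewrite -chi f'E; ring.
  rewrite (mulrAC E) WE f'E.
  rewrite (_ : r * f b * g b + t^-1 * (r * f b) = f b * (r * g b + r / t))%R; last by ring.
  rewrite (_ : f b * g b + _ = f b * (g b + t / 2 + (1 + r ^+ 2) / (2 * t)))%R; last first.
    by field; rewrite gt_eqF.
  rewrite ler_pM2l //.
  have /andP[g0 g1] := g01 b.
  rewrite -subr_ge0.
  rewrite (_ : _ - _ = (t ^+ 2 + (r - 1) ^+ 2 - 2 * t * (g b * (r - 1))) / (2 * t))%R; last first.
    by field; rewrite gt_eqF.
  rewrite divr_ge0 //; last by rewrite mulr_ge0 // ltW.
  have h : (g b ^+ 2 <= 1)%R by rewrite expr_le1.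
  have h1 : (0 <= (t - g b * (r - 1)) ^+ 2)%R by exact: sqr_ge0.
  have h2 : (0 <= (1 - g b ^+ 2) * (r - 1) ^+ 2)%R by rewrite mulr_ge0 ?sqr_ge0 ?subr_ge0.
  nra.
have mfg y : measurable_fun setT (fun b : Vk R p => mvn_prec_pdf y S b * g b)%R.
  exact: measurable_funM.
have fg0 y b : (0 <= mvn_prec_pdf y S b * g b)%R.
  by rewrite mulr_ge0 ?mvn_ge0 //; have /andP[] := g01 b.
have cI (c : R) y : (0 <= c)%R -> \int[leb R p]_b (c * mvn_prec_pdf y S b)%R%:E = c%:E.
  move=> c0; under eq_integral do rewrite EFinM.
  rewrite ge0_integralZl ?lee_fin //; last 2 first.
  - exact/measurable_EFinP.
  - by move=> b _; rewrite lee_fin mvn_ge0.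
  by rewrite integral_mvn // mule1.
have H : \int[leb R p]_b (f' b * g b + t^-1 * f' b)%:E <=
    \int[leb R p]_b (f b * g b + ((t / 2 + (2 * t)^-1) * f b + (E / (2 * t)) * W b))%:E.
  apply: ge0_le_integral => //.
  - by move=> b _; rewrite lee_fin addr_ge0 ?fg0 // mulr_ge0 ?mvn_ge0.
  - apply/measurable_EFinP; apply: measurable_funD; first exact: mfg.
    by apply: measurable_funM => //; exact: mw.
  - apply/measurable_EFinP; apply: measurable_funD; first exact: mfg.
    by apply: measurable_funD; apply: measurable_funM => //; exact: mw.
  - by move=> b _; rewrite lee_fin; exact: pt.
have E0 : (0 <= E / (2 * t))%R by rewrite divr_ge0 ?expR_ge0 ?mulr_ge0 ?ltW.
have I1 : \int[leb R p]_b (f' b * g b + t^-1 * f' b)%:E =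
    \int[leb R p]_b (f' b * g b)%:E + (t^-1)%:E.
  rewrite -(cI _ m' t1) -ge0_integralD //.
  - by move=> b _; rewrite lee_fin fg0.
  - by apply/measurable_EFinP; exact: mfg.
  - by move=> b _; rewrite lee_fin mulr_ge0 ?mvn_ge0.
  - by apply/measurable_EFinP; apply: measurable_funM => //; exact: mw.
have I2 : \int[leb R p]_b (f b * g b + ((t / 2 + (2 * t)^-1) * f b + (E / (2 * t)) * W b))%:E =
    \int[leb R p]_b (f b * g b)%:E + ((t / 2 + (2 * t)^-1)%:E + (E / (2 * t))%:E).
  rewrite -(cI _ m t2) -(cI _ (m' + m' - m)%R E0) -ge0_integralD //; last 4 first.
  - by move=> b _; rewrite lee_fin mulr_ge0 ?mvn_ge0.
  - by apply/measurable_EFinP; apply: measurable_funM => //; exact: mw.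
  - by move=> b _; rewrite lee_fin mulr_ge0 ?mvn_ge0.
  - by apply/measurable_EFinP; apply: measurable_funM => //; exact: mw.
  rewrite -ge0_integralD //.
  - by move=> b _; rewrite lee_fin fg0.
  - by apply/measurable_EFinP; exact: mfg.
  - by move=> b _; rewrite lee_fin addr_ge0 // mulr_ge0 ?mvn_ge0.
  - by apply/measurable_EFinP; apply: measurable_funD; apply: measurable_funM => //; exact: mw.
move: H; rewrite I1 I2.
have /andP[A0 A1] := integral_mvn_g m' mg g01.
have /andP[B0 B1] := integral_mvn_g m mg g01.
rewrite -/f -/f' in A0 A1 B0 B1 *.
have gen (IA IB : \bar R) : 0 <= IA -> IA <= 1 -> 0 <= IB -> IB <= 1 ->
    IA + (t^-1)%:E <= IB + ((t / 2 + (2 * t)^-1)%:E + (E / (2 * t))%:E) ->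
    IA <= IB + (t / 2 + (E - 1) / (2 * t))%:E.
  case: IA => [a| |] // _ _; case: IB => [c| |] // _ _.
  rewrite -!EFinD !lee_fin => H.
  have e1 : (t^-1 = (2 * t)^-1 + (2 * t)^-1)%R by field; rewrite gt_eqF.
  rewrite mulrBl mul1r; lra.
rewrite -/E; exact: (gen _ _ A0 A1 B0 B1).
Qed.

Lemma fine_unit_itv d (T : measurableType d) (g : T -> \bar R) : measurable_fun setT g ->
  (forall x, 0 <= g x <= 1) ->
  exists2 f : T -> R, measurable_fun setT f &
    (forall x, (0 <= f x <= 1)%R) /\ (forall x, g x = (f x)%:E).
Proof.
move=> mg g01; have gf x : g x \is a fin_num.
  have /andP[g0 g1] := g01 x.
  by rewrite ge0_fin_numE // (le_lt_trans g1) // ltry.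
exists (fine \o g); first exact: measurableT_comp.
by split => x; rewrite -?lee_fin /= fineK.
Qed.

(** The only place where a merely bounded function becomes Lipschitz. For $x\le 1/2$ the constant
    $2$ absorbs $e^x-1\le 2x$. For $x>1/2$ the bound is $s+x/s\ge 1$, because
    $s^2+x-s=(s-1/2)^2+x-1/4$, and nothing remains to prove for values in $[0,1]$. *)
Lemma lipZ_gauss_op1 (g : Vk R p -> \bar R) : measurable_fun setT g ->
  (forall b, 0 <= g b <= 1) -> lipZ 2 (gauss_op g).
Proof.
move=> mg /(fine_unit_itv mg)[f mf [f01 gf]] z z' s s0.
have gauss_opE y : gauss_op g y = \int[leb R p]_b (mvn_prec_pdf (mean y) S b * f b)%R%:E.
  by apply: eq_integral => b _; rewrite gf -EFinM.
rewrite !gauss_opE; set x := N2 _.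
have x0 : (0 <= x)%R by exact: N2_ge0.
have [x1|x1] := leP x (1 / 2)%R.
  apply: le_trans (mvn_tv (mean z') (mean z) mf f01 s0) _.
  rewrite leeD2l // lee_fin -/x.
  have x01 : (0 <= x <= 1 / 2)%R by rewrite x0.
  have h1 : ((expR x - 1) / (2 * s) <= (2 * x) / (2 * s))%R.
    rewrite ler_pM2r ?invr_gt0 ?mulr_gt0 //.
    by have := expR_le_2x x01; lra.
  apply: le_trans (_ : s / 2 + (2 * x) / (2 * s) <= _)%R; first by rewrite lerD2l.
  rewrite mulrDr mulrA lerD // ?mulrA //; lra.
have /andP[A0 A1] := integral_mvn_g (mean z) mf f01.
have /andP[B0 B1] := integral_mvn_g (mean z') mf f01.
apply: (le_trans A1); rewrite -[1]add0e leeD // lee_fin.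
rewrite (_ : 2 * (s / 2 + x / (2 * s)) = (s ^+ 2 + x) / s)%R; last by field; rewrite gt_eqF.
rewrite ler_pdivlMr // mul1r -subr_ge0.
have := sqr_ge0 (s - 1 / 2)%R; lra.
Qed.

(** * Contraction of a full step under the orthant condition *)

Variable eps : R.
Hypothesis eps0 : (0 < eps)%R.
Hypothesis eps1 : (eps <= 1)%R.
Hypothesis contr_ge : forall s a,
  (eps * N2 a <= \sum_(i < n | contr s i) lin i a ^+ 2)%R.

(** The square of the Lipschitz constant, in the predictor, of the [i]-th quantile at level [u] for
    states in the closed orthant [s]. *)
Definition contr_weight (s : 'I_p -> bool) (i : nat) (u : R) : R :=
  (if contr s i then (1 - u) ^+ 2 else 1)%R.

Lemma quant_le s b b' (u : 'cV[R]_n) (i : 'I_n) : corthant s b -> corthant s b' ->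
  (0 < u i ord0 < 1)%R ->
  ((quant b u i ord0 - quant b' u i ord0) ^+ 2 <=
   lin i (b - b') ^+ 2 * contr_weight s i (u i ord0))%R.
Proof.
move=> sb sb' u01; rewrite !mxE /contr_weight linB.
have n0 (x : R) : (x ^+ 2 = `|x| ^+ 2)%R by rewrite real_normK ?num_real.
have [ci|ci] := boolP (contr s i); last first.
  by rewrite mulr1 n0 [leRHS]n0 lerXn2r ?nnegrE // tnq_lip.
have [u0 u1] := andP u01.
rewrite n0 [X in (_ <= X * _)%R]n0 -exprMn lerXn2r ?nnegrE ?mulr_ge0 ?subr_ge0 ?(ltW u1) //.
apply: tnq_contract => //.
have := contr_sign ci sb; have := contr_sign ci sb'.
by case: (Ys i) => -> ->.
Qed.

Lemma measurable_contr_weight s i : measurable_fun setT (contr_weight s i).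
Proof.
rewrite /contr_weight; case: (contr s i) => //.
by apply: measurable_funX; exact: measurable_funB.
Qed.

Lemma contr_weight_ge0 s i u : (0 <= contr_weight s i u)%R.
Proof. by rewrite /contr_weight; case: ifP => // _; exact: sqr_ge0. Qed.

Lemma integral_contr_weight s (i : 'I_n) : \int[leb R n]_u (unit_cube u * contr_weight s i (u i ord0))%R%:E =
  (if contr s i then 3%R^-1 else 1%R)%:E.
Proof.
apply: integral_unit_cube_coord; [exact: measurable_contr_weight|exact: contr_weight_ge0|].
rewrite /contr_weight; case: (contr s i); first exact: integral_onem2.
by under eq_integral do rewrite mulr1; exact: integral_indic01.
Qed.

Local Notation rho2 := (1 - 2 / 3 * eps)%R.

Lemma sum_contr_weight_le s a :
  (\sum_(i < n) lin i a ^+ 2 * (if contr s i then 3^-1 else 1) <= rho2 * N2 a)%R.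
Proof.
have := contr_ge s a; have := Q_ge0 a; have := N2E a.
rewrite [in X in _ -> _ -> (_ <= X)%R -> _](big_mkcond _ _).
set A := (\sum_(i < n) _)%R; set B := (\sum_i _)%R => e q h.
have -> : (\sum_(i < n) lin i a ^+ 2 * (if contr s i then 3^-1 else 1) = A - 2 / 3 * B)%R.
  rewrite /A /B mulr_sumr -sumrB; apply: eq_bigr => i _.
  by case: (contr s i); [field|rewrite mulr1 mulr0 subr0].
nra.
Qed.

Let rho : R := Num.sqrt rho2.

Lemma rho2_gt0 : (0 < rho2)%R. Proof. by move: eps1; lra. Qed.

Lemma rho_gt0 : (0 < rho)%R. Proof. by rewrite sqrtr_gt0 rho2_gt0. Qed.

Lemma rho_lt1 : (rho < 1)%R.
Proof.
rewrite -[1%R](@sqrtr1 R) ltr_sqrt //; move: eps0; lra.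
Qed.

Lemma rhoK : (rho * rho = rho2)%R.
Proof. by rewrite -expr2 sqr_sqrtr // ltW // rho2_gt0. Qed.

(** The bound on [h] is linear in the squared distance of the means, so integrating over the
    uniforms needs only the mean of [contr_weight]; the free parameter [t] stands in for Jensen's
    inequality. *)
Lemma latent_op_orthant s L (h : Vk R n -> \bar R) : measurable_fun setT h ->
  (forall z, 0 <= h z) -> (0 <= L)%R -> lipZ L h ->
  forall b b' t, corthant s b -> corthant s b' -> (0 < t)%R ->
  latent_op h b <= latent_op h b' + (L * (t / 2 + rho2 * N2 (b - b') / (2 * t)))%R%:E.
Proof.
move=> mh h0 L0 hL b b' t sb sb' t0; rewrite !latent_op_quant //.
pose q (u : 'cV[R]_n) : R := (\sum_(i < n) lin i (b - b') ^+ 2 * contr_weight s i (u i ord0))%R.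
have mq : measurable_fun setT (q : Vk R n -> R).
  apply: measurable_sum => i; apply: measurable_funM => //.
  exact: (measurableT_comp (measurable_contr_weight _ _) (@measurable_coord R n i)).
have q0 u : (0 <= q u)%R.
  by apply: sumr_ge0 => i _; rewrite mulr_ge0 ?sqr_ge0 ?contr_weight_ge0.
have mU := measurable_unit_cube.
have mhq b0 : measurable_fun setT (fun u : Vk R n => h (quant b0 u)).
  exact: (measurableT_comp mh (measurable_quant b0)).
have Lt : (0 <= L / (2 * t))%R by rewrite divr_ge0 // mulr_ge0 // ltW.
have Lt2 : (0 <= L * (t / 2))%R by rewrite mulr_ge0 // divr_ge0 // ltW.
pose g u := h (quant b' u) + (L / (2 * t) * q u)%R%:E.
have mg : measurable_fun setT (g : Vk R n -> \bar R).
  by apply: emeasurable_funD => //; apply/measurable_EFinP; exact: measurable_funM.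
have g0 u : 0 <= g u by rewrite adde_ge0 // lee_fin mulr_ge0.
apply: (@le_trans _ _ (\int[leb R n]_u ((unit_cube u)%:E * (g u + (L * (t / 2))%:E)))).
  apply: ge0_le_integral => //.
  - by move=> u _; rewrite mule_ge0 // lee_fin unit_cube_ge0.
  - by apply: emeasurable_funM => //; exact/measurable_EFinP.
  - apply: emeasurable_funM; first exact/measurable_EFinP.
    by apply: emeasurable_funD => //; exact: measurable_cst.
  move=> u _.
  (* Off the open cube the weight is zero, so the quantile estimates are invoked only for levels in
     $]0,1[$. *)
  have [u01|nu] := pselect (forall i, (0 < u i ord0 < 1)%R); last first.
    suff -> : unit_cube u = 0%R by rewrite !mul0e.
    have [i /negP ui] : exists i, ~ (0 < u i ord0 < 1)%R by exact/existsNP.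
    rewrite /unit_cube (bigD1 i) //= indicE memNset ?mul0r //=.
    by rewrite in_itv /=; exact/negP.
  rewrite lee_wpmul2l ?lee_fin ?unit_cube_ge0 //.
  apply: (le_trans (hL _ (quant b' u) t t0)); rewrite /g -addeA leeD2l // -EFinD lee_fin.
  rewrite mulrDr addrC lerD2r -mulrA ler_wpM2l // [leRHS]mulrC ler_pM2r ?invr_gt0 ?mulr_gt0 //.
  apply: (le_trans (mean_contract _ _)); apply: ler_sum => i _.
  exact: quant_le.
rewrite integral_mul_addc //; [|exact: unit_cube_ge0|exact: integral_unit_cube].
have Uq : \int[leb R n]_u (unit_cube u * q u)%R%:E <= (rho2 * N2 (b - b'))%:E.
  apply: le_trans (_ : (\sum_(i < n) lin i (b - b') ^+ 2 *
    (if contr s i then 3^-1 else 1))%R%:E <= _); last by rewrite lee_fin sum_contr_weight_le.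
  rewrite -sumEFin.
  under eq_integral do rewrite mulr_sumr -sumEFin.
  rewrite ge0_integral_sum //; last 2 first.
  - move=> i; apply/measurable_EFinP; apply: measurable_funM => //; apply: measurable_funM => //.
    exact: (measurableT_comp (measurable_contr_weight _ _) (@measurable_coord R n i)).
  - move=> i u _; rewrite lee_fin; apply: mulr_ge0; first exact: unit_cube_ge0.
    by apply: mulr_ge0; [exact: sqr_ge0|exact: contr_weight_ge0].
  apply: lee_sum => i _; under eq_integral do rewrite mulrCA EFinM.
  rewrite ge0_integralZl ?lee_fin ?sqr_ge0 //; last 2 first.
  - apply/measurable_EFinP; apply: measurable_funM => //.
    exact: (measurableT_comp (measurable_contr_weight _ _) (@measurable_coord R n i)).
  - by move=> u _; rewrite lee_fin mulr_ge0 ?contr_weight_ge0 ?unit_cube_ge0.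
  by rewrite integral_contr_weight -EFinM.
have -> : \int[leb R n]_u ((unit_cube u)%:E * g u) = \int[leb R n]_u ((unit_cube u)%:E * h (quant b' u)) +
    (L / (2 * t))%:E * \int[leb R n]_u (unit_cube u * q u)%R%:E.
  rewrite -ge0_integralZl //; last 2 first.
  - by apply/measurable_EFinP; exact: measurable_funM.
  - by move=> u _; rewrite lee_fin mulr_ge0 ?unit_cube_ge0.
  rewrite -ge0_integralD //.
  - apply: eq_integral => u _.
    rewrite /g ge0_muleDr; [|exact: h0|by rewrite lee_fin; exact: mulr_ge0].
    by rewrite -!EFinM mulrCA.
  - by move=> u _; rewrite mule_ge0 ?lee_fin ?unit_cube_ge0.
  - by apply: emeasurable_funM => //; exact/measurable_EFinP.
  - move=> u _; apply: mule_ge0; rewrite lee_fin; first exact: Lt.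
    by apply: mulr_ge0; [exact: unit_cube_ge0|exact: q0].
  - apply: emeasurable_funM => //; apply/measurable_EFinP; exact: measurable_funM.
rewrite -addeA leeD2l //.
apply: le_trans (leeD2r _ (lee_wpmul2l _ Uq)) _; first by rewrite lee_fin.
rewrite -EFinM -EFinD lee_fin le_eqVlt; apply/orP; left; apply/eqP; ring.
Qed.

(** Taking $t=\rho s$ turns $t/2+\rho^2N/(2t)$ into $\rho(s/2+N/(2s))$. Gluing over orthants comes
    after this rescaling and does not change the constant. *)
Lemma lipV_latent_op L (h : Vk R n -> \bar R) : measurable_fun setT h ->
  (forall z, 0 <= h z) -> (0 <= L)%R -> lipZ L h -> lipV (L * rho)%R (latent_op h).
Proof.
move=> mh h0 L0 hL; apply: lip_glue => c x y s cx cy s0.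
have r0 := rho_gt0.
apply: le_trans (latent_op_orthant mh h0 L0 hL cx cy (mulr_gt0 r0 s0)) _.
rewrite leeD2l // lee_fin -rhoK le_eqVlt; apply/orP; left; apply/eqP.
by field; rewrite !gt_eqF.
Qed.

Lemma gauss_op_le1 (g : Vk R p -> \bar R) z : measurable_fun setT g ->
  (forall b, 0 <= g b <= 1) -> gauss_op g z <= 1.
Proof.
move=> mg /(fine_unit_itv mg)[f mf [f01 gf]].
have /andP[_] := integral_mvn_g (mean z) mf f01.
by apply: le_trans; rewrite le_eqVlt; apply/orP; left; apply/eqP/eq_integral => b _; rewrite gf -EFinM.
Qed.

Lemma latent_op_le1 (h : Vk R n -> \bar R) b : measurable_fun setT h ->
  (forall z, 0 <= h z <= 1) -> latent_op h b <= 1.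
Proof.
move=> mh h01; rewrite -(integral_latent b).
have ml : measurable_fun setT (fun z : Vk R n => latent_pdf Xs Ys b z).
  by apply: measurable_latent => //; exact: measurable_cst.
apply: ge0_le_integral => //.
- by move=> z _; rewrite mule_ge0 ?lee_fin ?latent_ge0 //; have /andP[] := h01 z.
- by apply: emeasurable_funM => //; exact/measurable_EFinP.
- exact/measurable_EFinP.
move=> z _; rewrite -[leRHS]mule1 lee_wpmul2l ?lee_fin ?latent_ge0 //.
by have /andP[] := h01 z.
Qed.

(** * Iterates of the kernel on a fixed event *)

Section event.
Variable A : set 'cV[R]_p.
Hypothesis mA : @borelRk R p A.
Local Notation ker m := (fun b => ac_kernel v Q n Xs Ys m b A).

Lemma kerP m : measurable_fun setT (ker m : Vk R p -> \bar R) /\ (forall b, 0 <= ker m b <= 1).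
Proof.
elim: m => [|m [mg g01]] /=.
  split; last by move=> b; rewrite indicE; case: (_ \in _); rewrite !lee_fin ?lexx ?ler01.
  by apply/measurable_EFinP; apply: (@measurable_indic _ (Vk R p) R setT A); exact: mA.
have g0 b : 0 <= ker m b by have /andP[] := g01 b.
have mH := measurable_gauss_op mg g0.
have H0 z : 0 <= gauss_op (ker m) z by exact: gauss_op_ge0.
have H01 z : 0 <= gauss_op (ker m) z <= 1 by rewrite H0 gauss_op_le1.
have e b : ac_step v Q n Xs Ys b (ker m) = latent_op (gauss_op (ker m)) b by exact: ac_stepE.
rewrite (funext e); split; first exact: measurable_latent_op.
by move=> b; rewrite e latent_op_ge0 ?latent_op_le1.
Qed.

Lemma kerS m b : ker m.+1 b = latent_op (gauss_op (ker m)) b.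
Proof.
have [mg g01] := kerP m; rewrite /= ac_stepE // => b'.
by have /andP[] := g01 b'.
Qed.

(** Iterates are composed backwards from the indicator of [A]: the Gaussian draw next to it gives
    the constant $2$, the later ones preserve constants, and every latent draw multiplies by $\rho$.
    Zero steps leave an indicator, hence the shifted index. *)
Lemma lip_ker m : lipV (2 * rho ^+ m.+1)%R (ker m.+1).
Proof.
have r0 := rho_gt0.
elim: m => [|m IH].
  have [mg g01] := kerP 0.
  have g0 b : 0 <= ker 0 b by have /andP[] := g01 b.
  rewrite (funext (kerS 0)) expr1; apply: lipV_latent_op => //.
  - exact: measurable_gauss_op.
  - by move=> z; exact: gauss_op_ge0.
  - exact: lipZ_gauss_op1.
have [mg g01] := kerP m.+1.
have g0 b : 0 <= ker m.+1 b by have /andP[] := g01 b.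
have L0 : (0 <= 2 * rho ^+ m.+1)%R by rewrite mulr_ge0 // exprn_ge0 // ltW.
rewrite (funext (kerS m.+1)) exprSr mulrA; apply: lipV_latent_op => //.
- exact: measurable_gauss_op.
- by move=> z; exact: gauss_op_ge0.
- exact: lipZ_gauss_op.
Qed.

(** * The posterior: Gaussian tails, mass and invariance *)

Local Notation post := (post_unnorm v Q n Xs Ys).

Lemma post_factor_gt0 (b : 'cV[R]_p) i :
  (0 < (if Ys i then Phi (lin i b) else 1 - Phi (lin i b)))%R.
Proof. by case: (Ys i); rewrite ?Phi_gt0 // subr_gt0 Phi_lt1. Qed.

Lemma post_gt0 b : (0 < post b)%R.
Proof.
rewrite /post_unnorm mulr_gt0 ?expR_gt0 // prodr_gt0 // => i _; exact: post_factor_gt0.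
Qed.

Lemma measurable_post : measurable_fun setT (post : Vk R p -> R).
Proof.
have ml i : measurable_fun setT (fun b : Vk R p => lin i b) by exact: measurable_lin.
rewrite /post_unnorm; apply: measurable_funM.
  apply: measurable_prod => i _; case: (Ys i).
    exact: (measurableT_comp (@measurable_Phi R) (ml i)).
  by apply: measurable_funB => //; exact: (measurableT_comp (@measurable_Phi R) (ml i)).
apply: (measurableT_comp (@measurable_expR R)); apply: measurable_funM => //.
apply: measurableT_comp => //.
by apply: (@measurable_qf R _ _ p Q); apply: measurable_subV => //; exact: measurable_cst.
Qed.

Lemma corthant_ex (b : 'cV[R]_p) : exists s, corthant s b.
Proof.
exists (fun j => 0 <= b j ord0)%R => j /=.
by case: (leP 0%R (b j ord0)) => // /ltW.
Qed.

(** In a closed orthant containing [b], each contracting observation is on its unlikely side and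
    contributes a normal tail at most $\exp(-(X_i^Tb)^2/2)$; the other factors are at most one. The
    hypothesis [contr_ge] then bounds the exponent. *)
Lemma post_le b : (post b <= expR (- (eps * N2 b / 2)))%R.
Proof.
have [s sb] := corthant_ex b.
have Q1 : (expR (- ((b - v)^T *m Q *m (b - v)) ord0 ord0 / 2) <= 1)%R.
  rewrite -[leRHS]expR0 ler_expR mulNr oppr_le0 divr_ge0 //; exact: Q_ge0.
apply: (@le_trans _ _ (\prod_(i < n) (if contr s i then expR (- (lin i b ^+ 2 / 2)) else 1))%R).
  rewrite /post_unnorm -[leRHS]mulr1; apply: ler_pM => //.
    by rewrite prodr_ge0 // => i _; exact/ltW/post_factor_gt0.
  apply: ler_prod => i _; rewrite (ltW (post_factor_gt0 b i)) /=.
  have [ci|_] := boolP (contr s i); last first.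
    case: (Ys i); first exact/ltW/Phi_lt1.
    by rewrite gerBl Phi_ge0.
  have := contr_sign ci sb; case: (Ys i) => h.
    by rewrite -[X in Phi X]opprK -sqrrN Phi_tail_le // oppr_ge0.
  by rewrite -PhiN Phi_tail_le.
rewrite -big_mkcond /= -expR_sum ler_expR sumrN lerN2.
rewrite -mulr_suml ler_pM2r //; exact: contr_ge.
Qed.

(** Up to its constant $K\ge 0$ this is the Gaussian density of precision $(\epsilon/2)\Sigma$. As
    $K$ times the integral equals one, the integral can be neither infinite nor multiplied by
    $K=0$. *)
Lemma Gauss_moment :
  exists2 C : R, (0 <= C)%R & \int[leb R p]_b (expR (- (eps / 2 * N2 b / 2)))%:E = C%:E.
Proof.
have e0 : (0 < eps / 2)%R by rewrite divr_gt0.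
have pS : posdef ((eps / 2) *: S).
  split; first by rewrite linearZ /= S_pd.1.
  move=> u u0; rewrite -scalemxAr -scalemxAl mxE mulr_gt0 //; exact: S_pd.2.
have qS b : qf ((eps / 2) *: S) b b = (eps / 2 * N2 b)%R.
  by rewrite /qf -scalemxAr -scalemxAl mxE.
have := integral_mvn 0 pS; set K := ((Num.sqrt (2 * pi))^-p * Num.sqrt (\det ((eps / 2) *: S)))%R.
under eq_integral do rewrite mvnE -/K subr0 qS mulNr EFinM.
have K0 : (0 <= K)%R by rewrite mulr_ge0 ?invr_ge0 ?exprn_ge0 ?sqrtr_ge0.
rewrite ge0_integralZl ?lee_fin //; last first.
  apply/measurable_EFinP; apply: (measurableT_comp (@measurable_expR R)).
  apply: measurableT_comp => //; apply: measurable_funM => //; apply: measurable_funM => //.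
  exact: measurable_qf.
set I := \int[_]_b _ => KI.
have I0 : 0 <= I by apply: integral_ge0 => b _; rewrite lee_fin expR_ge0.
case: I I0 KI => [c|_|//].
  by move=> c0 _; exists c.
have [->|K1] := eqVneq K 0%R; first by rewrite mul0e => /eqP; rewrite eq_sym onee_eq0.
by rewrite gt0_muley // lte_fin lt0r K1.
Qed.

Definition post_mass : \bar R := \int[leb R p]_b (post b)%:E.

(** The tail bound of the posterior is $e\cdot e$ with $e=\exp(-\epsilon N/4)$: one factor absorbs
    the quadratic growth, the other is integrable by [Gauss_moment]. *)
Lemma post_moment x : exists2 C : R, (0 <= C)%R &
  \int[leb R p]_y ((1 + N2 (x - y)) * post y)%R%:E <= C%:E.
Proof.
have [C C0 CI] := Gauss_moment.
(* From $N(x-b)\le 2N(x)+2N(b)$ and $N(b)e\le 4/\epsilon$. *)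
pose k := (1 + 2 * N2 x + 8 / eps)%R.
have k0 : (0 <= k)%R.
  by rewrite !addr_ge0 ?mulr_ge0 ?N2_ge0 // invr_ge0 ltW.
exists (k * C)%R; first by rewrite mulr_ge0.
have mg : measurable_fun setT (fun b : Vk R p => expR (- (eps / 2 * N2 b / 2)))%R.
  apply: (measurableT_comp (@measurable_expR R)).
  apply: measurableT_comp => //; apply: measurable_funM => //; apply: measurable_funM => //.
  exact: measurable_qf.
rewrite EFinM -CI -ge0_integralZl ?lee_fin //; last exact/measurable_EFinP.
apply: ge0_le_integral => //.
- by move=> b _; rewrite lee_fin mulr_ge0 ?addr_ge0 ?N2_ge0 // ltW // post_gt0.
- apply/measurable_EFinP; apply: measurable_funM; last exact: measurable_post.
  apply: measurable_funD => //.
  by apply: measurable_qf; apply: measurable_subV => //; exact: measurable_cst.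
- by apply/measurable_EFinP; apply: measurable_funM.
move=> b _; rewrite -EFinM lee_fin.
set a := N2 b; have a0 : (0 <= a)%R by exact: N2_ge0.
have h1 : (N2 (x - b) <= 2 * N2 x + 2 * a)%R by have := N2D_le x (- b)%R; rewrite N2N.
set e := expR _; have e0 : (0 < e)%R by exact: expR_gt0.
have h2 : (post b <= e * e)%R.
  apply: le_trans (post_le b) _; rewrite /e -expRD ler_expR -/a le_eqVlt.
  by apply/orP; left; apply/eqP; field.
have h3 : ((1 + eps / 4 * a) * e <= 1)%R.
  have h : (1 + eps / 4 * a <= e^-1)%R.
    rewrite /e -expRN opprK; apply: le_trans (expR_ge1Dx _) _.
    by rewrite ler_expR le_eqVlt; apply/orP; left; apply/eqP; rewrite -/a; field.
  by rewrite -(ler_pM2r e0) mulVf ?gt_eqF // in h.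
have N0 := N2_ge0 x; have p0 := ltW (post_gt0 b).
have e1 : (e <= 1)%R.
  by rewrite -[leRHS]expR0 ler_expR oppr_le0 divr_ge0 // mulr_ge0 // divr_ge0 // ltW.
apply: (@le_trans _ _ ((1 + 2 * N2 x + 2 * a) * (e * e))%R).
  apply: ler_pM => //; first by rewrite addr_ge0 ?N2_ge0.
  by rewrite -addrA lerD2l.
rewrite mulrA ler_pM2r //.
have ae : (a * e <= 4 / eps)%R.
  by rewrite ler_pdivlMr //; nra.
rewrite mulrDl /k; nra.
Qed.

(** If the mass were zero, a strictly positive density would vanish almost everywhere; every
    integral would then be zero, contradicting [integral_mvn]. *)
Lemma post_mass_gt0 : exists2 z : R, (0 < z)%R & post_mass = z%:E.
Proof.
have mp : measurable_fun setT (fun b : Vk R p => (post b)%:E).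
  by apply/measurable_EFinP; exact: measurable_post.
have p0 b : 0 <= (post b)%:E by rewrite lee_fin ltW // post_gt0.
have Z0 : 0 <= post_mass by exact: integral_ge0.
have Zlt : post_mass < +oo.
  have [C _ CI] := post_moment 0%R.
  apply: (@le_lt_trans _ _ C%:E); last exact: ltry.
  apply: le_trans CI; apply: ge0_le_integral => //.
  - apply/measurable_EFinP; apply: measurable_funM; last exact: measurable_post.
    apply: measurable_funD => //.
    by apply: measurable_qf; apply: measurable_subV => //; exact: measurable_cst.
  - by move=> b _; rewrite lee_fin ler_peMl ?(ltW (post_gt0 _)) // lerDl N2_ge0.
exists (fine post_mass); last by rewrite fineK // ge0_fin_numE.
rewrite fine_gt0 // Zlt andbT lt_neqAle Z0 andbT eq_sym; apply/eqP => Z00.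
have ae0 : ae_eq (leb R p) setT (fun b => (post b)%:E) (cst 0).
  apply/(ae_eq_integral_abs (leb R p) measurableT mp); rewrite -[RHS]Z00.
  by apply: eq_integral => b _; rewrite gee0_abs.
have := integral_mvn 0 S_pd; rewrite (ae_eq_integral (cst 0)) //.
- by rewrite integral0 => /eqP; rewrite eq_sym onee_eq0.
- by apply/measurable_EFinP; apply: measurable_mvn => //; exact: measurable_cst.
apply: filterS ae0 => b h Tb; have /eqP := h Tb.
by rewrite eqe gt_eqF // post_gt0.
Qed.

Lemma post_proper_ok : post_proper v Q n Xs Ys.
Proof.
rewrite /post_proper intRkE; first by have [z _ e] := post_mass_gt0; rewrite -/post_mass e ltry.
  by apply/measurable_EFinP; exact: measurable_post.
by move=> b; rewrite lee_fin ltW // post_gt0.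
Qed.

(** The data augmentation identity. The normalizers of the truncated normals cancel the probit
    likelihood, and completing the square in [b] shows that, given [z], the state is Gaussian with
    mean [mean z] and precision [Sigma]. *)
Lemma joint_factor : exists c : 'cV[R]_n -> R,
  [/\ measurable_fun setT (c : Vk R n -> R), (forall z, (0 <= c z)%R) &
   forall b z, (post b * latent_pdf Xs Ys b z = c z * mvn_prec_pdf (mean z) S b)%R].
Proof.
pose sg (z : 'cV[R]_n) : R := (\prod_(i < n) (if Ys i then if (0 : R) < z i ord0 then 1 else 0 else if z i ord0 < 0 then 1 else 0))%R.
pose k : R := normal_peak 1.
(* The part free of [b] when $|z-Xb|^2+(b-v)^TQ(b-v)$ is written as a constant plus
   $N(b-\mathrm{mean}(z))$. *)
pose Cz (z : 'cV[R]_n) := (\sum_(i < n) z i ord0 ^+ 2 + qf Q v v - N2 (mean z))%R.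
pose K := ((Num.sqrt (2 * pi))^-p * Num.sqrt (\det S))%R.
have K0 : (0 < K)%R.
  by have := mvn_gt0 0 0; rewrite mvnE -/K pmulr_lgt0 // expR_gt0.
exists (fun z => sg z * (k ^+ n * expR (- Cz z / 2)) / K)%R; split.
- apply: measurable_funM => //; apply: measurable_funM.
    apply: measurable_prod => i _.
    have mi : measurable_fun setT (fun z : Vk R n => z i ord0) by exact: measurable_coord.
    by case: (Ys i); apply: measurable_fun_ifT => //; exact: measurable_fun_ltr.
  apply: measurable_funM => //; apply: (measurableT_comp (@measurable_expR R)).
  apply: measurable_funM => //; apply: measurableT_comp => //.
  apply: measurable_funB.
    apply: measurable_funD => //; apply: measurable_sum => i.
    by apply: measurable_funX; exact: measurable_coord.
  by apply: measurable_qf; exact: measurable_mean.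
- move=> z; rewrite !mulr_ge0 ?exprn_ge0 ?expR_ge0 ?invr_ge0 ?normal_peak_ge0 ?(ltW K0) //.
  by rewrite prodr_ge0 // => i _; case: (Ys i); case: ifP.
move=> b z.
have E : (latent_pdf Xs Ys b z * \prod_(i < n) (if Ys i then Phi (lin i b) else 1 - Phi (lin i b)) =
    sg z * (k ^+ n * expR (- (\sum_(i < n) (z i ord0 - lin i b) ^+ 2) / 2)))%R.
  have -> : (expR (- (\sum_(i < n) (z i ord0 - lin i b) ^+ 2) / 2) =
      \prod_(i < n) expR (- ((z i ord0 - lin i b) ^+ 2 / 2)))%R.
    by rewrite -expR_sum sumrN -mulr_suml mulNr.
  have -> : (k ^+ n = \prod_(i < n) k)%R by rewrite prodr_const card_ord.
  rewrite -!big_split /=.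
  apply: eq_bigr => i _; have := post_factor_gt0 b i.
  rewrite /tn_pdf -/(lin i b) phiE -/k; case: (Ys i) => P0; case: ifP => _;
    rewrite ?mul0r ?mul1r ?divfK ?gt_eqF //.
have N2e : (\sum_(i < n) (z i ord0 - lin i b) ^+ 2 + qf Q (b - v) (b - v) =
    Cz z + N2 (b - mean z))%R.
  rewrite /Cz !(qfDl, qfDr, qfNl, qfNr) (qfC b (mean z) S_pd.1) !qf_mean (qfC b v Qs) (N2E b).
  have -> : (\sum_(i < n) (z i ord0 - lin i b) ^+ 2 = \sum_(i < n) z i ord0 ^+ 2 -
      2 * (\sum_(i < n) z i ord0 * lin i b) + \sum_(i < n) lin i b ^+ 2)%R.
    rewrite mulr_sumr -sumrB -big_split /=; apply: eq_bigr => i _; ring.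
  by ring.
have -> : post b = ((\prod_(i < n) (if Ys i then Phi (lin i b) else 1 - Phi (lin i b))) *
    expR (- qf Q (b - v) (b - v) / 2))%R by [].
rewrite mulrAC [(_ * latent_pdf _ _ _ _)%R]mulrC E mvnE -/K.
have : (expR (- (\sum_(i < n) (z i ord0 - lin i b) ^+ 2) / 2) * expR (- qf Q (b - v) (b - v) / 2) =
    expR (- Cz z / 2) * expR (- N2 (b - mean z) / 2))%R.
  by rewrite -!expRD -!mulrDl -!opprD N2e.
set e1 := expR _; set e2 := expR _; set e3 := expR _; set e4 := expR _ => ee.
transitivity (sg z * k ^+ n * (e1 * e2))%R; first by ring.
by rewrite ee; field; rewrite gt_eqF.
Qed.


(** By Tonelli on the joint density, both sides equal the integral of [c z] times [gauss_op g z]: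
    the left one after integrating out the old state, the right one because the latent density has
    mass one. *)
Lemma post_invariant (g : Vk R p -> \bar R) : measurable_fun setT g ->
  (forall b, 0 <= g b) ->
  \int[leb R p]_b ((post b)%:E * latent_op (gauss_op g) b) = \int[leb R p]_b ((post b)%:E * g b).
Proof.
move=> mg g0; have [c [mc c0 cE]] := joint_factor.
have mH := measurable_gauss_op mg g0.
have H0 z : 0 <= gauss_op g z by exact: gauss_op_ge0.
have ml b : measurable_fun setT (fun z : Vk R n => latent_pdf Xs Ys b z).
  by apply: measurable_latent => //; exact: measurable_cst.
have mm z : measurable_fun setT (fun b : Vk R p => mvn_prec_pdf (mean z) S b).
  by apply: measurable_mvn => //; exact: measurable_cst.
have p0 b : 0 <= (post b)%:E by rewrite lee_fin ltW // post_gt0.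
have mj : measurable_fun setT (fun w : Vk R p * Vk R n => (post w.1 * latent_pdf Xs Ys w.1 w.2)%R).
  apply: measurable_funM; last exact: measurable_latent.
  exact: (measurableT_comp measurable_post measurable_fst).
have j0 b (z : 'cV[R]_n) : 0 <= (post b * latent_pdf Xs Ys b z)%:E.
  by rewrite lee_fin mulr_ge0 ?latent_ge0 // ltW // post_gt0.
transitivity (\int[leb R n]_z ((c z)%:E * gauss_op g z)); [|symmetry].
  transitivity (\int[leb R p]_b \int[leb R n]_z ((post b * latent_pdf Xs Ys b z)%:E * gauss_op g z)).
    apply: eq_integral => b _; rewrite -ge0_integralZl //.
    - by apply: eq_integral => z _; rewrite EFinM muleA.
    - by apply: emeasurable_funM => //; exact/measurable_EFinP.
    - by move=> z _; rewrite mule_ge0 // lee_fin latent_ge0.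
  rewrite (@fubini_tonelli _ _ _ _ _ (leb R p) (leb R n)
    (fun w => (post w.1 * latent_pdf Xs Ys w.1 w.2)%:E * gauss_op g w.2)) /=; last 2 first.
  - apply: emeasurable_funM; first exact/measurable_EFinP.
    exact: (measurableT_comp mH measurable_snd).
  - by move=> w; rewrite mule_ge0.
  apply: eq_integral => z _; under eq_integral do rewrite cE EFinM muleAC.
  rewrite ge0_integralZl.
  - by rewrite integral_mvn // mule1.
  - exact: measurableT.
  - by apply/measurable_EFinP; exact: mm.
  - by move=> b _; rewrite lee_fin mvn_ge0.
  - by rewrite mule_ge0 // lee_fin.
transitivity (\int[leb R p]_b \int[leb R n]_z ((post b * latent_pdf Xs Ys b z)%:E * g b)).
  apply: eq_integral => b _; under [RHS]eq_integral do rewrite muleC EFinM muleA.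
  rewrite ge0_integralZl //.
  - by rewrite integral_latent mule1 muleC.
  - exact/measurable_EFinP.
  - by move=> z _; rewrite lee_fin latent_ge0.
  - by rewrite mule_ge0.
rewrite (@fubini_tonelli _ _ _ _ _ (leb R p) (leb R n)
  (fun w => (post w.1 * latent_pdf Xs Ys w.1 w.2)%:E * g w.1)) /=; last 2 first.
- apply: emeasurable_funM; first exact/measurable_EFinP.
  exact: (measurableT_comp mg measurable_fst).
- by move=> w; rewrite mule_ge0.
apply: eq_integral => z _; under eq_integral do rewrite cE EFinM -muleA.
rewrite ge0_integralZl //.
- by apply: emeasurable_funM => //; exact/measurable_EFinP.
- by move=> b _; rewrite mule_ge0 // lee_fin mvn_ge0.
- by rewrite lee_fin.
Qed.

Lemma post_ker m : \int[leb R p]_b ((post b)%:E * ker m b) =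
  \int[leb R p]_b (post b * \1_A b)%:E.
Proof.
elim: m => [|m IH]; first by apply: eq_integral => b _; rewrite EFinM.
have [mk k01] := kerP m.
rewrite -IH -(post_invariant mk); last by move=> b; have /andP[] := k01 b.
by apply: eq_integral => b _; rewrite kerS.
Qed.

Lemma posteriorE z : post_mass = z%:E -> (0 < z)%R ->
  (z * posterior v Q n Xs Ys A)%:E = \int[leb R p]_b (post b * \1_A b)%:E.
Proof.
move=> Ze z0; have p0 b : (0 <= post b)%R by exact/ltW/post_gt0.
have mpA : measurable_fun setT (fun b : Vk R p => (post b * \1_A b)%:E).
  apply/measurable_EFinP; apply: measurable_funM; first exact: measurable_post.
  by apply: (@measurable_indic _ (Vk R p) R setT A); exact: mA.
have mp : measurable_fun setT (fun b : Vk R p => (post b)%:E).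
  by apply/measurable_EFinP; exact: measurable_post.
rewrite /posterior !intRkE //; last first.
  by move=> b; rewrite lee_fin mulr_ge0.
rewrite -/post_mass Ze /= mulrC divfK ?gt_eqF // fineK // ge0_fin_numE; last first.
  by apply: integral_ge0 => b _; rewrite lee_fin mulr_ge0.
apply: (@le_lt_trans _ _ post_mass); last by rewrite Ze ltry.
apply: ge0_le_integral => //.
- by move=> b _; rewrite lee_fin mulr_ge0.
- move=> b _; rewrite lee_fin ler_piMr // indicE; by case: (_ \in _).
Qed.

(** By invariance the posterior probability of [A] is the posterior average of the [m]-step kernel.
    Averaging the Lipschitz bound between [x] and [y] over [y], in both directions, costs a second
    moment of the posterior. *)
Lemma ker_posterior z C x m : post_mass = z%:E -> (0 < z)%R -> (0 <= C)%R ->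
  \int[leb R p]_y ((1 + N2 (x - y)) * post y)%R%:E <= C%:E ->
  `|ker m x - (posterior v Q n Xs Ys A)%:E| <= ((1 + C / z) * rho ^+ m)%:E.
Proof.
move=> Ze z0 C0 hC; set PA := posterior _ _ _ _ _ _.
have p0 b : (0 <= post b)%R by exact/ltW/post_gt0.
have C'0 : (0 <= C / z)%R by rewrite divr_ge0 // ltW.
have mpA : measurable_fun setT (fun b : Vk R p => (post b * \1_A b)%:E).
  apply/measurable_EFinP; apply: measurable_funM; first exact: measurable_post.
  by apply: (@measurable_indic _ (Vk R p) R setT A); exact: mA.
have mp : measurable_fun setT (fun b : Vk R p => (post b)%:E).
  by apply/measurable_EFinP; exact: measurable_post.
have [mk k01] := kerP m; have [f mf [f01 fE]] := fine_unit_itv mk k01.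
have PAz : (z * PA)%:E = \int[leb R p]_b (post b * f b)%R%:E.
  by rewrite posteriorE // -(post_ker m); apply: eq_integral => b _; rewrite fE -EFinM.
have fz y : (z * f y)%:E = \int[leb R p]_b (f y * post b)%R%:E.
  have /andP[f0 _] := f01 y.
  rewrite mulrC EFinM -Ze; under eq_integral do rewrite EFinM.
  by rewrite ge0_integralZl // => b _; rewrite lee_fin.
rewrite fE -EFinB abse_EFin lee_fin.
have [Pl Pu] : (0 <= PA)%R /\ (PA <= 1)%R.
  split.
    rewrite -(pmulr_rge0 _ z0) -lee_fin PAz; apply: integral_ge0 => b _.
    by rewrite lee_fin mulr_ge0 //; have /andP[] := f01 b.
  rewrite -(ler_pM2l z0) mulr1 -lee_fin PAz -Ze; apply: ge0_le_integral => //.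
  - by move=> b _; rewrite lee_fin mulr_ge0 //; have /andP[] := f01 b.
  - by apply/measurable_EFinP; apply: measurable_funM => //; exact: measurable_post.
  - by move=> b _; rewrite lee_fin ler_piMr //; have /andP[] := f01 b.
(* For $m=0$ no Lipschitz bound exists; the summand $1$ of the constant covers the difference of two
   numbers in $[0,1]$. *)
case: m mk k01 mf f01 fE PAz fz => [|m] mk k01 mf f01 fE PAz fz.
  rewrite expr0 mulr1; have /andP[fl fu] := f01 x.
  by rewrite ler_norml; apply/andP; split; lra.
have r0 := rho_gt0; set r := (rho ^+ m.+1)%R.
have rr0 : (0 <= r)%R by rewrite exprn_ge0 // ltW.
(* The free parameter is taken to be $s=1$: only decay in $m$ matters here, and the bound stays
   quadratic and integrable. *)
have lip a b : (f a <= f b + r * (1 + N2 (a - b)))%R.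
  have := lip_ker m a b ltr01; rewrite !fE -EFinD lee_fin -/r.
  by congr (_ <= _ + _)%R; field.
pose J y := ((1 + N2 (x - y)) * post y)%R.
have J0 y : (0 <= J y)%R by rewrite mulr_ge0 // addr_ge0 // N2_ge0.
have mJ : measurable_fun setT (J : Vk R p -> R).
  apply: measurable_funM; last exact: measurable_post.
  apply: measurable_funD => //.
  by apply: measurable_qf; apply: measurable_subV => //; exact: measurable_cst.
have key (f1 f2 : Vk R p -> R) (a1 a2 : R) : measurable_fun setT f1 -> measurable_fun setT f2 ->
    (forall b, 0 <= f1 b)%R -> (forall b, 0 <= f2 b)%R ->
    (forall b, f1 b <= f2 b + r * (1 + N2 (x - b)))%R ->
    (z * a1)%:E = \int[leb R p]_b (f1 b * post b)%R%:E ->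
    (z * a2)%:E = \int[leb R p]_b (f2 b * post b)%R%:E -> (a1 <= a2 + C / z * r)%R.
  move=> m1 m2 f10 f20 f12 e1 e2.
  suff : (z * a1)%:E <= (z * a2)%:E + (r * C)%:E.
    rewrite -EFinD lee_fin => h; rewrite -(ler_pM2l z0); apply: (le_trans h).
    by rewrite le_eqVlt; apply/orP; left; apply/eqP; field; rewrite gt_eqF.
  rewrite e1 e2.
  apply: (@le_trans _ _ (\int[leb R p]_b (f2 b * post b)%R%:E + r%:E * \int[leb R p]_b (J b)%:E)).
    rewrite -ge0_integralZl //; last 2 first.
    - exact/measurable_EFinP.
    - by move=> b _; rewrite lee_fin.
    have mp' := measurable_post.
    rewrite -ge0_integralD //; last 4 first.
    - by move=> b _; rewrite lee_fin mulr_ge0.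
    - by apply/measurable_EFinP; exact: measurable_funM.
    - by move=> b _; rewrite -EFinM lee_fin mulr_ge0.
    - by apply: emeasurable_funM; [exact: measurable_cst|exact/measurable_EFinP].
    apply: ge0_le_integral => //.
    - by move=> b _; rewrite lee_fin mulr_ge0.
    - by apply/measurable_EFinP; exact: measurable_funM.
    - apply: emeasurable_funD; first by apply/measurable_EFinP; exact: measurable_funM.
      by apply: emeasurable_funM; [exact: measurable_cst|exact/measurable_EFinP].
    move=> b _; rewrite -EFinM -EFinD lee_fin.
    by have := ler_wpM2r (p0 b) (f12 b); rewrite mulrDl -mulrA.
  by rewrite leeD2l // EFinM lee_wpmul2l // lee_fin.
have f0 b : (0 <= f b)%R by have /andP[] := f01 b.
have PAz' : (z * PA)%:E = \int[leb R p]_b (f b * post b)%R%:E.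
  by rewrite PAz; apply: eq_integral => b _; rewrite mulrC.
have N2C a b : (N2 (a - b) = N2 (b - a))%R by rewrite -N2N opprB.
have h1 := key (cst (f x)) f (f x) PA (measurable_cst _) mf (fun=> f0 x) f0 (lip x) (fz x) PAz'.
have h2 : (PA <= f x + C / z * r)%R.
  apply: (key f (cst (f x)) PA (f x) mf (measurable_cst _) f0 (fun=> f0 x) _ PAz' (fz x)).
  by move=> b; rewrite N2C; exact: lip.
by rewrite mulrDl mul1r ler_norml; apply/andP; split; lra.
Qed.

End event.

(** The posterior is proper, so [ac_rate] is the genuine infimum. The constant of [ker_posterior]
    depends on [x] but not on the event, hence survives the supremum over events. *)
Lemma ac_rate_le : (ac_rate v Q n Xs Ys <= rho)%R.
Proof.
rewrite /ac_rate asboolT; last exact: post_proper_ok.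
have [z z0 Ze] := post_mass_gt0.
have r0 := rho_gt0.
apply: ge_inf; first by exists 0%R => t [/andP[]].
split; first by rewrite !ltW // rho_lt1.
pose C x := sval (cid2 (post_moment x)).
have CP x : (0 <= C x)%R /\ \int[leb R p]_y ((1 + N2 (x - y)) * post_unnorm v Q n Xs Ys y)%R%:E <= (C x)%:E.
  by rewrite /C; case: cid2.
exists (fun x => 1 + C x / z)%R; split.
  by move=> x; rewrite addr_ge0 // divr_ge0 ?(CP x).1 // ltW.
move=> x m; apply: ge_ereal_sup => _ [A mA <-].
exact: (ker_posterior mA m Ze z0 (CP x).1 (CP x).2).
Qed.

End chain.

(** * A strong law of large numbers along powers of two *)

Section slln.
Local Open Scope ereal_scope.

(** A sum of powers of two is at most twice its largest term. Taken in expectation, this bounds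
    $\sum_k 2^kP(f>2^k)$ by $2Ef$, the cost of truncation. *)
Lemma sum_pow2_lt (R : realFieldType) (x : R) n : (0 <= x ->
  \sum_(k < n) (if 2 ^+ k < x then 2 ^+ k else 0) <= 2 * x)%R.
Proof.
move=> x0; have lt2 m : (\sum_(k < m) (if 2 ^+ k < x then 2 ^+ k else 0) <= 2 ^+ m :> R)%R.
  elim: m => [|m IH]; first by rewrite big_ord0.
  rewrite big_ord_recr exprS mulr_natl mulr2n lerD //=.
  by case: ifP => // _; rewrite exprn_ge0.
elim: n => [|n IH]; first by rewrite big_ord0 mulr_ge0.
rewrite big_ord_recr /=; case: ifP => h; last by rewrite addr0.
by have := lt2 n; lra.
Qed.

(** A geometric series started at the first power above [x]. In expectation it bounds the sum over
    $k$ of the truncated second moments divided by $2^k$, with only a first moment available. *)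
Lemma sum_sqr_div_pow2_le (R : realFieldType) (x : R) n : (0 <= x ->
  \sum_(k < n) (if x <= 2 ^+ k then x ^+ 2 / 2 ^+ k else 0) <= 2 * x)%R.
Proof.
move=> x0.
have p2 k : (0 < 2 ^+ k :> R)%R by rewrite exprn_gt0.
(* The induction carries the whole remaining tail $2x^2/2^n$ of the series. *)
suff : (if x <= 2 ^+ n then \sum_(k < n) (if x <= 2 ^+ k then x ^+ 2 / 2 ^+ k else 0) +
    2 * (x ^+ 2 / 2 ^+ n) <= 2 * x else
    \sum_(k < n) (if x <= 2 ^+ k then x ^+ 2 / 2 ^+ k else 0) == 0)%R.
  case: ifP => [_|_ /eqP ->]; last by rewrite mulr_ge0.
  have : (0 <= 2 * (x ^+ 2 / 2 ^+ n))%R by rewrite mulr_ge0 // divr_ge0 ?sqr_ge0 // ltW.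
  lra.
elim: n => [|n IH].
  rewrite big_ord0 expr0; case: ifP => // x1; rewrite add0r divr1; nra.
rewrite !big_ord_recr /=; move: IH; case: (leP x (2 ^+ n)%R) => h1.
  have -> : (x <= 2 ^+ n.+1)%R by rewrite exprS; have := p2 n; lra.
  have -> : (x ^+ 2 / 2 ^+ n.+1 = x ^+ 2 / 2 ^+ n / 2)%R.
    by rewrite [(2 ^+ n.+1)%R]exprSr invfM mulrA.
  by lra.
move=> /eqP ->; rewrite addr0; case: ifP => // h2.
rewrite add0r ler_pM2l // ler_pdivrMr // expr2 ler_wpM2l //.
Qed.

Lemma Borel_Cantelli_bound d (Omega : measurableType d) (R : realType)
  (P : probability Omega R) (F : nat -> set Omega) (c : R) :
  (forall k, measurable (F k)) -> (forall n, \sum_(k < n) P (F k) <= c%:E) ->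
  {ae P, forall w, exists K, forall k, (K <= k)%N -> ~ F k w}.
Proof.
move=> mF Fc; have : P (lim_sup_set F) = 0.
  apply: lim_sup_set_cvg0 => //; apply: (@le_lt_trans _ _ c%:E); last exact: ltry.
  apply: lime_le; first by apply: is_cvg_nneseries.
  by apply: nearW => n; rewrite big_mkord.
have mL : measurable (lim_sup_set F).
  apply: bigcapT_measurable => n; apply: bigcup_measurable => k _; exact: mF.
move/(proj2 (negligibleP P mL)); apply: negligibleS => w /= h.
move=> n _; apply: contrapT => nF; apply: h; exists n => k nk Fk; apply: nF.
by exists k.
Qed.

(** * Sums of pairwise independent, identically distributed variables *)

Section iid.
Context d (Omega : measurableType d) (R : realType) (P : probability Omega R)
  dT (T : measurableType dT) (W : nat -> Omega -> T).
Hypothesis mW : forall i, measurable_fun setT (W i).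
Hypothesis W_indep : forall i j A B, i != j -> measurable A -> measurable B ->
  P (W i @^-1` A `&` W j @^-1` B) = P (W i @^-1` A) * P (W j @^-1` B).
Hypothesis W_ident : forall i A, measurable A -> P (W i @^-1` A) = P (W 0%N @^-1` A).

Let law : {measure set T -> \bar R} :=
  measure_function_pushforward__canonical__measure_function_Measure P (mW 0).

Let law_sf : sigma_finite setT law.
Proof.
exists (fun=> setT); first by rewrite bigcup_const //; exists 0%N.
by move=> i; split => //; rewrite /law /= /pushforward preimage_setT probability_setT ltry.
Qed.

Let integral_law i (f : T -> \bar R) : measurable_fun setT f -> (forall t, 0 <= f t) ->
  \int[P]_w f (W i w) = \int[law]_t f t.
Proof.
move=> mf f0.
rewrite -(@eq_measure_integral _ _ _ _ law
  (measure_function_pushforward__canonical__measure_function_Measure P (mW i))); last first.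
  by move=> A mA _; rewrite /= /pushforward W_ident.
by rewrite [RHS](@ge0_integral_pushforward _ _ _ _ _ _ (mW i) P) // preimage_setT.
Qed.

Lemma iid_integral i (f : T -> \bar R) : measurable_fun setT f -> (forall t, 0 <= f t) ->
  \int[P]_w f (W i w) = \int[P]_w f (W 0%N w).
Proof. by move=> mf f0; rewrite !integral_law. Qed.

(** Pairwise independence identifies the joint law of the pair with the product of the common law,
    by uniqueness on rectangles; Tonelli then separates the factors. *)
Lemma iid_integralM i j (f g : T -> \bar R) : i != j ->
  measurable_fun setT f -> measurable_fun setT g ->
  (forall t, 0 <= f t) -> (forall t, 0 <= g t) ->
  \int[P]_w (f (W i w) * g (W j w)) = \int[P]_w f (W 0%N w) * \int[P]_w g (W 0%N w).
Proof.
move=> ij mf mg f0 g0; rewrite !integral_law //.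
have [nu nuE] := sigma_finite_pack law_sf.
have mWW : measurable_fun setT (fun w => (W i w, W j w)) by exact: measurable_fun_pair.
pose joint : {measure set (T * T) -> \bar R} :=
  measure_function_pushforward__canonical__measure_function_Measure P mWW.
have mfg : measurable_fun setT (fun t : T * T => f t.1 * g t.2).
  apply: emeasurable_funM.
    exact: (measurableT_comp mf measurable_fst).
  exact: (measurableT_comp mg measurable_snd).
have fg0 (t : T * T) : 0 <= f t.1 * g t.2 by exact: mule_ge0.
transitivity (\int[joint]_t (f t.1 * g t.2)).
  by rewrite [RHS](@ge0_integral_pushforward _ _ _ _ _ _ mWW P) // preimage_setT.
rewrite -nuE.
rewrite (@eq_measure_integral _ _ _ _ (nu \x nu)%E); last first.
  move=> A mA _; symmetry; apply: product_measure_unique => // B C mB mC.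
  by rewrite /joint /= /pushforward nuE /law /= /pushforward -(W_ident i) // -(W_ident j) // -W_indep.
rewrite fubini_tonelli1 // /fubini_F /=.
under eq_integral do rewrite ge0_integralZl //.
by rewrite ge0_integralZr // integral_ge0.
Qed.

Section moments.
Variables (f : T -> R) (m v : R).
Hypothesis mf : measurable_fun setT f.
Hypothesis f0 : forall t, (0 <= f t)%R.
Hypothesis fm : \int[P]_w (f (W 0%N w))%:E = m%:E.
Hypothesis fv : \int[P]_w (f (W 0%N w) ^+ 2)%:E <= v%:E.
Local Notation Sf N w := (\sum_(i < N) f (W i w))%R.

Let mfW i : measurable_fun setT (fun w => f (W i w)).
Proof. exact: (measurableT_comp mf (mW i)). Qed.

Lemma measurable_iid_sum N : measurable_fun setT (fun w => Sf N w).
Proof. by apply: measurable_sum => i; exact: mfW. Qed.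

Let m0 : (0 <= m)%R.
Proof. by rewrite -lee_fin -fm; apply: integral_ge0 => w _; rewrite lee_fin. Qed.

Let v0 : (0 <= v)%R.
Proof.
by rewrite -lee_fin (le_trans _ fv) //; apply: integral_ge0 => w _; rewrite lee_fin sqr_ge0.
Qed.

Lemma iid_sum_mean N : \int[P]_w (Sf N w)%:E = (N%:R * m)%:E.
Proof.
under eq_integral do rewrite -sumEFin.
rewrite ge0_integral_sum //; last 2 first.
- by move=> i; apply/measurable_EFinP; exact: mfW.
- by move=> i w _; rewrite lee_fin.
rewrite (eq_bigr (fun=> m%:E)); first by rewrite sumEFin sumr_const card_ord mulr_natl.
move=> i _; rewrite (@iid_integral i (EFin \o f)) //; exact/measurable_EFinP.
Qed.

Lemma iid_sum_sqr N :
  \int[P]_w (Sf N w ^+ 2)%:E <= (N%:R * v + (N%:R * m) ^+ 2)%:E.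
Proof.
have mff i j : measurable_fun setT (fun w => (f (W i w) * f (W j w))%:E).
  by apply/measurable_EFinP; exact: measurable_funM.
have ff0 i j w : 0 <= (f (W i w) * f (W j w))%:E by rewrite lee_fin mulr_ge0.
have e w : (Sf N w ^+ 2)%:E = \sum_(i < N) \sum_(j < N) (f (W i w) * f (W j w))%:E.
  rewrite expr2 mulr_suml -sumEFin; apply: eq_bigr => i _.
  by rewrite mulr_sumr -sumEFin.
under eq_integral do rewrite e.
rewrite ge0_integral_sum //; last 2 first.
- by move=> i; apply: emeasurable_sum.
- by move=> i w _; apply: sume_ge0.
apply: (@le_trans _ _ (\sum_(i < N) (v + N%:R * m ^+ 2)%:E)); last first.
  rewrite sumEFin sumr_const card_ord lee_fin -mulr_natl le_eqVlt.
  by apply/orP; left; apply/eqP; ring.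
apply: lee_sum => i _; rewrite ge0_integral_sum //.
rewrite (bigD1 i) //= EFinD; apply: leeD.
  rewrite (eq_integral (fun w => (f (W i w) ^+ 2)%:E)) //.
  rewrite (@iid_integral i (fun t => (f t ^+ 2)%:E)) //.
    by apply/measurable_EFinP; exact: measurable_funX.
  by move=> t; rewrite lee_fin sqr_ge0.
apply: (@le_trans _ _ (\sum_(j < N) (m ^+ 2)%:E)); last first.
  by rewrite sumEFin sumr_const card_ord mulr_natl.
apply: (@le_trans _ _ (\sum_(j < N | j != i) (m ^+ 2)%:E)); last first.
  rewrite [leLHS]big_mkcond; apply: lee_sum => j _.
  by case: ifP => // _; rewrite lee_fin sqr_ge0.
apply: lee_sum => j ji.
rewrite (eq_integral (fun w => (f (W i w))%:E * (f (W j w))%:E)) //.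
rewrite (@iid_integralM i j (EFin \o f) (EFin \o f)) //.
- by rewrite fm -EFinM expr2.
- by rewrite eq_sym.
- exact/measurable_EFinP.
- exact/measurable_EFinP.
Qed.

Lemma iid_chebyshev N a : (0 < a)%R ->
  P [set w | a <= `|Sf N w - N%:R * m|]%R <= (N%:R * v / a ^+ 2)%:E.
Proof.
move=> a0; set M := (N%:R * m)%R.
have M0 : (0 <= M)%R by rewrite mulr_ge0.
have mS := measurable_iid_sum N.
have S0 w : (0 <= Sf N w)%R by exact: sumr_ge0.
have mD : measurable_fun setT (fun w => Sf N w - M)%R by exact: measurable_funB.
have varS : \int[P]_w ((Sf N w - M) ^+ 2)%:E <= (N%:R * v)%:E.
  (* The variance is reached through $(S-M)^2+2MS=S^2+M^2$, whose terms are all nonnegative, so no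
     integral is subtracted. *)
  have : \int[P]_w ((Sf N w - M) ^+ 2)%:E + (2 * M * M)%:E <= (N%:R * v)%:E + (2 * M * M)%:E.
    rewrite [in X in X <= _]EFinM -[X in _ * X]iid_sum_mean -ge0_integralZl //; last 3 first.
    - exact/measurable_EFinP.
    - by move=> w _; rewrite lee_fin.
    - by rewrite lee_fin mulr_ge0.
    rewrite -ge0_integralD //; last 4 first.
    - by move=> w _; rewrite lee_fin sqr_ge0.
    - by apply/measurable_EFinP; exact: measurable_funX.
    - by move=> w _; rewrite mule_ge0 ?lee_fin ?mulr_ge0.
    - by apply: emeasurable_funM => //; exact/measurable_EFinP.
    rewrite (eq_integral (fun w => (Sf N w ^+ 2)%:E + (M ^+ 2)%:E)); last first.
      move=> w _; rewrite -EFinM -!EFinD; congr (_%:E); ring.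
    rewrite ge0_integralD //; last 3 first.
    - by move=> w _; rewrite lee_fin sqr_ge0.
    - by apply/measurable_EFinP; exact: measurable_funX.
    - by move=> w _; rewrite lee_fin sqr_ge0.
    have -> : \int[P]_(w in setT) (M ^+ 2)%:E = (M ^+ 2)%:E.
      rewrite integral_cst; [|exact: measurableT].
      by rewrite [X in _ * X](@probability_setT _ _ _ P) mule1.
    apply: le_trans (leeD2r _ (iid_sum_sqr N)) _.
    by rewrite -!EFinD lee_fin -/M le_eqVlt; apply/orP; left; apply/eqP; ring.
  by rewrite leeD2rE.
have mE : measurable [set w | a <= `|Sf N w - M|]%R.
  rewrite -[X in measurable X]setTI.
  by apply: measurable_fun_le => //; exact: measurableT_comp.
have a20 : (0 < a ^+ 2)%R by rewrite exprn_gt0.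
rewrite -(@lee_pmul2l _ (a ^+ 2)%:E) ?lte_fin // -EFinM mulrC divfK ?gt_eqF //.
apply: le_trans varS; rewrite -[X in P X]setIT -integral_indic // -ge0_integralZl //.
- apply: ge0_le_integral => //.
  + by move=> w _; rewrite -EFinM lee_fin mulr_ge0 // ltW.
  + by apply: emeasurable_funM => //; apply/measurable_EFinP; exact: measurable_indic.
  + by apply/measurable_EFinP; exact: measurable_funX.
  move=> w _; rewrite -EFinM lee_fin indicE; case: (boolP (_ \in _)) => [|_].
    rewrite inE /= mulr1 => h; rewrite -[leRHS]real_normK ?num_real //.
    by rewrite lerXn2r ?nnegrE // ltW.
  by rewrite mulr0 sqr_ge0.
- by apply/measurable_EFinP; exact: measurable_indic.
- by rewrite lee_fin ltW.
Qed.
End moments.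

(** Only a first moment is assumed, so at scale $2^k$ the variables are truncated at $2^k$.
    Chebyshev handles the truncated sum, a union bound the event that truncation changes something,
    and both probabilities are summable in $k$. *)
Lemma iid_slln_dyadic_ge0 (f : T -> R) (m eta : R) : measurable_fun setT f ->
  (forall t, 0 <= f t)%R -> \int[P]_w (f (W 0%N w))%:E = m%:E -> (0 < eta)%R ->
  {ae P, forall w, exists K, forall k, (K <= k)%N ->
    (`|\sum_(i < 2 ^ k) f (W i w) - 2 ^+ k * m| <= eta * 2 ^+ k)%R}.
Proof.
move=> mf f0 fm eta0.
have p2 k : (0 < 2 ^+ k :> R)%R by rewrite exprn_gt0.
have mfW i : measurable_fun setT (fun w => f (W i w)) by exact: (measurableT_comp mf (mW i)).
have m0 : (0 <= m)%R.
  by rewrite -lee_fin -fm; apply: integral_ge0 => w _; rewrite lee_fin.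
pose g k t := if (f t <= 2 ^+ k)%R then f t else 0%R.
have mg k : measurable_fun setT (g k).
  by apply: measurable_fun_ifT => //; apply: measurable_fun_ler.
have g0 k t : (0 <= g k t)%R by rewrite /g; case: ifP.
have gf k t : (g k t <= f t)%R by rewrite /g; case: ifP.
have mgW k i : measurable_fun setT (fun w => g k (W i w)) by exact: (measurableT_comp (mg k) (mW i)).
have gmk k : exists mk, \int[P]_w (g k (W 0%N w))%:E = mk%:E.
  exists (fine (\int[P]_w (g k (W 0%N w))%:E)); rewrite fineK // ge0_fin_numE; last first.
    by apply: integral_ge0 => w _; rewrite lee_fin.
  apply: (@le_lt_trans _ _ m%:E); last exact: ltry.
  rewrite -fm; apply: ge0_le_integral => //.
  - by move=> w _; rewrite lee_fin.
  - exact/measurable_EFinP.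
  - exact/measurable_EFinP.
  - by move=> w _; rewrite lee_fin.
have [mu_ muE] := choice gmk.
have gvk k : exists vk, \int[P]_w (g k (W 0%N w) ^+ 2)%:E = vk%:E.
  exists (fine (\int[P]_w (g k (W 0%N w) ^+ 2)%:E)); rewrite fineK // ge0_fin_numE; last first.
    by apply: integral_ge0 => w _; rewrite lee_fin sqr_ge0.
  apply: (@le_lt_trans _ _ (2 ^+ k * m)%:E); last exact: ltry.
  rewrite EFinM -fm -ge0_integralZl //; last 2 first.
  - exact/measurable_EFinP.
  - by move=> w _; rewrite lee_fin.
  apply: ge0_le_integral => //.
  - by move=> w _; rewrite lee_fin sqr_ge0.
  - by apply/measurable_EFinP; exact: measurable_funX.
  - by apply: emeasurable_funM => //; exact/measurable_EFinP.
  move=> w _; rewrite -EFinM lee_fin /g; case: ifP => h.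
    by rewrite expr2 ler_wpM2r.
  by rewrite expr0n /= mulr_ge0 // ltW.
have [v_ vE] := choice gvk.
have natp k : ((2 ^ k)%N%:R = 2 ^+ k :> R)%R by rewrite natrX.
(* Half of [eta] is spent on fluctuation; the other half pays for the bias [m - mu_ k] of the
   truncated mean. *)
pose B k := [set w | eta / 2 * 2 ^+ k <= `|\sum_(i < 2 ^ k) g k (W i w) - (2 ^ k)%N%:R * mu_ k|]%R.
have mB k : measurable (B k).
  rewrite -[X in measurable X]setTI; apply: measurable_fun_le => //.
  apply: measurableT_comp => //; apply: measurable_funB => //; exact: measurable_sum.
pose A k := \bigcup_(i < 2 ^ k) (W i @^-1` [set t | 2 ^+ k < f t])%R.
have mS k : measurable [set t | 2 ^+ k < f t]%R.
  have := mf measurableT _ (measurable_itv (Interval (BRight (2 ^+ k : R)%R) +oo%O)); rewrite setTI.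
  by congr measurable; apply/seteqP; split => t /=; rewrite in_itv /= andbT.
have mWS i k : measurable (W i @^-1` [set t | 2 ^+ k < f t]%R).
  by rewrite -[X in measurable X]setTI; exact: mW.
have mA k : measurable (A k) by apply: bigcup_measurable.
have PB n : \sum_(k < n) P (B k) <= ((eta / 2) ^- 2 * (2 * m))%:E.
  pose q k w := (if f (W 0%N w) <= 2 ^+ k then f (W 0%N w) ^+ 2 / 2 ^+ k else 0)%R.
  have q0 k w : (0 <= q k w)%R.
    by rewrite /q; case: ifP => // _; rewrite divr_ge0 ?sqr_ge0 // ltW.
  have mq k : measurable_fun setT (q k).
    apply: measurable_fun_ifT => //; first exact: measurable_fun_ler.
    by apply: measurable_funM => //; exact: measurable_funX.
  have qE k : (v_ k / 2 ^+ k)%:E = \int[P]_w (q k w)%:E.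
    rewrite mulrC EFinM -vE -ge0_integralZl //.
    - apply: eq_integral => w _; rewrite -EFinM mulrC /q /g; congr (_%:E).
      by case: ifP => // _; rewrite expr0n mul0r.
    - by apply/measurable_EFinP; exact: measurable_funX.
    - by move=> w _; rewrite lee_fin sqr_ge0.
  have sv : (\sum_(k < n) v_ k / 2 ^+ k <= 2 * m)%R.
    rewrite -lee_fin -sumEFin; under eq_bigr do rewrite qE.
    rewrite -ge0_integral_sum //; last 2 first.
    - by move=> k; exact/measurable_EFinP.
    - by move=> k w _; rewrite lee_fin.
    rewrite EFinM -fm -ge0_integralZl //; last 2 first.
    - exact/measurable_EFinP.
    - by move=> w _; rewrite lee_fin.
    apply: ge0_le_integral => //.
    - by move=> w _; apply: sume_ge0 => k _; rewrite lee_fin.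
    - by apply: emeasurable_sum => k; exact/measurable_EFinP.
    - by apply: emeasurable_funM => //; exact/measurable_EFinP.
    move=> w _; rewrite sumEFin -EFinM lee_fin; exact: sum_sqr_div_pow2_le.
  apply: (@le_trans _ _ (\sum_(k < n) ((eta / 2) ^- 2 * (v_ k / 2 ^+ k))%:E)); last first.
    by rewrite sumEFin -mulr_sumr lee_fin ler_wpM2l // invr_ge0 sqr_ge0.
  apply: lee_sum => k _.
  have a0 : (0 < eta / 2 * 2 ^+ k)%R by rewrite mulr_gt0 // divr_gt0.
  apply: le_trans (iid_chebyshev (mg k) (g0 k) (muE k) _ (2 ^ k) a0) _.
    by rewrite vE.
  rewrite lee_fin natp le_eqVlt; apply/orP; left; apply/eqP; field.
  by rewrite !gt_eqF.
have PA n : \sum_(k < n) P (A k) <= (2 * m)%:E.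
  pose q k w : R := (if 2 ^+ k < f (W 0%N w) then 2 ^+ k else 0)%R.
  have q0 k w : (0 <= q k w)%R by rewrite /q; case: ifP => // _; rewrite ltW.
  have mq k : measurable_fun setT (q k).
    by apply: measurable_fun_ifT => //; exact: measurable_fun_ltr.
  have PAk k : P (A k) <= \int[P]_w (q k w)%:E.
    rewrite /A bigcup_mkord;
    apply: (le_trans (@Boole_inequality _ _ _ P (fun i => W i @^-1` [set t | 2 ^+ k < f t]%R) (2 ^ k) _)) => //.
    rewrite (eq_bigr (fun=> P (W 0%N @^-1` [set t | 2 ^+ k < f t]%R))); last by move=> i _; exact: W_ident.
    have -> : \int[P]_w (q k w)%:E = (2 ^+ k)%:E * P (W 0%N @^-1` [set t | 2 ^+ k < f t]%R).
      rewrite -[X in P X]setIT -integral_indic // -ge0_integralZl //.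
      - apply: eq_integral => w _; rewrite -EFinM indicE /q; congr (_%:E).
        case: ifP => h; first by rewrite mem_set ?mulr1.
        by rewrite memNset ?mulr0 //= h.
      by apply/measurable_EFinP; exact: measurable_indic.
    have /fineK <- : P (W 0%N @^-1` [set t | 2 ^+ k < f t]%R) \is a fin_num.
      exact: fin_num_measure.
    by rewrite sumEFin sumr_const card_ord -EFinM -natp mulr_natl.
  apply: (@le_trans _ _ (\sum_(k < n) \int[P]_w (q k w)%:E)).
    by apply: lee_sum => k _; exact: PAk.
  rewrite -ge0_integral_sum //; last 2 first.
  - by move=> k; exact/measurable_EFinP.
  - by move=> k w _; rewrite lee_fin.
  rewrite EFinM -fm -ge0_integralZl //; last 2 first.
  - exact/measurable_EFinP.
  - by move=> w _; rewrite lee_fin.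
  apply: ge0_le_integral => //.
  - by move=> w _; apply: sume_ge0 => k _; rewrite lee_fin.
  - by apply: emeasurable_sum => k; exact/measurable_EFinP.
  - by apply: emeasurable_funM => //; exact/measurable_EFinP.
  move=> w _; rewrite sumEFin -EFinM lee_fin; exact: sum_pow2_lt.
(* Monotone convergence: each value is left unchanged by truncation once $2^k$ exceeds it. *)
have muc : (mu_ k @[k --> \oo] --> m)%classic.
  have h : (\int[P]_w (g k (W 0%N w))%:E @[k --> \oo] --> \int[P]_w (f (W 0%N w))%:E)%classic.
    rewrite (eq_integral (fun w => limn (fun k => (g k (W 0%N w))%:E))).
      apply: cvg_monotone_convergence => //.
      - by move=> k; exact/measurable_EFinP.
      - by move=> k w _; rewrite lee_fin.
      move=> w _ i j ij; rewrite lee_fin /g; case: ifP => h1; last by case: ifP.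
      rewrite ifT // (le_trans h1) // ler_weXn2l // ler1n //.
    move=> w _; apply/esym/cvg_lim => //.
    have [k0 k0P] : exists k0, forall k, (k0 <= k)%N -> (f (W 0%N w) <= 2 ^+ k)%R.
      exists (Num.truncn (f (W 0%N w))).+1 => k k0k.
      have h1 := ltW (truncnS_gt (f (W 0%N w))).
      apply: (le_trans h1); rewrite -natp ler_nat.
      by apply: (leq_trans k0k); exact/ltnW/ltn_expl.
    apply: cvg_near_cst; exists k0 => //= k /k0P.
    by rewrite /g => ->.
  by move: h; rewrite fm (funext muE) => h; exact: (fine_cvg h).
have [K0 K0P] : exists K, forall k, (K <= k)%N -> (`|m - mu_ k| <= eta / 2)%R.
  have e2 : (0 < eta / 2)%R by rewrite divr_gt0.
  have /cvgrPdist_le/(_ _ e2)[K _ KP] := muc.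
  by exists K => k; exact: KP.
have BC1 := Borel_Cantelli_bound mB PB.
have BC2 := Borel_Cantelli_bound mA PA.
apply: filterS2 BC1 BC2 => w [K1 K1P] [K2 K2P].
exists (maxn K0 (maxn K1 K2)) => k; rewrite !geq_max => /and3P[k0 k1 k2].
have := K0P k k0; have /negP := K1P k k1; rewrite -ltNge => b2 b1.
have -> : (\sum_(i < 2 ^ k) f (W i w) = \sum_(i < 2 ^ k) g k (W i w))%R.
  apply: eq_bigr => i _; rewrite /g; case: leP => // h; exfalso.
  by apply: (K2P k k2); exists i => //=.
move: b2; set S := (\sum_(i < _) _)%R; rewrite natp => b2.
have -> : (S - 2 ^+ k * m = (S - 2 ^+ k * mu_ k) - 2 ^+ k * (m - mu_ k))%R by ring.
apply: (le_trans (ler_normB _ _)); rewrite [X in (_ + X)%R]normrM gtr0_norm //.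
have := ler_wpM2l (ltW (p2 k)) b1; lra.
Qed.


Lemma iid_slln_dyadic (f : T -> R) (eta : R) : measurable_fun setT f ->
  P.-integrable setT (fun w => (f (W 0%N w))%:E) -> (0 < eta)%R ->
  {ae P, forall w, exists K, forall k, (K <= k)%N ->
    (`|\sum_(i < 2 ^ k) f (W i w) - 2 ^+ k * fine (\int[P]_w (f (W 0%N w))%:E)| <=
     eta * 2 ^+ k)%R}.
Proof.
move=> mf fi eta0.
pose fp t := Num.max (f t) 0%R; pose fn t := Num.max (- f t)%R 0%R.
have fpE : (fun w => (f (W 0%N w))%:E)^\+ = (fun w => (fp (W 0%N w))%:E).
  by apply/funext => w; rewrite funeposE -EFin_max.
have fnE : (fun w => (f (W 0%N w))%:E)^\- = (fun w => (fn (W 0%N w))%:E).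
  by apply/funext => w; rewrite funenegE -EFinN -EFin_max.
have ip := integrable_fin_num measurableT (integrable_funepos measurableT fi).
have iN := integrable_fin_num measurableT (integrable_funeneg measurableT fi).
have p0 t : (0 <= fp t)%R by rewrite le_max lexx orbT.
have n0 t : (0 <= fn t)%R by rewrite le_max lexx orbT.
have mp : measurable_fun setT fp by exact: measurable_maxr.
have mn : measurable_fun setT fn by apply: measurable_maxr => //; exact: measurableT_comp.
rewrite fpE in ip; rewrite fnE in iN.
have fE : (fine (\int[P]_w (f (W 0%N w))%:E) = fine (\int[P]_w (fp (W 0%N w))%:E) -
    fine (\int[P]_w (fn (W 0%N w))%:E))%R by rewrite integralE fpE fnE fineB.
have e2 : (0 < eta / 2)%R by rewrite divr_gt0.
have s1 := iid_slln_dyadic_ge0 mp p0 (esym (fineK ip)) e2.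
have s2 := iid_slln_dyadic_ge0 mn n0 (esym (fineK iN)) e2.
apply: filterS2 s1 s2 => w [K1 K1P] [K2 K2P].
exists (maxn K1 K2) => k; rewrite geq_max => /andP[k1 k2].
have := K1P k k1; have := K2P k k2.
rewrite fE.
have -> : (\sum_(i < 2 ^ k) f (W i w) =
    \sum_(i < 2 ^ k) fp (W i w) - \sum_(i < 2 ^ k) fn (W i w))%R.
  rewrite -sumrB; apply: eq_bigr => i _; rewrite /fp /fn.
  by case: (leP (f (W i w)) 0%R) => h; case: leP => h'; lra.
set a := fine _; set b := fine _; set A := (\sum_(i < _) _)%R; set B := (\sum_(i < _) _)%R.
move=> hb ha.
have -> : (B - A - 2 ^+ k * (b - a) = (B - 2 ^+ k * b) - (A - 2 ^+ k * a))%R by ring.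
apply: (le_trans (ler_normB _ _)); lra.
Qed.
End iid.
End slln.

(** * From the random design to the contraction rate *)

Lemma ler_sum_widen (R : numDomainType) (P : pred nat) (F : nat -> R) m n :
  (m <= n)%N -> (forall i, 0 <= F i) -> \sum_(i < m | P i) F i <= \sum_(i < n | P i) F i.
Proof.
move=> mn F0; rewrite -!(big_mkord P F) (@big_cat_nat _ _ _ m 0%N n) //=.
by rewrite lerDl sumr_ge0.
Qed.

(** * Coercivity of positive definite forms *)

Section coercivity.
Variables (R : realType) (p : nat).
Implicit Types (a u : 'cV[R]_p) (B M : 'M[R]_p).

Definition nrm2 a : R := \sum_j a j ord0 ^+ 2.
Definition sum_norm B : R := \sum_j \sum_k `|B j k|.

Lemma nrm2_ge0 a : 0 <= nrm2 a. Proof. by apply: sumr_ge0 => j _; exact: sqr_ge0. Qed.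

Lemma nrm2_gt0 a : a != 0 -> 0 < nrm2 a.
Proof.
move=> a0; rewrite lt0r nrm2_ge0 andbT; apply: contra a0 => n0.
apply/eqP/matrixP => j z; rewrite ord1 mxE.
have := n0; rewrite psumr_eq0; last by move=> i _; exact: sqr_ge0.
by move=> /allP/(_ j); rewrite mem_index_enum sqrf_eq0 => /(_ isT)/eqP.
Qed.

Lemma sum_norm_ge0 B : 0 <= sum_norm B.
Proof. by apply: sumr_ge0 => j _; exact: sumr_ge0. Qed.

Lemma qf_sum_norm B a : `|qf B a a| <= sum_norm B * nrm2 a.
Proof.
have sqr_le i : a i ord0 ^+ 2 <= nrm2 a.
  by rewrite /nrm2 (bigD1 i) //= lerDl sumr_ge0 // => j _; exact: sqr_ge0.
rewrite qfE mulr_suml; apply: (le_trans (ler_norm_sum _ _ _)); apply: ler_sum => i _.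
rewrite mulr_suml; apply: (le_trans (ler_norm_sum _ _ _)); apply: ler_sum => j _.
rewrite !normrM mulrAC [leRHS]mulrC ler_wpM2r //.
have := sqr_le i; have := sqr_le j.
have e (x : R) : x ^+ 2 = `|x| ^+ 2 by rewrite real_normK ?num_real.
have := sqr_ge0 (`|a i ord0| - `|a j ord0|); rewrite (e (a i ord0)) (e (a j ord0)); nra.
Qed.

(** An explicit constant in place of compactness of the sphere. For $b=M^{-1}a$, positivity of the
    form at $a-b/C$ gives $2|a|^2/C\le a^TMa+b^TMb/C^2$, and $b^TMb=a^TM^{-1}a\le C|a|^2$ once $C$
    exceeds the entry norm of $M^{-1}$. *)
Lemma posdef_coercive M : posdef M -> exists2 C, 0 < C & forall a, nrm2 a <= C * qf M a a.
Proof.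
move=> pM; have uM := posdef_unit pM.
exists (1 + sum_norm (invmx M)); first by rewrite ltr_pwDl // sum_norm_ge0.
set C := 1 + _ => a; have C0 : 0 < C by rewrite ltr_pwDl // sum_norm_ge0.
have nE : (a^T *m a) ord0 ord0 = nrm2 a.
  by rewrite mxE; apply: eq_bigr => j _; rewrite mxE expr2.
set b := invmx M *m a.
have ab : qf M a b = nrm2 a by rewrite /qf /b -mulmxA mulKVmx.
have bb : qf M b b <= C * nrm2 a.
  have -> : qf M b b = qf (invmx M) a a.
    rewrite /qf -mulmxA mulKVmx // /b trmx_mul trmx_inv pM.1 //.
  apply: (le_trans (ler_norm _)); apply: (le_trans (qf_sum_norm _ _)).
  by rewrite ler_wpM2r ?nrm2_ge0 // lerDr.
have := posdef_ge0 (a - C^-1 *: b) pM.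
rewrite !(qfDl, qfDr, qfNl, qfNr, qfZl, qfZr) (qfC b a pM.1) ab.
have : C^-1 * (C^-1 * qf M b b) <= C^-1 * nrm2 a.
  rewrite ler_pM2l ?invr_gt0 //.
  by rewrite -(ler_pM2l C0) mulVKf ?gt_eqF // mulrA mulfV ?gt_eqF // mul1r.
move=> h1 h2; rewrite -ler_pdivrMl //; lra.
Qed.
End coercivity.

(** * A rate bound for one fixed data set *)

Section deterministic_rate.
Variables (R : realType) (p : nat) (v : 'cV[R]_p) (Q : 'M[R]_p)
  (Xs : nat -> 'cV[R]_p) (Ys : nat -> bool).
Hypothesis Qs : Q^T = Q.
Hypothesis Q_ge0 : forall a, 0 <= qf Q a a.

Variables (C U : R) (n k : nat).
Hypothesis C0 : 0 < C.
Hypothesis U0 : 0 <= U.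
Hypothesis nk : (2 ^ k <= n < 2 ^ k.+1)%N.
Hypothesis contr_lb : forall s a,
  2 ^+ k * nrm2 a <= C * \sum_(i < 2 ^ k | contr Xs Ys s i) lin Xs i a ^+ 2.
Hypothesis norm_ub : \sum_(i < 2 ^ k.+1) sum_norm (Xs i *m (Xs i)^T) <= 2 ^+ k * U.

(** Sums of nonnegative terms grow with $n$, so the lower bound is taken at $2^k\le n$ and the upper
    one at $2^{k+1}>n$. Both scale as $2^k$, which cancels in the ratio; the prior is absorbed
    because $2^k\ge 1$. *)
Lemma ac_rate_dyadic :
  ac_rate v Q n Xs Ys <= Num.sqrt (1 - 2 / 3 * (1 + C * (U + sum_norm Q))^-1).
Proof.
have [nk1 nk2] := andP nk.
have qQ a : qf Q a a <= sum_norm Q * nrm2 a.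
  exact: le_trans (ler_norm _) (qf_sum_norm _ _).
have lin_le i a : lin Xs i a ^+ 2 <= sum_norm (Xs i *m (Xs i)^T) * nrm2 a.
  apply: le_trans (qf_sum_norm _ _); apply: le_trans (ler_norm _).
  rewrite /qf mulmxA -mulmxA mxE big_ord1 expr2 -/(lin Xs i a).
  suff -> : (a^T *m Xs i) ord0 ord0 = lin Xs i a by [].
  by rewrite linE mxE; apply: eq_bigr => j _; rewrite mxE mulrC.
have D1 : 1 <= 1 + C * (U + sum_norm Q).
  by rewrite lerDl mulr_ge0 ?addr_ge0 ?sum_norm_ge0 // ltW.
have D0 : 0 < 1 + C * (U + sum_norm Q) by exact: lt_le_trans D1.
have N2E' a : qf (Sigma Q n Xs) a a = \sum_(i < n) lin Xs i a ^+ 2 + qf Q a a by exact: N2E.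
have lb s a : 2 ^+ k * nrm2 a <= C * \sum_(i < n | contr Xs Ys s i) lin Xs i a ^+ 2.
  apply: (le_trans (contr_lb s a)); rewrite ler_pM2l //.
  by apply: (@ler_sum_widen _ (contr Xs Ys s) (fun i => lin Xs i a ^+ 2)) => // i; exact: sqr_ge0.
have ub a : qf (Sigma Q n Xs) a a <= 2 ^+ k * ((U + sum_norm Q) * nrm2 a).
  rewrite N2E'; apply: (@le_trans _ _ (2 ^+ k * U * nrm2 a + sum_norm Q * nrm2 a)).
    apply: lerD; last exact: qQ.
    apply: (@le_trans _ _ (\sum_(i < 2 ^ k.+1) sum_norm (Xs i *m (Xs i)^T) * nrm2 a)); last first.
      by rewrite -mulr_suml ler_wpM2r ?nrm2_ge0.
    apply: (@le_trans _ _ (\sum_(i < 2 ^ k.+1) lin Xs i a ^+ 2)); last exact: ler_sum.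
    apply: (@ler_sum_widen _ xpredT (fun i => lin Xs i a ^+ 2)); first exact: ltnW.
    by move=> i; exact: sqr_ge0.
  rewrite (mulrDl U) mulrDr mulrA lerD2l -[leLHS]mul1r ler_wpM2r //.
    by rewrite mulr_ge0 ?sum_norm_ge0 ?nrm2_ge0.
  by rewrite exprn_ege1 // ler1n.
have Spd : posdef (Sigma Q n Xs).
  split; first by rewrite /Sigma linearD /= trmx_mul trmxK Qs.
  move=> u u0; rewrite -/(qf _ u u) N2E' ltr_pwDl //.
  have := lb (fun=> true) u; have n0 := nrm2_gt0 u0.
  have : 0 < (2 ^+ k : R) * nrm2 u by rewrite mulr_gt0 // exprn_gt0.
  move=> h1 /(lt_le_trans h1); rewrite pmulr_rgt0 // => h2; apply: (lt_le_trans h2).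
  rewrite [leLHS]big_mkcond; apply: ler_sum => i _; case: ifP => // _; exact: sqr_ge0.
(* Here [eps] is $(1+C(U+|Q|))^{-1}$; the added $1$ makes the denominator positive and [eps] at most
   one. *)
apply: ac_rate_le => //.
- by rewrite invr_gt0.
- by rewrite invf_le1.
move=> s a; rewrite ler_pdivrMl //; apply: (le_trans (ub a)).
have := lb s a; set sm := \sum_(i < n | _) _ => h.
have sm0 : 0 <= sm by apply: sumr_ge0 => i _; exact: sqr_ge0.
rewrite mulrCA; apply: le_trans (ler_wpM2l _ h) _; first by rewrite addr_ge0 ?sum_norm_ge0.
rewrite mulrCA mulrA mulrDl mul1r; lra.
Qed.
End deterministic_rate.

Section zero_integral.
Context d (Omega : measurableType d) (R : realType) (P : probability Omega R).

Lemma integral0_support (h : Omega -> R) : measurable_fun setT h -> (forall w, 0 <= h w) ->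
  (\int[P]_w (h w)%:E = 0)%E -> P [set w | h w != 0] = 0%E.
Proof.
move=> mh h0 Ih; have mh' : measurable_fun setT (fun w => (h w)%:E) by exact/measurable_EFinP.
have : ae_eq P setT (fun w => (h w)%:E) (cst 0%E).
  apply/(ae_eq_integral_abs P measurableT mh'); rewrite -[RHS]Ih.
  by apply: eq_integral => w _; rewrite gee0_abs // lee_fin.
have mS : measurable [set w | h w != 0].
  have := mh measurableT _ (measurableC (measurable_set1 (0 : R))); rewrite setTI.
  by congr measurable; apply/seteqP; split => w /= /eqP.
move=> ae0; apply/(negligibleP P mS); apply: negligibleS ae0 => w /= hw H.
by move/eqP: hw; apply; have := H I; case.
Qed.
End zero_integral.

(** * The random design: moments of the contracting observations *)

Section random_design.
Context (R : realType) (p : nat) (d : measure_display) (Omega : measurableType d)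
  (P : probability Omega R) (X : nat -> Omega -> 'cV[R]_p) (Y : nat -> Omega -> bool)
  (G : 'cV[R]_p -> R).
Hypothesis hXm : forall i B, borelRk p B -> measurable (X i @^-1` B).
Hypothesis hYm : forall i, measurable [set w | Y i w].
Hypothesis hindep : forall s : seq nat, uniq s ->
  forall B0 B1 : nat -> set 'cV[R]_p, (forall i, borelRk p (B0 i) /\ borelRk p (B1 i)) ->
  P (\bigcap_(i in [set i | i \in s]) pair_event X Y i (B0 i) (B1 i)) =
  (\prod_(i <- s) P (pair_event X Y i (B0 i) (B1 i)))%E.
Hypothesis hident : forall i B0 B1, borelRk p B0 -> borelRk p B1 ->
  P (pair_event X Y i B0 B1) = P (pair_event X Y 0 B0 B1).
Hypothesis hGm : forall A : set R, measurable A -> borelRk p (G @^-1` A).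
Hypothesis hG01 : forall x, 0 < G x < 1.
Hypothesis hcond : forall i B, borelRk p B ->
  P [set w | Y i w /\ B (X i w)] = (\int[P]_w (G (X i w) * \1_B (X i w))%:E)%E.
Hypothesis hA2fin : forall j k : 'I_p,
  P.-integrable setT (fun w => (X 0%N w j ord0 * X 0%N w k ord0)%:E).
Hypothesis hA3 : forall (s : 'I_p -> bool) (beta : 'cV[R]_p), beta != 0 ->
  (0 < P [set w | ((\1_(orthant s) (X 0%N w) + \1_(orthant s) (- X 0%N w))
                   * ((X 0%N w)^T *m beta) ord0 ord0 != 0)%R])%E.

Let mX i : measurable_fun setT (X i : Omega -> Vk R p).
Proof. by move=> _ B mB; rewrite setTI; exact: hXm. Qed.

Let mY i : measurable_fun setT (Y i).
Proof.
apply: (measurable_fun_bool true); rewrite setTI.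
by have := hYm i; congr measurable; apply/seteqP; split.
Qed.

Let W i w : Vk R p * bool := (X i w, Y i w).

Let mW i : measurable_fun setT (W i).
Proof. exact: measurable_fun_pair. Qed.

Let sec (A : set (Vk R p * bool)) y : set 'cV[R]_p := [set x | A (x, y)].

Let msec A y : measurable A -> borelRk p (sec A y).
Proof.
move=> mA; have := @measurable_ysection _ _ (Vk R p) bool A y mA.
by congr (_ _); apply/seteqP; split => x; rewrite /ysection /= inE.
Qed.

Let WE i A : W i @^-1` A = pair_event X Y i (sec A false) (sec A true).
Proof. by apply/seteqP; split => w; rewrite /pair_event /W /=; case: (Y i w). Qed.

Let W_ident i A : measurable A -> P (W i @^-1` A) = P (W 0%N @^-1` A).
Proof. by move=> mA; rewrite !WE hident //; exact: msec. Qed.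

(** The independence hypothesis for the family of two indices, each measurable set of pairs being
    cut into its sections over the two values of $Y$. *)
Let W_indep i j A B : i != j -> measurable A -> measurable B ->
  P (W i @^-1` A `&` W j @^-1` B) = (P (W i @^-1` A) * P (W j @^-1` B))%E.
Proof.
move=> ij mA mB.
pose Bs b n := if n == i then sec A b else sec B b.
have := @hindep [:: i; j] _ (Bs false) (Bs true); rewrite /= inE ij => /(_ isT) h.
have {}h := h (fun n => _); rewrite !big_cons big_nil mule1 /Bs eqxx (negPf (_ : j != i)) in h; last by rewrite eq_sym.
rewrite !WE -h; last by move=> n; split; case: ifP => _; exact: msec.
congr (P _); apply/seteqP; split => [w [wi wj] n /=|w h'].
  rewrite !inE => /orP[] /eqP ->; first by rewrite eqxx.
  by rewrite eq_sym (negPf ij).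
split; first by have := h' i; rewrite /= !inE eqxx => /(_ isT).
by have := h' j; rewrite /= !inE eqxx orbT eq_sym (negPf ij) => /(_ isT).
Qed.

Definition contr_pt (s : 'I_p -> bool) (t : 'cV[R]_p * bool) : bool :=
  if t.2 then - t.1 \in orthant s else t.1 \in orthant s.

Let mcoord j : measurable_fun setT (fun x : Vk R p => x j ord0 : R).
Proof. exact: measurable_coord. Qed.

Lemma measurable_orthant s : borelRk p (orthant s : set 'cV[R]_p).
Proof.
pose o (x : 'cV[R]_p) : R := \prod_j (if s j then (0 < x j ord0)%R%:R else (x j ord0 < 0)%R%:R).
have mo : measurable_fun setT (o : Vk R p -> R).
  apply: measurable_prod => j _; case: (s j).
    rewrite (_ : (fun x : Vk R p => _) = (fun x : Vk R p => if 0 < x j ord0 :> R then 1 else 0)).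
      by apply: measurable_fun_ifT => //; exact: measurable_fun_ltr.
    by apply/funext => x; case: ltP.
  rewrite (_ : (fun x : Vk R p => _) = (fun x : Vk R p => if x j ord0 < 0 :> R then 1 else 0)).
    by apply: measurable_fun_ifT => //; exact: measurable_fun_ltr.
  by apply/funext => x; case: ltP.
have := mo measurableT _ (measurableC (measurable_set1 (0 : R))); rewrite setTI.
congr (_ _); apply/seteqP; split => x /=.
  move=> o0 j; have : o x != 0 by apply/eqP.
  rewrite /o prodf_seq_neq0 => /allP/(_ j); rewrite mem_index_enum => /(_ isT) /=.
  by case: (s j); case: ltP; rewrite ?eqxx.
move=> xs; apply/eqP; rewrite prodf_seq_neq0; apply/allP => j _ /=.
by have := xs j; case: (s j) => ->; rewrite oner_eq0.
Qed.


Let mcontr s : measurable_fun setT (contr_pt s : Vk R p * bool -> bool).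
Proof.
have mo (h : Vk R p * bool -> Vk R p) : measurable_fun setT h ->
    measurable_fun setT (fun t => h t \in orthant s).
  move=> mh; apply: (measurable_fun_bool true); rewrite setTI.
  have := mh measurableT _ (measurable_orthant s); rewrite setTI.
  by congr measurable; apply/seteqP; split => t /= ht; [exact: mem_set|exact: set_mem].
apply: measurable_fun_ifT; first exact: measurable_snd.
  apply: mo; apply: measurable_toVk => j; under eq_fun do rewrite mxE.
  by apply: measurableT_comp => //; exact: (measurableT_comp (mcoord j) measurable_fst).
by apply: mo; exact: measurable_fst.
Qed.

Definition contr_entry s j k (t : 'cV[R]_p * bool) : R :=
  (contr_pt s t)%:R * (t.1 j ord0 * t.1 k ord0).

Let m_indic (b : Vk R p * bool -> bool) : measurable_fun setT b ->
  measurable_fun setT (fun t => (b t)%:R : R).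
Proof.
move=> mb; rewrite (_ : (fun t => _) = (fun t => if b t then 1 else 0)).
  by apply: measurable_fun_ifT.
by apply/funext => t; case: (b t).
Qed.

Let mentry s j k : measurable_fun setT (contr_entry s j k : Vk R p * bool -> R).
Proof.
apply: measurable_funM; first exact: (m_indic (mcontr s)).
by apply: measurable_funM; exact: (measurableT_comp (mcoord _) measurable_fst).
Qed.

Let entry_int s j k : P.-integrable setT (fun w => (contr_entry s j k (W 0%N w))%:E).
Proof.
apply: (le_integrable measurableT _ _ (hA2fin j k)).
  by apply/measurable_EFinP; exact: (measurableT_comp (mentry s j k) (mW 0)).
move=> w _; rewrite !abse_EFin lee_fin /contr_entry normrM ler_piMl //.
by case: contr_pt; rewrite ?normr1 ?normr0.
Qed.

(** The matrix $E[1_{S}((1-2Y)X)\,XX^T]$ for the orthant $S$ coded by [s], the almost sure limit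
    along $2^k$ of the normalized Gram matrix of the contracting observations. *)
Definition contr_mx s : 'M[R]_p :=
  \matrix_(j, k) fine (\int[P]_w (contr_entry s j k (W 0%N w))%:E)%E.

Let dot (x a : 'cV[R]_p) : R := (x^T *m a) ord0 ord0.

Let dotE x a : dot x a = \sum_j x j ord0 * a j ord0.
Proof. by rewrite /dot mxE; apply: eq_bigr => j _; rewrite mxE. Qed.

Let sum_entry s (a : 'cV[R]_p) (t : 'cV[R]_p * bool) :
  \sum_j \sum_k a j ord0 * contr_entry s j k t * a k ord0 = (contr_pt s t)%:R * dot t.1 a ^+ 2.
Proof.
rewrite expr2 dotE mulr_suml mulr_sumr; apply: eq_bigr => j _.
rewrite mulr_sumr mulr_sumr; apply: eq_bigr => k _; rewrite /contr_entry; ring.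
Qed.

Lemma qf_contr_mx s a : (qf (contr_mx s) a a)%:E =
  (\int[P]_w ((contr_pt s (W 0%N w))%:R * dot (X 0%N w) a ^+ 2)%:E)%E.
Proof.
have ei j k : P.-integrable setT (fun w => (a j ord0 * contr_entry s j k (W 0%N w) * a k ord0)%:E).
  rewrite (_ : (fun w => _) = (fun w => (a j ord0 * a k ord0)%:E * (contr_entry s j k (W 0%N w))%:E)%E).
    exact: integrableZl.
  by apply/funext => w; rewrite -EFinM mulrAC.
under eq_integral do rewrite -(sum_entry s a (W 0%N _)) -sumEFin.
rewrite integral_sum //; last first.
  by move=> j; under eq_fun do rewrite -sumEFin; exact: integrable_sum.
rewrite qfE -sumEFin; apply: eq_bigr => j _.
under eq_integral do rewrite -sumEFin.
rewrite integral_sum // -sumEFin; apply: eq_bigr => k _.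
under eq_integral do rewrite mulrAC EFinM.
rewrite integralZl // mxE mulrAC EFinM fineK //.
exact: integrable_fin_num.
Qed.

Let mdot a : measurable_fun setT (fun x : Vk R p => dot x a).
Proof.
under eq_fun do rewrite dotE; apply: measurable_sum => j; exact: measurable_funM.
Qed.

Let mG : measurable_fun setT (G : Vk R p -> R).
Proof. by move=> _ B mB; rewrite setTI; exact: hGm. Qed.

Lemma posdef_contr_mx s : posdef (contr_mx s).
Proof.
split.
  apply/matrixP => j k; rewrite !mxE; congr fine; apply: eq_integral => w _.
  by rewrite /contr_entry [X in _ * X]mulrC.
move=> a a0; rewrite -/(qf _ a a) -lte_fin qf_contr_mx.
set h := fun w => (contr_pt s (W 0%N w))%:R * dot (X 0%N w) a ^+ 2.
have h0 w : 0 <= h w by rewrite /h mulr_ge0 // sqr_ge0.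
have mh : measurable_fun setT h.
  apply: measurable_funM.
    exact: (measurableT_comp (m_indic (mcontr s)) (mW 0)).
  by apply: measurable_funX; exact: (measurableT_comp (mdot a) (mX 0)).
have I0 : (0 <= \int[P]_w (h w)%:E)%E by apply: integral_ge0 => w _; rewrite lee_fin.
rewrite lt_neqAle I0 andbT; apply/eqP => /esym Ih; have Ph := integral0_support mh h0 Ih.
pose D1 : set 'cV[R]_p := orthant s `&` [set x | dot x a != 0].
pose D2 : set 'cV[R]_p := [set x | orthant s (- x)] `&` [set x | dot x a != 0].
have mdn : borelRk p [set x | dot x a != 0].
  have := mdot a measurableT (measurableC (measurable_set1 (0 : R))); rewrite setTI.
  by congr (_ _); apply/seteqP; split => x /= /eqP.
have moS : borelRk p [set x : 'cV[R]_p | orthant s (- x)].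
  have mN : measurable_fun setT (fun x : Vk R p => - (x : 'cV[R]_p) : Vk R p).
    by apply: measurable_toVk => j; under eq_fun do rewrite mxE; exact: measurableT_comp.
  by have := mN measurableT _ (measurable_orthant s); rewrite setTI.
have mD1 : borelRk p D1 by apply: (@measurableI _ (Vk R p)) => //; exact: measurable_orthant.
have mD2 : borelRk p D2 by exact: (@measurableI _ (Vk R p)).
have mX1 := hXm 0 mD1; have mX2 := hXm 0 mD2.
have mN0 : measurable [set w | h w != 0].
  have := mh measurableT _ (measurableC (measurable_set1 (0 : R))); rewrite setTI.
  by congr measurable; apply/seteqP; split => w /= /eqP.
have mYD (D : set 'cV[R]_p) : borelRk p D -> measurable [set w | Y 0 w /\ D (X 0%N w)].
  by move=> mD; exact: measurableI (hYm 0) (hXm 0 mD).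
have mGD (D : set 'cV[R]_p) : borelRk p D -> measurable_fun setT (fun w => G (X 0%N w) * \1_D (X 0%N w)).
  move=> mD; apply: measurable_funM; first exact: (measurableT_comp mG (mX 0)).
  exact: (measurableT_comp (@measurable_indic _ (Vk R p) R setT D mD) (mX 0)).
have GD0 (D : set 'cV[R]_p) w : 0 <= G (X 0%N w) * \1_D (X 0%N w).
  by rewrite mulr_ge0 //; have /andP[/ltW] := hG01 (X 0%N w).
have P2 : P (X 0%N @^-1` D2) = 0%E.
  have : P [set w | Y 0%N w /\ D2 (X 0%N w)] = 0%E.
    apply: (subset_measure0 _ mN0 _ Ph); first exact: mYD.
    move=> w /= [Yw [xs xa]]; rewrite /h /contr_pt /= Yw mem_set // mul1r.
    by rewrite expf_neq0.
  rewrite hcond // => /(integral0_support (mGD _ mD2) (GD0 _)).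
  congr (P _ = _); apply/seteqP; split => w /=.
    by case: (pselect (D2 (X 0%N w))) => // nD; rewrite indicE memNset // mulr0 eqxx.
  move=> Dw; rewrite indicE mem_set // mulr1 gt_eqF //.
  by have /andP[] := hG01 (X 0%N w).
have P1 : P (X 0%N @^-1` D1) = 0%E.
  have E1 : P (X 0%N @^-1` D1 `\` [set w | Y 0%N w]) = 0%E.
    apply: (subset_measure0 _ mN0 _ Ph); first exact: measurableD.
    move=> w /= [[xs xa] Yw]; rewrite /h /contr_pt /=; move/negP/negbTE: Yw => ->.
    by rewrite mem_set // mul1r expf_neq0.
  have m1 : measurable_fun setT (fun w => (1 - G (X 0%N w)) * \1_D1 (X 0%N w)).
    apply: measurable_funM.
      by apply: measurable_funB => //; exact: (measurableT_comp mG (mX 0)).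
    exact: (measurableT_comp (@measurable_indic _ (Vk R p) R setT D1 mD1) (mX 0)).
  have h1 w : 0 <= (1 - G (X 0%N w)) * \1_D1 (X 0%N w).
    by rewrite mulr_ge0 // subr_ge0; have /andP[_ /ltW] := hG01 (X 0%N w).
  (* The hypothesis [hcond] speaks of $Y=1$ only. Since $Y=0$ has probability zero on [D1], all the
     mass of [D1] is carried by $Y=1$, and subtracting leaves $\int(1-G)1_{D_1}=0$. *)
  have le1 : (P (X 0%N @^-1` D1) <= \int[P]_w (G (X 0%N w) * \1_D1 (X 0%N w))%:E)%E.
    rewrite -hcond // -[leRHS]add0e -E1.
    have mYD1 := mYD _ mD1; have mX1Y := measurableD mX1 (hYm 0).
    apply: (le_trans _ (measureU2 P mX1Y mYD1)); apply: le_measure; rewrite ?inE //.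
      exact: measurableU.
    by move=> w Dw; case: (pselect (Y 0%N w)) => Yw; [right|left].
  have eq1 : P (X 0%N @^-1` D1) = (\int[P]_w ((1 - G (X 0%N w)) * \1_D1 (X 0%N w))%:E +
      \int[P]_w (G (X 0%N w) * \1_D1 (X 0%N w))%:E)%E.
    rewrite -ge0_integralD //; last 4 first.
    - by move=> w _; rewrite lee_fin.
    - exact/measurable_EFinP.
    - by move=> w _; rewrite lee_fin.
    - by apply/measurable_EFinP; exact: mGD.
    rewrite -[X in P X]setIT -integral_indic //; apply: eq_integral => w _.
    by rewrite -EFinD -mulrDl subrK mul1r.
  have I1 : (\int[P]_w ((1 - G (X 0%N w)) * \1_D1 (X 0%N w))%:E = 0)%E.
    apply/eqP; rewrite eq_le integral_ge0 ?andbT; last by move=> w _; rewrite lee_fin.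
    have fG : (\int[P]_w (G (X 0%N w) * \1_D1 (X 0%N w))%:E)%E \is a fin_num.
      by rewrite -hcond //; apply: fin_num_measure; exact: mYD.
    by move: le1; rewrite eq1 -[leRHS]add0e leeD2rE.
  have := integral0_support m1 h1 I1.
  congr (P _ = _); apply/seteqP; split => w /=.
    by case: (pselect (D1 (X 0%N w))) => // nD; rewrite indicE memNset // mulr0 eqxx.
  move=> Dw; rewrite indicE mem_set // mulr1 gt_eqF // subr_gt0.
  by have /andP[] := hG01 (X 0%N w).
have := hA3 s a0; rewrite -/(dot _ _).
suff -> : P [set w | ((\1_(orthant s) (X 0%N w) + \1_(orthant s) (- X 0%N w)) *
    ((X 0%N w)^T *m a) ord0 ord0 != 0)] = 0%E by rewrite ltxx.
have -> : [set w | ((\1_(orthant s) (X 0%N w) + \1_(orthant s) (- X 0%N w)) *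
    ((X 0%N w)^T *m a) ord0 ord0 != 0)] = X 0%N @^-1` D1 `|` X 0%N @^-1` D2.
  apply/seteqP; split => w /=.
    rewrite mulf_eq0 negb_or !indicE => /andP[h1 h2].
    case: (pselect (orthant s (X 0%N w))) => o1; first by left.
    right; split => //; apply: contrapT => o2; move: h1.
    by rewrite !memNset // addr0 eqxx.
  rewrite !indicE => -[] [oS da]; rewrite mulf_neq0 //.
    by rewrite (mem_set oS) gt_eqF // ltr_pwDl // ler0n.
  have -> : (- X 0%N w \in orthant s) = true by exact: mem_set.
  by rewrite gt_eqF // ltr_wpDl.
by rewrite measureU0.
Qed.


Definition outer_norm (t : 'cV[R]_p * bool) : R := sum_norm (t.1 *m t.1^T).

Let outer_normE t : outer_norm t = \sum_j \sum_k `|t.1 j ord0 * t.1 k ord0|.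
Proof.
apply: eq_bigr => j _; apply: eq_bigr => k _.
by rewrite mxE big_ord1 [_^T _ _]mxE.
Qed.

Let m_outer_norm : measurable_fun setT (outer_norm : Vk R p * bool -> R).
Proof.
rewrite (funext outer_normE); apply: measurable_sum => j; apply: measurable_sum => k.
apply: measurableT_comp => //.
by apply: measurable_funM; exact: (measurableT_comp (mcoord _) measurable_fst).
Qed.

Let outer_norm_int : P.-integrable setT (fun w => (outer_norm (W 0%N w))%:E).
Proof.
under eq_fun do rewrite outer_normE -sumEFin.
apply: integrable_sum => // j _; under eq_fun do rewrite -sumEFin.
apply: integrable_sum => // k _.
exact: (integrable_norm (hA2fin j k)).
Qed.

(** Closeness of the entries within [eta] perturbs the form by at most $\eta p^22^k|a|^2$. The
    smallness of [eta] keeps this below half of the limiting lower bound, hence the constant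
    $2C$. *)
Lemma contr_lb_dyadic (C eta : R) s (w : Omega) k a : 0 < C ->
  eta * (p * p)%:R * C <= 1 / 2 ->
  (forall b, nrm2 b <= C * qf (contr_mx s) b b) ->
  (forall i j, `|\sum_(l < 2 ^ k) contr_entry s i j (W l w) - 2 ^+ k * contr_mx s i j| <= eta * 2 ^+ k) ->
  2 ^+ k * nrm2 a <= 2 * C * \sum_(l < 2 ^ k | contr (X^~ w) (Y^~ w) s l) lin (X^~ w) l a ^+ 2.
Proof.
move=> C0 etaC hC close.
pose Mh : 'M[R]_p := \matrix_(i, j) \sum_(l < 2 ^ k) contr_entry s i j (W l w).
have MhE : qf Mh a a = \sum_(l < 2 ^ k | contr (X^~ w) (Y^~ w) s l) lin (X^~ w) l a ^+ 2.
  rewrite qfE [RHS]big_mkcond /=.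
  rewrite (eq_bigr (fun l : 'I_(2 ^ k) => \sum_i \sum_j a i ord0 * contr_entry s i j (W l w) * a j ord0)); last first.
    move=> l _; rewrite sum_entry /contr /contr_pt /W /=.
    by case: (if Y l w then - X l w \in orthant s else X l w \in orthant s); rewrite ?mul1r ?mul0r.
  rewrite [RHS]exchange_big /=; apply: eq_bigr => i _.
  rewrite [RHS]exchange_big /=; apply: eq_bigr => j _.
  by rewrite mxE mulr_sumr mulr_suml.
rewrite -MhE.
set D : 'M[R]_p := Mh - 2 ^+ k *: contr_mx s.
have qD : qf Mh a a = qf D a a + 2 ^+ k * qf (contr_mx s) a a.
  rewrite -(subrK (2 ^+ k *: contr_mx s) Mh) qfDm -/D; congr (_ + _).
  by rewrite /qf -scalemxAr -scalemxAl mxE.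
have sD : sum_norm D <= eta * 2 ^+ k * (p * p)%:R.
  apply: (@le_trans _ _ (\sum_(i < p) \sum_(j < p) eta * 2 ^+ k)).
    apply: ler_sum => i _; apply: ler_sum => j _.
    by have := close i j; rewrite !mxE.
  by rewrite !sumr_const !card_ord -mulrnA mulr_natr.
have := qf_sum_norm D a; rewrite ler_norml => /andP[lD _].
have := ler_wpM2r (nrm2_ge0 a) sD; have := hC a.
have k0 : 0 < 2 ^+ k :> R by rewrite exprn_gt0.
move=> h1 h2.
have h3 : 2 ^+ k * nrm2 a <= C * (2 ^+ k * qf (contr_mx s) a a).
  by rewrite mulrCA ler_pM2l.
have h4 : C * (sum_norm D * nrm2 a) <= 2 ^+ k * nrm2 a / 2.
  apply: (@le_trans _ _ (C * (eta * 2 ^+ k * (p * p)%:R * nrm2 a))); first by rewrite ler_pM2l.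
  have -> : C * (eta * 2 ^+ k * (p * p)%:R * nrm2 a) = 2 ^+ k * nrm2 a * (eta * (p * p)%:R * C) by ring.
  by rewrite ler_wpM2l ?mulr_ge0 ?nrm2_ge0 ?(ltW k0) // -[2^-1]mul1r.
have h5 : - (C * (sum_norm D * nrm2 a)) <= C * qf D a a by rewrite -mulrN ler_pM2l.
rewrite qD -mulrA mulrDr; lra.
Qed.

Variables (v : 'cV[R]_p) (Q : 'M[R]_p).
Hypothesis hQ : posdef Q \/ Q = 0.

Lemma ac_rate_limsup : exists rho : R, rho < 1 /\
  {ae P, forall w, (limn_esup (fun n => (ac_rate v Q n (X^~ w) (Y^~ w))%:E) <= rho%:E)%E}.
Proof.
have Qs : Q^T = Q by case: hQ => [[]//|->]; rewrite trmx0.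
have Q0 a : 0 <= qf Q a a.
  by case: hQ => [/(posdef_ge0 a)//|->]; rewrite /qf mulmx0 mul0mx mxE.
pose Cs s := sval (cid2 (posdef_coercive (posdef_contr_mx s))).
have CsP s : 0 < Cs s /\ forall a, nrm2 a <= Cs s * qf (contr_mx s) a a.
  by rewrite /Cs; case: cid2.
(* Finite functions make the orthants a finite type: one constant serves them all, and the almost
   sure events can be intersected over them. *)
pose C := \sum_(s : {ffun 'I_p -> bool}) Cs s.
have C0 : 0 < C.
  rewrite /C (bigD1 [ffun=> true]) //= ltr_pwDl ?(CsP _).1 //.
  by apply: sumr_ge0 => s _; exact/ltW/(CsP s).1.
have CP (s : {ffun 'I_p -> bool}) a : nrm2 a <= C * qf (contr_mx s) a a.
  apply: (le_trans ((CsP s).2 a)); rewrite ler_wpM2r //.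
    exact: posdef_ge0 (posdef_contr_mx s).
  rewrite /C (bigD1 s) //= lerDl; apply: sumr_ge0 => t _; exact/ltW/(CsP t).1.
(* Chosen so that $\eta p^2C\le 1/2$. *)
pose eta : R := (2 * C * (p * p).+1%:R)^-1.
have eta0 : 0 < eta by rewrite invr_gt0 !mulr_gt0.
have etaC : eta * (p * p)%:R * C <= 1 / 2.
  have p0 : 0 < (p * p).+1%:R :> R by [].
  have -> : eta * (p * p)%:R * C = (p * p)%:R / (p * p).+1%:R / 2.
    by rewrite /eta; field; rewrite gt_eqF // gt_eqF.
  by rewrite ler_pM2r // ler_pdivrMr // mul1r ler_nat.
pose U0 := fine (\int[P]_w (outer_norm (W 0%N w))%:E)%E.
have U00 : 0 <= U0.
  by apply: fine_ge0; apply: integral_ge0 => w _; rewrite lee_fin sum_norm_ge0.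
(* The strong law with tolerance one bounds the sum up to $2^{k+1}$ by $2^{k+1}(U_0+1)=2^kU$. *)
pose U := 2 * (U0 + 1).
have U_ge0 : 0 <= U by rewrite mulr_ge0 // addr_ge0.
pose D := 1 + 2 * C * (U + sum_norm Q).
have D0 : 0 < D by rewrite ltr_pwDl // !mulr_ge0 ?addr_ge0 ?sum_norm_ge0 // ltW.
exists (Num.sqrt (1 - 2 / 3 * D^-1)); split.
  rewrite -[ltRHS]sqrtr1 ltr_sqrt //.
  have : 0 < D^-1 by rewrite invr_gt0.
  by lra.
have ae1 : {ae P, forall w, forall sij : {ffun 'I_p -> bool} * 'I_p * 'I_p,
    \forall k \near \oo, `|\sum_(l < 2 ^ k) contr_entry sij.1.1 sij.1.2 sij.2 (W l w) -
      2 ^+ k * contr_mx sij.1.1 sij.1.2 sij.2| <= eta * 2 ^+ k}.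
  apply: filter_forall => -[[s i] j] /=.
  have := iid_slln_dyadic mW W_indep W_ident (mentry s i j) (entry_int s i j) eta0.
  apply: filterS => w [K KP]; exists K => // k /= Kk.
  by rewrite mxE; exact: KP.
have ae2 := iid_slln_dyadic mW W_indep W_ident m_outer_norm outer_norm_int ltr01.
apply: filterS2 ae1 ae2 => w h1 [K1 K1P].
move/filter_forall: h1 => [K2 _ K2P].
rewrite limn_esup_lim; apply: lime_le; first exact: is_cvg_esups.
exists (2 ^ maxn K1 K2)%N => // m /= mK; apply: ge_ereal_sup => _ [n /= mn <-].
rewrite lee_fin.
have n0 : (0 < n)%N by apply: leq_trans (leq_trans mK mn); rewrite expn_gt0.
(* The dyadic scale of $n$. It passes both thresholds as soon as $n\ge 2^{\max(K_1,K_2)}$, so the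
   bound holds for every large $n$ and not only for powers of two. *)
have nk := trunc_log_bounds (isT : (1 < 2)%N) n0.
have Kk : (maxn K1 K2 <= trunc_log 2 n)%N.
  by rewrite -ltnS -(ltn_exp2l _ _ (isT : (1 < 2)%N)); apply: leq_ltn_trans (leq_trans mK mn) _; case/andP: nk.
move: nk Kk; set k := trunc_log 2 n => nk; rewrite geq_max => /andP[k1 k2].
apply: (ac_rate_dyadic v Qs Q0 _ U_ge0 nk); first by rewrite mulr_gt0.
  move=> s a.
  have -> : s = [ffun j => s j] by apply/funext => j; rewrite ffunE.
  apply: contr_lb_dyadic C0 etaC (CP _) _ => i j.
  exact: (K2P k k2 ([ffun j => s j], i, j)).
have := K1P k.+1 (leqW k1); rewrite -/U0 ler_norml => /andP[_ ub].
have -> : 2 ^+ k * U = 1 * 2 ^+ k.+1 + 2 ^+ k.+1 * U0 by rewrite /U exprS; ring.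
by rewrite -lerBlDr.
Qed.

End random_design.

Theorem theorem2 (R : realType) (p : nat) (hp : (1 <= p)%N)
  (v : 'cV[R]_p) (Q : 'M[R]_p) (hQ : posdef Q \/ Q = 0)
  (d : measure_display) (Omega : measurableType d) (P : probability Omega R)
  (X : nat -> Omega -> 'cV[R]_p) (Y : nat -> Omega -> bool)
  (G : 'cV[R]_p -> R)
  (* X_i and Y_i are random variables *)
  (hXm : forall i B, borelRk p B -> measurable (X i @^-1` B))
  (hYm : forall i, measurable [set w | Y i w])
  (* (A1) the pairs (X_i, Y_i) are independent ... *)
  (hindep : forall s : seq nat, uniq s ->
     forall B0 B1 : nat -> set 'cV[R]_p,
       (forall i, borelRk p (B0 i) /\ borelRk p (B1 i)) ->
       P (\bigcap_(i in [set i | i \in s]) pair_event X Y i (B0 i) (B1 i))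
       = (\prod_(i <- s) P (pair_event X Y i (B0 i) (B1 i)))%E)
  (* ... identically distributed ... *)
  (hident : forall i B0 B1, borelRk p B0 -> borelRk p B1 ->
       P (pair_event X Y i B0 B1) = P (pair_event X Y 0 B0 B1))
  (* ... and Y_i | X_i ~ Bernoulli(G(X_i)) with G measurable, (0,1)-valued *)
  (hGm : forall A : set R, measurable A -> borelRk p (G @^-1` A))
  (hG01 : forall x, 0 < G x < 1)
  (hcond : forall i B, borelRk p B ->
       P [set w | Y i w /\ B (X i w)]
       = (\int[P]_w (G (X i w) * \1_B (X i w))%:E)%E)
  (* (A2) E X_1 X_1^T is finite and positive definite *)
  (hA2fin : forall j k : 'I_p,
       P.-integrable setT (fun w => (X 0%N w j ord0 * X 0%N w k ord0)%:E))
  (hA2pd : posdef (\matrix_(j < p, k < p)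
       fine (\int[P]_w (X 0%N w j ord0 * X 0%N w k ord0)%:E)%E))
  (* (A3) *)
  (hA3 : forall (s : 'I_p -> bool) (beta : 'cV[R]_p), beta != 0 ->
       (0 < P [set w | ((\1_(orthant s) (X 0%N w) + \1_(orthant s) (- X 0%N w))
                        * ((X 0%N w)^T *m beta) ord0 ord0 != 0)%R])%E) :
  exists rho : R, rho < 1 /\
    {ae P, forall w,
      (limn_esup (fun n => (ac_rate v Q n (fun i => X i w) (fun i => Y i w))%:E)
         <= rho%:E)%E}.
Proof.
exact: (ac_rate_limsup hXm hYm hindep hident hGm hG01 hcond hA2fin hA3 v hQ).
Qed.
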